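(* There exist constants $C_W,C_{BL},\gamma_W,\gamma_{BL},\delta,C,b>0$, independent of $\mu$ and $\varepsilon$, such that for all $0<\varepsilon\le\mu\le1$ the solution $\mathbf U$ of $L_{\varepsilon,\mu}\mathbf U=\mathbf F$ in $I$, $\mathbf U(0)=\mathbf U(1)=0$, can be written as $\mathbf U=\mathbf W+\widetilde{\mathbf U}_{BL}+\mathbf R$, where $\mathbf W\in\mathcal A(1,C_W,\gamma_W)$, $\widetilde{\mathbf U}_{BL}\in\mathcal{BL}^2(\delta\mu,C_{BL},\gamma_{BL}\,\mu/\varepsilon)$, and $$\|\mathbf R\|_{L^\infty(\partial I)}+\|L_{\varepsilon,\mu}\mathbf R\|_{L^2(I)}\le C\Big(\frac\mu\varepsilon\Big)^2e^{-b/\mu}.$$ In particular, $\|\mathbf R\|_{E,I}\le C(\mu/\varepsilon)^2e^{-b/\mu}$.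
   Context: $I=(0,1)$, $\partial I=\{0,1\}$. Fixed real data: $\mathbf F=(f,g)^T$ and $\mathbf A(x)=(a_{ij}(x))_{i,j=1,2}$ with $f,g,a_{ij}$ analytic on $[0,1]$: for some constants $C_f,\gamma_f,C_g,\gamma_g,C_a,\gamma_a>0$ and all $n\in\mathbb N_0$, $\|f^{(n)}\|_{L^\infty(I)}\le C_f\gamma_f^n n!$, $\|g^{(n)}\|_{L^\infty(I)}\le C_g\gamma_g^n n!$, $\|a_{ij}^{(n)}\|_{L^\infty(I)}\le C_a\gamma_a^n n!$. For some fixed $\alpha>0$, $\xi^T\mathbf A(x)\xi\ge\alpha^2\xi^T\xi$ for all $\xi\in\mathbb R^2$, $x\in[0,1]$. $L_{\varepsilon,\mu}\mathbf U:=-\mathrm{diag}(\varepsilon^2,\mu^2)\mathbf U''+\mathbf A(x)\mathbf U$; the problem has a unique solution in $[H_0^1(I)]^2$. Energy norm: $\|(u,v)\|_{E,I}^2=\varepsilon^2\|u'\|_{L^2(I)}^2+\mu^2\|v'\|_{L^2(I)}^2+\alpha^2(\|u\|_{L^2(I)}^2+\|v\|_{L^2(I)}^2)$. $\|\mathbf R\|_{L^\infty(\partial I)}$ is the maximum of $|\mathbf R|$ over the two endpoints. $w\in\mathcal A(\nu,C_w,\gamma_w)$ means $\|w^{(n)}\|_{L^\infty(I)}\le C_w\gamma_w^n\max\{n,\nu^{-1}\}^n$ for all $n\in\mathbb N_0$. $w\in\mathcal{BL}^2(\nu,C_w,\gamma_w)$ means $w$ is an entire function with $\|e^{\operatorname{dist}(x,\partial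 I)/\nu}w^{(n)}\|_{L^2(I)}\le C_w\nu^{1/2}\gamma_w^n\nu^{-n}$ for all $n\in\mathbb N_0$. Bounds are componentwise for vector-valued functions. *)

(* Defs.v *)
From HB Require Import structures.
From mathcomp Require Export all_boot all_order all_algebra.
From mathcomp Require Export all_classical all_reals all_analysis.

Set Implicit Arguments.
Unset Strict Implicit.
Unset Printing Implicit Defensive.

Export Order.TTheory GRing.Theory Num.Theory.
Export numFieldNormedType.Exports.

#[global] Open Scope classical_set_scope.
#[global] Open Scope ring_scope.

Definition cpt (R : realType) (U : R -> 'cV[R]_2) (i : 'I_2) : R -> R :=
  fun x => U x i ord0.

Definition enorm (R : realType) (v : 'cV[R]_2) : R :=
  Num.sqrt (\sum_(i < 2) v i ord0 ^+ 2).

(* The L^p(I) norm, I = ]0, 1[, obtained by extending the function by 0. *)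
Definition normI (R : realType) (p : \bar R) (f : R -> R) : \bar R :=
  ('N[@lebesgue_measure R]_p[EFin \o (f \_ `]0%R, 1%R[)])%E.

(* Since the library's derivatives are total, estimates on derive1n n w are only
   meaningful together with this predicate. It only asks for continuity at the
   endpoints: bounds on all the derivatives in ]0, 1[ then make them extend
   continuously to [0, 1]. *)
Definition smoothI (R : realType) (w : R -> R) : Prop :=
  {within `[0, 1], continuous w} /\
  forall (n : nat) (x : R), 0 < x < 1 -> derivable (derive1n n w) x 1.

Definition analyticI (R : realType) (C gam : R) (w : R -> R) : Prop :=
  smoothI w /\
  forall n : nat,
    (normI +oo%E (derive1n n w) <= (C * gam ^+ n * n`!%:R)%:E)%E.

Definition classA (R : realType) (nu C gam : R) (w : R -> R) : Prop :=
  smoothI w /\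
  forall n : nat,
    (normI +oo%E (derive1n n w)
       <= (C * gam ^+ n * Num.max n%:R nu^-1 ^+ n)%:E)%E.

(* Restrictions to the real line of entire functions that are real there: a
   power series converging on all of R has infinite radius of convergence. *)
Definition entire (R : realType) (w : R -> R) : Prop :=
  exists a : R^nat,
    forall x : R, series (fun n => a n * x ^+ n) n @[n --> \oo] --> w x.

Definition dist_bd (R : realType) (x : R) : R := Num.min `|x - 0| `|x - 1|.

Definition classBL2 (R : realType) (nu C gam : R) (w : R -> R) : Prop :=
  entire w /\
  forall n : nat,
    (normI 2%:E (fun x => (expR (dist_bd x / nu) * derive1n n w x)%R)
       <= (C * Num.sqrt nu * gam ^+ n * nu ^- n)%:E)%E.

(* u is the continuous representative of an element of H^1_0(I) whose weak
   derivative is du; in one dimension H^1(I) consists of the absolutely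
   continuous functions with derivative in L^2(I). *)
Definition H10 (R : realType) (u du : R -> R) : Prop :=
  [/\ du \_ `]0, 1[ \in Lfun (@lebesgue_measure R) 2%:E,
      forall x : R, 0 <= x <= 1 ->
        u x = u 0 + \int[@lebesgue_measure R]_(t in `]0, x[) du t,
      u 0 = 0 & u 1 = 0].

Definition H10v (R : realType) (U dU : R -> 'cV[R]_2) : Prop :=
  forall i : 'I_2, H10 (cpt U i) (cpt dU i).

Definition diagE (R : realType) (eps mu : R) : 'M[R]_2 :=
  diag_mx (\row_(j < 2) (if j == ord0 then eps ^+ 2 else mu ^+ 2)).

Definition opL (R : realType) (eps mu : R) (A : R -> 'M[R]_2)
    (U : R -> 'cV[R]_2) : R -> 'cV[R]_2 :=
  fun x => - (diagE eps mu *m \col_i derive1n 2 (cpt U i) x) + A x *m U x.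

(* L U = F in I with U(0) = U(1) = 0, in the variational sense of [H^1_0(I)]^2. *)
Definition solution (R : realType) (eps mu : R) (A : R -> 'M[R]_2)
    (F U : R -> 'cV[R]_2) : Prop :=
  exists dU : R -> 'cV[R]_2,
    H10v U dU /\
    forall V dV : R -> 'cV[R]_2, H10v V dV ->
      \int[@lebesgue_measure R]_(x in `]0, 1[)
        ((dV x)^T *m diagE eps mu *m dU x + (V x)^T *m A x *m U x) ord0 ord0
      = \int[@lebesgue_measure R]_(x in `]0, 1[)
          ((V x)^T *m F x) ord0 ord0.

(* Regularity under which opL is meaningful pointwise in I. *)
Definition twice_differentiable (R : realType) (r : R -> R) : Prop :=
  {within `[0, 1], continuous r} /\
  forall x : R, 0 < x < 1 -> derivable r x 1 /\ derivable (derive1 r) x 1.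

Definition bdnorm (R : realType) (U : R -> 'cV[R]_2) : R :=
  Num.max (enorm (U 0)) (enorm (U 1)).

Definition L2normv (R : realType) (U : R -> 'cV[R]_2) : \bar R :=
  normI 2%:E (fun x => enorm (U x)).

Definition energy_norm (R : realType) (eps mu alpha : R)
    (U : R -> 'cV[R]_2) : \bar R :=
  let u := cpt U ord0 in
  let v := cpt U ord_max in
  sqrte ((eps ^+ 2)%:E * normI 2%:E (derive1 u) ^+ 2
         + (mu ^+ 2)%:E * normI 2%:E (derive1 v) ^+ 2
         + (alpha ^+ 2)%:E * (normI 2%:E u ^+ 2 + normI 2%:E v ^+ 2))%E.

(* Main.v *)
Require Import Defs.
From mathcomp Require Import all_boot all_order all_algebra.
From mathcomp Require Import all_classical all_reals all_analysis.
From mathcomp Require Import ess_sup_inf measurable_realfun.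
From mathcomp Require Import ring lra.

Import Order.TTheory GRing.Theory Num.Theory.

(** The smooth part W is a truncated outer expansion. Write the equation as
A U = F + mu^2 E U'' with E = diag((eps / mu)^2, 1), whose entries lie in [0, 1], and
iterate: A w_0 = F and A w_(i+1) = E w_i''. As the data are analytic, the n-th derivative
of w_i is bounded by C K^i rho^n (n + 2 i)!. Hence the sum of mu^(2 i) w_i over i < m,
for m of the order of 1 / mu, is bounded like an analytic function uniformly in eps and
mu, and it misses the equation only by mu^(2 m) times a term whose size makes the residual
exponentially small in 1 / mu ([outer_expansion], [smooth_part]).

The difference V = U - W solves the same system with this residual as right-hand side and
with bounded boundary values. Coercivity of A turns the system into scalar differential
inequalities for squares, and comparison with exponentials shows that V decays like
e^(- kap x / mu) + e^(- kap (1 - x) / mu) ([layer_decay]). The equation bounds the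
derivatives of V: up to an order N of the size of 1 / eps each of them costs a factor N
([layer_bounds]). That weak solutions are smooth enough for these arguments is read off an
integral equation, obtained by testing with the Green function of - u''
([solution_green], [bootstrap]).

V itself need not extend to an entire function, hence the boundary layer part is a
polynomial close to V. Near each end point, a Taylor polynomial of degree less than N
approximates V up to e^(- N); in the middle of the interval V is already exponentially
small. The three regimes are glued with polynomial cutoffs, the distribution functions of
binomial variables: they are exponentially close to 0 and 1 away from their jump, and
their derivatives grow geometrically at the rate 1 / eps, like those of V
([taylor_cutoff_approx], [polynomial_approximation]). Since N >= 1 / eps >= 1 / mu, all
errors are of the form e^(- b / mu), for up to two derivatives at the cost of a factor
1 / eps each, and this bounds the remainder in every norm ([remainder_norms]). *)

Set Implicit Arguments.
Unset Strict Implicit.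
Unset Printing Implicit Defensive.

(** * Continuity and comparison on the unit interval *)

Definition ctsI (R : realType) (f : R -> R) : Prop :=
  {within `[0, 1], continuous f}.

Section ContinuousOnI.
Context {R : realType}.
Implicit Types f g : R -> R.

Lemma is_derive_derivable f (x d : R) : is_derive x 1 f d -> derivable f x 1.
Proof. by case. Qed.

Lemma is_derive_derive1 f (x d : R) : is_derive x 1 f d -> derive1 f x = d.
Proof. by move=> h; rewrite derive1E; case: h. Qed.

Lemma is_derive_uniq f (x d e : R) :
  is_derive x 1 f d -> is_derive x 1 f e -> d = e.
Proof. by move=> /is_derive_derive1 <- /is_derive_derive1 <-. Qed.

Lemma ctsI_continuous f : continuous f -> ctsI f.
Proof. by move=> cf; apply: continuous_subspaceT. Qed.

Lemma ctsI_cst (c : R) : ctsI (fun=> c).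
Proof. by apply: ctsI_continuous; exact: cst_continuous. Qed.

Lemma ctsI_id : ctsI (fun x : R => x).
Proof. by apply: ctsI_continuous => x; exact: cvg_id. Qed.

Lemma ctsID f g : ctsI f -> ctsI g -> ctsI (fun x => f x + g x).
Proof. by move=> cf cg x; apply: cvgD; [exact: cf|exact: cg]. Qed.

Lemma ctsIN f : ctsI f -> ctsI (fun x => - f x).
Proof. by move=> cf x; apply: cvgN; exact: cf. Qed.

Lemma ctsIB f g : ctsI f -> ctsI g -> ctsI (fun x => f x - g x).
Proof. by move=> cf cg; apply: ctsID => //; exact: ctsIN. Qed.

Lemma ctsIM f g : ctsI f -> ctsI g -> ctsI (fun x => f x * g x).
Proof. by move=> cf cg x; apply: cvgM; [exact: cf|exact: cg]. Qed.

Lemma ctsI_sum (J : Type) (r : seq J) (P : pred J) (F : J -> R -> R) :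
  (forall j, P j -> ctsI (F j)) -> ctsI (fun x => \sum_(j <- r | P j) F j x).
Proof.
move=> cF; elim: r => [|j r IH].
  have -> : (fun x => \sum_(j <- [::] | P j) F j x) = (fun=> 0).
    by apply/funext => x; rewrite big_nil.
  exact: ctsI_cst.
have -> : (fun x => \sum_(i <- j :: r | P i) F i x) =
    (fun x => (if P j then F j x else 0) + \sum_(i <- r | P i) F i x).
  by apply/funext => x; rewrite big_cons; case: (P j); rewrite ?add0r.
apply: ctsID => //; have [Pj|_] := boolP (P j); first exact: cF.
exact: ctsI_cst.
Qed.

Lemma eq_ctsI f g : (forall x : R, 0 <= x <= 1 -> f x = g x) -> ctsI f -> ctsI g.
Proof.
move=> fg; rewrite /ctsI; apply: subspace_eq_continuous => x.
by rewrite inE /= in_itv /=; exact: fg.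
Qed.

Lemma ctsIV f : ctsI f -> (forall x : R, 0 <= x <= 1 -> f x != 0) ->
  ctsI (fun x => ((f x)^-1)%R).
Proof.
move=> cf f0.
have f0' x : `[0, 1]%classic x -> f x != 0 by rewrite /= in_itv /=; exact: f0.
apply/subspace_continuousP => x x01.
by move/subspace_continuousP: cf => /(_ x x01); apply: cvgV; exact: f0'.
Qed.

Lemma ctsI_at f x : ctsI f -> 0 < x < 1 -> {for x, continuous f}.
Proof.
by move=> cf x01; apply: within_continuous_continuous cf _ => //; rewrite in_itv.
Qed.

Lemma ctsI_sub f a b : 0 <= a -> b <= 1 -> ctsI f ->
  {within `[a, b], continuous f}.
Proof.
move=> a0 b1; apply: continuous_subspaceW => x /=; rewrite !in_itv /= => /andP[h1 h2].
by rewrite (le_trans a0 h1) (le_trans h2 b1).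
Qed.

Lemma ctsI_rev f : ctsI f -> ctsI (fun x => f (1 - x)).
Proof.
move=> cf; apply/subspace_continuousP => x x01.
have x01' : `[0, 1]%classic (1 - x).
  by move: x01; rewrite /= !in_itv /= subr_ge0 lerBlDr lerDl => /andP[-> ->].
move/subspace_continuousP: cf => /(_ _ x01')/cvgrPdist_lt cf.
apply/cvgrPdist_lt => e /cf; rewrite !near_withinE => h.
have cB : (fun z : R => 1 - z) z @[z --> x] --> 1 - x.
  by apply: cvgB; [exact: cvg_cst|exact: cvg_id].
have : \forall z \near x, (`[0, 1]%classic (1 - z) -> `|f (1 - x) - f (1 - z)| < e).
  exact: (cB _ h).
apply: filterS => z /= hz z01; apply: hz.
by move: z01; rewrite !in_itv /= subr_ge0 lerBlDr lerDl => /andP[-> ->].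
Qed.

(** Points of the closed interval are limits of interior points, so estimates of
continuous functions extend to the end points. *)
Lemma ctsI_norm_le f M : ctsI f -> (forall x : R, 0 < x < 1 -> `|f x| <= M) ->
  forall x : R, 0 <= x <= 1 -> `|f x| <= M.
Proof.
move=> cf fM x.
have cn : ctsI (fun x => `|f x|).
  by move=> y; apply: cvg_norm; exact: cf.
move/continuous_within_itvP: cn => /(_ ltr01) [_ c0 c1].
move=> /andP[]; rewrite le_eqVlt => /predU1P[<- _|x0].
  apply: (cvgr_to_le c0).
  by near=> y; apply: fM; apply/andP; split; near: y;
    [exact: nbhs_right_gt|exact: nbhs_right_lt].
rewrite le_eqVlt => /predU1P[->|x1]; last by apply: fM; rewrite x0 x1.
apply: (cvgr_to_le c1).
by near=> y; apply: fM; apply/andP; split; near: y;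
  [exact: nbhs_left_gt|exact: nbhs_left_lt].
Unshelve. all: by end_near. Qed.

Lemma ctsI_eq f g : ctsI f -> ctsI g -> (forall x : R, 0 < x < 1 -> f x = g x) ->
  forall x : R, 0 <= x <= 1 -> f x = g x.
Proof.
move=> cf cg fg x x01; apply/eqP; rewrite -subr_eq0 -normr_le0.
by apply: (ctsI_norm_le (ctsIB cf cg)) => // y /fg ->; rewrite subrr normr0.
Qed.

Lemma MVT_I f (df : R -> R) (a b : R) : 0 <= a -> a < b -> b <= 1 -> ctsI f ->
  (forall x : R, 0 < x < 1 -> is_derive x 1 f (df x)) ->
  exists c, [/\ a < c, c < b & f b - f a = df c * (b - a)].
Proof.
move=> a0 ab b1 cf dF.
have [x|//|c] := @MVT R f df a b ab; last 2 first.
- exact: ctsI_sub cf.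
- by rewrite in_itv /= => /andP[? ?] ?; exists c.
rewrite in_itv /= => /andP[ax xb]; apply: dF.
by rewrite (le_lt_trans a0 ax) (lt_le_trans xb b1).
Qed.

(** At an interior point c where z attains a positive maximum z' vanishes, while
z'' >= k z > 0 next to c forces z to increase to the right of c. *)
Lemma comparison_principle (z z1 z2 : R -> R) (k : R) : 0 < k -> ctsI z ->
  (forall x : R, 0 < x < 1 -> is_derive x 1 z (z1 x)) ->
  (forall x : R, 0 < x < 1 -> is_derive x 1 z1 (z2 x)) ->
  (forall x : R, 0 < x < 1 -> k * z x <= z2 x) ->
  z 0 <= 0 -> z 1 <= 0 -> forall x : R, 0 <= x <= 1 -> z x <= 0.
Proof.
move=> k0 cz dz dz1 kz z00 z10 x x01.
have [c] := @EVT_max R z 0 1 ler01 cz; rewrite in_itv /= => c01 cmax.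
have cmax' t : 0 <= t <= 1 -> z t <= z c by move=> ?; apply: cmax; rewrite in_itv.
apply: le_trans (cmax' _ x01) _; rewrite leNgt; apply/negP => zc.
have /andP[c0 c1] : 0 < c < 1.
  move: c01 => /andP[]; rewrite !le_eqVlt => /predU1P[c0|->].
    by move: zc; rewrite -c0 ltNge z00.
  by move=> /predU1P[c0|->//]; move: zc; rewrite c0 ltNge z10.
have dzc0 : is_derive c 1 z 0.
  apply: (@derive1_at_max R z 0 1 c) => //.
  - move=> t; rewrite in_itv /= => t01.
    exact: is_derive_derivable (dz t t01).
  - by rewrite in_itv /= c0 c1.
  - by move=> t; rewrite in_itv /= => /andP[/ltW ? /ltW ?]; apply: cmax'; apply/andP.
have z1c : z1 c = 0.
  by apply: is_derive_uniq dzc0; apply: dz; rewrite c0 c1.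
have c01' : 0 < c < 1 by rewrite c0 c1.
have /cvgrPdist_lt /(_ _ zc) h := ctsI_at cz c01'.
have [y [cy y1 yP]] : exists y, [/\ c < y, y < 1 & forall t, c < t <= y -> 0 < z t].
  move: h => /nbhs_ballP [e /= e0 he].
  exists (c + Num.min (e / 2) ((1 - c) / 2)).
  have m0 : 0 < Num.min (e / 2) ((1 - c) / 2).
    by rewrite lt_min !divr_gt0// subr_gt0.
  split; first by rewrite ltrDl.
    rewrite -ltrBrDl gt_min; apply/orP; right.
    by rewrite ltr_pdivrMr// mulr_natr mulr2n ltrDl subr_gt0.
  move=> t /andP[ct tm].
  have : ball c e t.
    rewrite /ball /= ltr0_norm ?subr_lt0// opprB ltrBlDl.
    apply: le_lt_trans tm _; rewrite ltrD2l gt_min; apply/orP; left.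
    by rewrite ltr_pdivrMr// mulr_natr mulr2n ltrDl.
  move=> /he /=; have [//|zt] := ltP 0 (z t).
  by rewrite ger0_norm ?subr_ge0 ?(le_trans zt)// ?(ltW zc)// -subr_gt0; lra.
have [s [cs sy zys]] := MVT_I (ltW c0) cy (ltW y1) cz dz.
have [||r] := @MVT R z1 z2 c s cs.
- move=> t; rewrite in_itv /= => /andP[ct ts]; apply: dz1.
  by rewrite (lt_trans c0 ct) (lt_trans ts (lt_trans sy y1)).
- apply: derivable_within_continuous => t; rewrite in_itv /= => /andP[ct ts].
  apply: is_derive_derivable (dz1 t _).
  by rewrite (lt_le_trans c0 ct) (le_lt_trans ts (lt_trans sy y1)).
rewrite in_itv /= z1c subr0 => /andP[cr rs] z1s.
have r01 : 0 < r < 1 by rewrite (lt_trans c0 cr) (lt_trans rs (lt_trans sy y1)).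
have zr : 0 < z r by apply: yP; rewrite cr (ltW (lt_trans rs sy)).
have z1s0 : 0 < z1 s.
  by rewrite z1s mulr_gt0 ?subr_gt0// (lt_le_trans _ (kz _ r01))// mulr_gt0.
have : z y <= z c by apply: cmax'; rewrite (ltW (lt_trans c0 cy)) (ltW y1).
by rewrite leNgt -subr_gt0 zys mulr_gt0// subr_gt0.
Qed.

End ContinuousOnI.

(** * Derivatives up to the boundary *)

(** The differentiation rules for functions written as explicit abstractions: in this
form derivatives of compound expressions are obtained by composing the rules. *)
Section PointwiseDerivatives.
Context {R : realType}.
Implicit Types (f g : R -> R) (x a b c : R).

Lemma isD_cst c x : is_derive x 1 (fun=> c) 0.
Proof. exact: is_derive_cst. Qed.

Lemma isD_id x : is_derive x 1 (fun y : R => y) 1.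
Proof. exact: is_derive_id. Qed.

Lemma isD_D f g x a b : is_derive x 1 f a -> is_derive x 1 g b ->
  is_derive x 1 (fun y => f y + g y) (a + b).
Proof. by move=> df dg; exact: is_deriveD. Qed.

Lemma isD_N f x a : is_derive x 1 f a -> is_derive x 1 (fun y => - f y) (- a).
Proof. by move=> df; exact: is_deriveN. Qed.

Lemma isD_B f g x a b : is_derive x 1 f a -> is_derive x 1 g b ->
  is_derive x 1 (fun y => f y - g y) (a - b).
Proof. by move=> df dg; apply: isD_D => //; exact: isD_N. Qed.

Lemma isD_M f g x a b : is_derive x 1 f a -> is_derive x 1 g b ->
  is_derive x 1 (fun y => f y * g y) (a * g x + f x * b).
Proof.
move=> df dg; apply: (is_derive_eq (is_deriveM df dg)).
by rewrite /GRing.scale /=; ring.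
Qed.

Lemma isD_Z c f x a : is_derive x 1 f a -> is_derive x 1 (fun y => c * f y) (c * a).
Proof.
move=> df; apply: (is_derive_eq (isD_M (isD_cst c x) df)).
by rewrite mul0r add0r.
Qed.

Lemma isD_sum n (F : 'I_n -> R -> R) x (a : 'I_n -> R) :
  (forall i, is_derive x 1 (F i) (a i)) ->
  is_derive x 1 (fun y => \sum_(i < n) F i y) (\sum_(i < n) a i).
Proof.
move=> dF; rewrite (_ : (fun y => \sum_(i < n) F i y) = \sum_(i < n) F i).
  exact: is_derive_sum.
by apply/funext => y; rewrite fct_sumE.
Qed.

Lemma isD_comp f g x a b : is_derive x 1 g b -> is_derive (g x) 1 f a ->
  is_derive x 1 (fun y => f (g y)) (a * b).
Proof.
by move=> dg df; apply: (is_derive_eq (@is_derive1_comp _ f g x a b df dg)).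
Qed.

Lemma eq_isD f g x a : 0 < x < 1 -> (forall y, 0 < y < 1 -> f y = g y) ->
  is_derive x 1 f a -> is_derive x 1 g a.
Proof.
move=> x01 fg; apply: near_eq_is_derive.
have : x \in `]0, 1[ by rewrite in_itv.
by move=> /near_in_itvoo; apply: filterS => y; rewrite in_itv /=; exact: fg.
Qed.

End PointwiseDerivatives.

Section LeibnizSums.
Context {R : realType}.
Implicit Types a v : nat -> R.

(** The n-th derivative of a product whose factors have the derivatives a and v. *)
Definition leib a v (n : nat) : R :=
  \sum_(k < n.+1) 'C(n, k)%:R * (a k * v (n - k)%N).

Lemma leib0 a v : leib a v 0 = a 0 * v 0.
Proof. by rewrite /leib big_ord1 bin0 mul1r. Qed.

Lemma leibS a v n :
  leib a v n.+1 = leib (fun k => a k.+1) v n + leib a (fun k => v k.+1) n.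
Proof.
rewrite /leib big_ord_recl /= bin0 mul1r subn0.
under eq_bigr => i _ do
  rewrite /bump /= add1n binS natrD mulrDl subSS addrC.
rewrite big_split /= addrCA; congr (_ + _).
rewrite [RHS]big_ord_recl /= bin0 mul1r subn0; congr (_ + _).
rewrite big_ord_recr /= bin_small// mul0r addr0.
by apply: eq_bigr => i _; rewrite /bump /= add1n subnSK.
Qed.

Lemma eq_leib a v a' v' n : (forall k, (k <= n)%N -> a k = a' k) ->
  (forall k, (k <= n)%N -> v k = v' k) -> leib a v n = leib a' v' n.
Proof.
move=> aa vv; apply: eq_bigr => k _.
by rewrite aa ?vv ?leq_subr// -ltnS ltn_ord.
Qed.

(** The n-th derivative of a product without the term in the n-th derivative of the
second factor: only lower derivatives of that factor remain, so that an equation for a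
product determines the derivatives of its second factor recursively. *)
Definition leib_tail a v n : R :=
  \sum_(k < n) 'C(n, k.+1)%:R * (a k.+1 * v (n - k.+1)%N).

Lemma leib_head a v n : leib a v n = a 0%N * v n + leib_tail a v n.
Proof. by rewrite /leib big_ord_recl /= bin0 mul1r subn0. Qed.

Lemma leib_sumr m a (v : 'I_m -> nat -> R) (c : 'I_m -> R) n :
  leib a (fun k => \sum_(i < m) c i * v i k) n = \sum_(i < m) c i * leib a (v i) n.
Proof.
rewrite /leib; under [RHS]eq_bigr => i _ do rewrite mulr_sumr.
rewrite exchange_big /=; apply: eq_bigr => k _.
rewrite !mulr_sumr; apply: eq_bigr => i _; ring.
Qed.

Lemma leibBr a v w n : leib a (fun k => v k - w k) n = leib a v n - leib a w n.
Proof.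
by rewrite /leib -sumrB; apply: eq_bigr => k _; rewrite !mulrBr.
Qed.

(** Geometric growth of the derivatives is stable under products, because Leibniz sums
of geometric sequences are binomial expansions. *)
Lemma leib_norm_le a v n (A B p q : R) : 0 <= A -> 0 <= B -> 0 <= p -> 0 <= q ->
  (forall k, (k <= n)%N -> `|a k| <= A * p ^+ k) ->
  (forall k, (k <= n)%N -> `|v k| <= B * q ^+ k) ->
  `|leib a v n| <= A * B * (p + q) ^+ n.
Proof.
move=> A0 B0 p0 q0 ha hv.
apply: (le_trans (ler_norm_sum _ _ _)).
rewrite addrC exprDn mulr_sumr; apply: ler_sum => k _.
rewrite !normrM normr_nat -[(_ * _) *+ _]mulr_natl.
have kn : (k <= n)%N by rewrite -ltnS ltn_ord.
have -> : A * B * ('C(n, k)%:R * (q ^+ (n - k) * p ^+ k)) =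
  'C(n, k)%:R * ((A * p ^+ k) * (B * q ^+ (n - k))) by ring.
rewrite ler_wpM2l// ler_pM//; first exact: ha.
by apply: hv; exact: leq_subr.
Qed.

End LeibnizSums.

(** A tower is a function together with all its derivatives on the open interval,
each extended continuously to the end points: this gives meaning to derivatives
at 0 and 1, about which the two-sided derivative says nothing. *)
Definition tower (R : realType) (u : nat -> R -> R) : Prop :=
  (forall n, ctsI (u n)) /\
  forall n (x : R), 0 < x < 1 -> is_derive x 1 (u n) (u n.+1 x).

Section Towers.
Context {R : realType}.
Implicit Types u v : nat -> R -> R.

Lemma tower_shift u m : tower u -> tower (fun n => u (n + m)%N).
Proof. by move=> [cu du]; split => n // x x01; exact: du. Qed.

Lemma tower_sumZ m (u : 'I_m -> nat -> R -> R) (c : 'I_m -> R) :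
  (forall i, tower (u i)) -> tower (fun n x => \sum_(i < m) c i * u i n x).
Proof.
move=> tu; split => n.
  by apply: ctsI_sum => i _; apply: ctsIM; [exact: ctsI_cst|exact: (tu i).1].
by move=> x x01; apply: isD_sum => i; apply: isD_Z; exact: (tu i).2.
Qed.

Lemma towerZ c u : tower u -> tower (fun n x => c * u n x).
Proof.
move=> [cu du]; split => n; first by apply: ctsIM => //; exact: ctsI_cst.
by move=> x x01; apply: isD_Z; exact: du.
Qed.

Lemma towerB u v : tower u -> tower v -> tower (fun n x => u n x - v n x).
Proof.
move=> [cu du] [cv dv]; split => n; first exact: ctsIB.
by move=> x x01; apply: isD_B; [exact: du|exact: dv].
Qed.

Lemma is_derive_leib u v n (x : R) :
  (forall k, (k <= n)%N -> is_derive x 1 (u k) (u k.+1 x)) ->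
  (forall k, (k <= n)%N -> is_derive x 1 (v k) (v k.+1 x)) ->
  is_derive x 1 (fun y => leib (u^~ y) (v^~ y) n) (leib (u^~ x) (v^~ x) n.+1).
Proof.
move=> du dv; rewrite leibS /leib -big_split /=.
apply: isD_sum => k; rewrite -mulrDr; apply: isD_Z; apply: isD_M.
  by apply: du; rewrite -ltnS ltn_ord.
by apply: dv; exact: leq_subr.
Qed.

Lemma ctsI_leib u v n : (forall k, (k <= n)%N -> ctsI (u k)) ->
  (forall k, (k <= n)%N -> ctsI (v k)) -> ctsI (fun y => leib (u^~ y) (v^~ y) n).
Proof.
move=> cu cv; apply: ctsI_sum => k _; apply: ctsIM; first exact: ctsI_cst.
by apply: ctsIM; [apply: cu; rewrite -ltnS ltn_ord|apply: cv; exact: leq_subr].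
Qed.

Lemma tower_leib u v : tower u -> tower v ->
  tower (fun n y => leib (u^~ y) (v^~ y) n).
Proof.
move=> [cu du] [cv dv]; split => n; first by apply: ctsI_leib => k _.
by move=> x x01; apply: is_derive_leib => k _; [exact: du|exact: dv].
Qed.

Lemma tower_horner (p : {poly R}) : tower (fun n x => (p^`(n)).[x]).
Proof.
split => n; first by apply: ctsI_continuous; exact: continuous_horner.
move=> x _; have /derivableP := @derivable_horner R (p^`(n)) x.
by move=> h; apply: (is_derive_eq h); rewrite -derive1E -derivE derivnS.
Qed.

Lemma tower_rev u : tower u -> tower (fun n x => (-1) ^+ n * u n (1 - x)).
Proof.
move=> [cu du]; split => n.
  by apply: ctsIM; [exact: ctsI_cst|exact: ctsI_rev].
move=> x x01; rewrite exprSr -mulrA; apply: isD_Z.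
rewrite mulrC; apply: isD_comp; last by apply: du; lra.
by apply: (is_derive_eq (isD_B (isD_cst 1 x) (isD_id x))); rewrite sub0r.
Qed.

(** A derivative on the open interval is determined by the function there, and its
boundary values by continuity. *)
Lemma tower_eq u v : tower u -> tower v ->
  (forall x : R, 0 <= x <= 1 -> u 0%N x = v 0%N x) ->
  forall n (x : R), 0 <= x <= 1 -> u n x = v n x.
Proof.
move=> [cu du] [cv dv] uv; elim=> [//|n IH].
apply: ctsI_eq => // x x01.
have dun := du n x x01; apply: is_derive_uniq dun _.
apply: eq_isD x01 _ (dv n x x01) => y /andP[y0 y1].
by rewrite IH// !ltW.
Qed.

(** Iterated derivatives only see the open interval. *)
Lemma tower_derive1n u (w : R -> R) : tower u ->
  (forall x : R, 0 < x < 1 -> w x = u 0%N x) -> forall n (x : R), 0 < x < 1 ->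
  derive1n n w x = u n x /\ derivable (derive1n n w) x 1.
Proof.
move=> [cu du] wu n.
have H : forall x : R, 0 < x < 1 -> derive1n n w x = u n x.
  elim: n => [//|n IH x x01]; rewrite derive1nS.
  apply: is_derive_derive1; apply: eq_isD x01 _ (du n x x01) => y y01.
  by rewrite IH.
move=> x x01; split; first exact: H.
apply: is_derive_derivable; apply: eq_isD x01 _ (du n x x01) => y y01.
by rewrite H.
Qed.

(** A function with bounded derivative on the open interval is Lipschitz there, and
its McShane extension is continuous everywhere. *)
Lemma lipschitz_extension (g dg : R -> R) (B : R) : 0 <= B ->
  (forall x : R, 0 < x < 1 -> is_derive x 1 g (dg x)) ->
  (forall x : R, 0 < x < 1 -> `|dg x| <= B) ->
  exists2 h, ctsI h & forall x : R, 0 < x < 1 -> h x = g x.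
Proof.
move=> B0 dgP dgB.
have lip (x y : R) : 0 < x -> x < y -> y < 1 -> `|g y - g x| <= B * (y - x).
  move=> x0 xy y1.
  have itvP c : c \in `]x, y[ -> 0 < c < 1.
    by rewrite in_itv /= => /andP[xc cy]; rewrite (lt_trans x0 xc) (lt_trans cy y1).
  have [||c cxy ->] := @MVT R g dg x y xy.
  - by move=> c /itvP; exact: dgP.
  - move=> c; apply: derivable_within_continuous => z zxy.
    apply: (is_derive_derivable (dgP z _)); move: zxy; rewrite in_itv /= => /andP[h1 h2].
    by rewrite (lt_le_trans x0 h1) (le_lt_trans h2 y1).
  rewrite normrM (@ger0_norm _ (y - x)) ?subr_ge0 ?(ltW xy)//.
  by rewrite ler_wpM2r ?subr_ge0 ?(ltW xy)// dgB// itvP.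
have lip2 (x y : R) : 0 < x < 1 -> 0 < y < 1 -> g x <= g y + B * `|x - y|.
  move=> /andP[x0 x1] /andP[y0 y1]; rewrite -lerBlDl.
  apply: le_trans (ler_norm _) _.
  have [xy|yx|->] := ltgtP x y.
  - by rewrite distrC (distrC x) (@ger0_norm _ (y - x)) ?subr_ge0 ?(ltW xy) ?lip//.
  - by rewrite (@ger0_norm _ (x - y)) ?subr_ge0 ?(ltW yx) ?lip//.
  - by rewrite !subrr normr0 mulr0.
pose E (x : R) : set R := fun r => exists2 y : R, 0 < y < 1 & g y + B * `|x - y| = r.
have hE : forall z y : R, 0 < y < 1 -> E z (g y + B * `|z - y|) by move=> z y ?; exists y.
have E0 x : (E x !=set0)%classic.
  by exists (g (1 / 2) + B * `|x - (1 / 2)|); apply: hE; lra.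
have lbE x : lbound (E x) (g (1 / 2) - B * `|(1 / 2) - x|).
  move=> _ [y y01 <-].
  have := lip2 (1 / 2) y; rewrite y01 => /(_ _ isT) h.
  have {}h : g (1 / 2) <= g y + B * `|(1 / 2) - y| by apply: h; lra.
  rewrite lerBlDr; apply: le_trans h _; rewrite -addrA lerD2l -mulrDr ler_wpM2l//.
  by rewrite [leRHS]addrC; apply: ler_distD.
have lbE' x : has_lbound (E x) by exists (g (1 / 2) - B * `|(1 / 2) - x|).
have hlip x z : inf (E x) - inf (E z) <= B * `|x - z|.
  rewrite lerBlDr -lerBlDl; apply: lb_le_inf => // _ [y y01 <-].
  rewrite lerBlDl; apply: le_trans (ge_inf (lbE' x) (hE x y y01)) _.
  rewrite addrCA lerD2l -mulrDr ler_wpM2l//.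
  exact: ler_distD.
exists (fun x => inf (E x)).
  apply: ctsI_continuous => x; apply/cvgrPdist_lt => e e0.
  have B1 : 0 < B + 1 by lra.
  have : \forall y \near x, `|x - y| < e / (B + 1).
    by apply/nbhs_ballP; exists (e / (B + 1)); rewrite /= ?divr_gt0.
  apply: filterS => y xy.
  have : `|inf (E x) - inf (E y)| <= B * `|x - y|.
    by rewrite ler_norml hlip andbT lerNl opprB distrC hlip.
  move=> /le_lt_trans; apply; apply: (@le_lt_trans _ _ ((B + 1) * `|x - y|)).
    by rewrite ler_wpM2r// lerDl.
  by rewrite mulrC -ltr_pdivlMr.
move=> x x01; apply/eqP; rewrite eq_le; apply/andP; split.
  by apply: le_trans (ge_inf (lbE' x) (hE x x x01)) _; rewrite subrr normr0 mulr0 addr0.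
by apply: lb_le_inf => // _ [y y01 <-]; exact: lip2.
Qed.

End Towers.

Section AnalyticTowers.
Context {R : realType}.

(** Where a continuous function exceeds M in absolute value it does so on a whole ball,
which has positive measure. *)
Lemma normI_oo_bound (f : R -> R) (M : R) :
  (forall x : R, 0 < x < 1 -> {for x, continuous f}) -> (normI +oo%E f <= M%:E)%E ->
  forall x : R, 0 < x < 1 -> `|f x| <= M.
Proof.
move=> cf; rewrite /normI unlock.
have -> : (0 < @lebesgue_measure R [set: R]%classic)%E.
  by rewrite -set_itvNyy lebesgue_measure_itv /= ltry.
move=> /ess_supP [N [mN N0 sub]] x x01; rewrite leNgt; apply/negP => Mfx.
have : \forall y \near x, 0 < y < 1 /\ M < `|f y|.
  near=> y; split.
    have : y \in `]0, 1[ by near: y; apply: near_in_itvoo; rewrite in_itv.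
    by rewrite in_itv.
  near: y; have : (fun y => `|f y|) y @[y --> x] --> `|f x|.
    by apply: cvg_norm; exact: cf.
  by move=> /cvgr_gt; apply.
move=> /nbhs_ballP [e /= e0 be].
have : (lebesgue_measure (ball x e) <= lebesgue_measure N)%E.
  apply: le_measure; rewrite ?inE//; first by rewrite ball_itv; exact: measurable_itv.
  move=> y /be [y01 My]; apply: sub => /=.
  rewrite patchE mem_set /= ?in_itv //= lee_fin.
  by apply/negP; rewrite -ltNge.
rewrite N0 lebesgue_measure_ball ?(ltW e0)// lee_fin.
by rewrite leNgt pmulrn_rgt0 ?e0.
Unshelve. all: by end_near. Qed.

(** Each derivative is Lipschitz on the open interval by the bound on the next one,
which provides its boundary values. *)
Lemma analyticI_tower (C gam : R) (w : R -> R) : 0 < C -> 0 < gam ->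
  analyticI C gam w -> exists u, [/\ tower u,
    forall x : R, 0 <= x <= 1 -> u 0%N x = w x &
    forall n (x : R), 0 <= x <= 1 -> `|u n x| <= C * gam ^+ n * n`!%:R].
Proof.
move=> C0 gam0 [[cw dw] bw].
have dw' n (x : R) : 0 < x < 1 ->
    is_derive x 1 (derive1n n w) (derive1n n.+1 w x).
  by move=> /(dw n) /derivableP h; apply: (is_derive_eq h); rewrite derive1nS derive1E.
have bw' n x : 0 < x < 1 -> `|derive1n n w x| <= C * gam ^+ n * n`!%:R.
  apply: normI_oo_bound => // y y01.
  exact/differentiable_continuous/derivable1_diffP/dw.
have ext n : exists h, ctsI h /\ forall x : R, 0 < x < 1 -> h x = derive1n n w x.
  have B0 : 0 <= C * gam ^+ n.+1 * (n.+1)`!%:R.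
    by rewrite !mulr_ge0 ?exprn_ge0 ?ltW.
  have [h ch hE] := lipschitz_extension B0 (dw' n) (bw' n.+1).
  by exists h.
have [u uP] := choice ext.
exists u; split.
- split=> n; first by have [] := uP n.
  move=> x x01; rewrite (uP n.+1).2//; apply: eq_isD x01 _ (dw' n x x01) => y y01.
  by rewrite (uP n).2.
- by apply: ctsI_eq => //; [exact: (uP 0%N).1|exact: (uP 0%N).2].
- move=> n; apply: ctsI_norm_le; first exact: (uP n).1.
  by move=> x x01; rewrite (uP n).2// bw'.
Qed.

End AnalyticTowers.

(** * Polynomial cutoffs *)

Lemma ler_exprn (R : realType) n (a b : R) : 0 <= a -> a <= b -> a ^+ n <= b ^+ n.
Proof. by move=> a0 ab; rewrite lerXn2r ?nnegrE// (le_trans a0). Qed.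

Section BernsteinCutoff.
Context {R : realType}.
Implicit Types (h : nat -> R) (x c q : R).

(** The Bernstein polynomial of the data h(0), ..., h(n) by de Casteljau's recursion:
at x it is the mean of h under the binomial distribution with parameters n, x. *)
Fixpoint bern (n : nat) (h : nat -> R) : {poly R} :=
  if n is n'.+1 then
    (1 - 'X) * bern n' h + 'X * bern n' (fun j => h j.+1)
  else (h 0%N)%:P.

Lemma bernS n h :
  bern n.+1 h = (1 - 'X) * bern n h + 'X * bern n (fun j => h j.+1).
Proof. by []. Qed.

Definition fdiff h : nat -> R := fun j => h j.+1 - h j.

Lemma bernB n h h' : bern n (fun j => h j - h' j) = bern n h - bern n h'.
Proof.
elim: n h h' => [|n IH] h h' /=; first by rewrite polyCB.
by rewrite IH (IH (fun j => h j.+1) (fun j => h' j.+1)); ring.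
Qed.

Lemma deriv_bern n h : (bern n.+1 h)^`() = n.+1%:R *: bern n (fdiff h).
Proof.
have d1X : (1 - 'X : {poly R})^`() = -1.
  by rewrite derivB derivX -[1]/(1%:P) derivC sub0r.
elim: n h => [|n IH] h.
  rewrite /= derivD !derivM d1X derivX !derivC /fdiff polyCB scale1r.
  by rewrite !mulr0 !addr0 mulN1r mul1r addrC.
rewrite bernS derivD !derivM d1X derivX.
rewrite (IH h) (IH (fun j => h j.+1)).
have -> : bern n.+1 (fun j => h j.+1) = bern n.+1 h + bern n.+1 (fdiff h).
  by rewrite bernB addrC subrK.
rewrite (bernS n (fdiff h)) -!mul_polyC.
have -> : (fun j => fdiff h j.+1) = fdiff (fun j => h j.+1) by [].
rewrite (_ : n.+2%:R%:P = n.+1%:R%:P + 1 :> {poly R}); last first.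
  by rewrite -addn1 natrD polyCD.
ring.
Qed.

(** Differentiating a Bernstein polynomial amounts to taking finite differences of its
data; this is what makes the derivatives of the cutoffs below easy to bound. *)
Lemma derivn_bern k n h :
  (bern n h)^`(k) = (n ^_ k)%:R *: bern (n - k) (iter k fdiff h).
Proof.
elim: k => [|k IH]; first by rewrite derivn0 ffactn0 scale1r subn0.
rewrite derivnS IH derivZ ffactnSr natrM.
have [nk|kn] := leqP n k.
  have -> : (n - k = 0)%N by apply/eqP; rewrite subn_eq0.
  by rewrite /= derivC scaler0 mulr0 scale0r.
by rewrite -[in LHS](subnSK kn) deriv_bern scalerA /= -[in RHS](subnSK kn).
Qed.

(** For geometric data the Bernstein polynomial is the binomial formula. *)
Lemma bern_norm_le n h c q x : 0 <= x <= 1 -> 0 <= q ->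
  (forall j, `|h j| <= c * q ^+ j) -> `|(bern n h).[x]| <= c * (1 - x + x * q) ^+ n.
Proof.
move=> /andP[x0 x1] q0; elim: n h c => [|n IH] h c hc.
  by rewrite /= hornerC expr0; have := hc 0%N; rewrite expr0.
rewrite /= !hornerE; apply: le_trans (ler_normD _ _) _; rewrite !normrM.
rewrite (ger0_norm x0) (@ger0_norm _ (1 - x)) ?subr_ge0//.
have h1 := IH h c hc.
have /IH h2 j : `|h j.+1| <= c * q * q ^+ j by rewrite -mulrA -exprS.
apply: le_trans (lerD (ler_wpM2l _ h1) (ler_wpM2l x0 h2)) _; rewrite ?subr_ge0//.
by rewrite exprS le_eqVlt; apply/orP; left; apply/eqP; ring.
Qed.

Lemma iter_fdiff_norm_le k h c q : 0 <= q ->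
  (forall j, `|h j| <= c * q ^+ j) ->
  forall j, `|iter k fdiff h j| <= c * (1 + q) ^+ k * q ^+ j.
Proof.
move=> q0 hc; elim: k => [|k IH] j; first by rewrite expr0 mulr1.
rewrite iterS /fdiff; apply: le_trans (ler_normB _ _) _.
apply: le_trans (lerD (IH j.+1) (IH j)) _.
by rewrite exprS (exprS _ k) le_eqVlt; apply/orP; left; apply/eqP; ring.
Qed.

Lemma derivn_bern_norm_le n h c q k x : 0 <= x <= 1 -> 0 <= q -> 0 <= c ->
  (forall j, `|h j| <= c * q ^+ j) ->
  `|((bern n h)^`(k)).[x]| <=
     if (k <= n)%N then n%:R ^+ k * (c * (1 + q) ^+ k * (1 - x + x * q) ^+ (n - k)) else 0.
Proof.
move=> x01 q0 c0 hc; rewrite derivn_bern hornerZ normrM normr_nat.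
case: leqP => [kn|nk]; last by rewrite ffact_small// mul0r.
apply: ler_pM => //; last first.
  by apply: bern_norm_le => //; exact: iter_fdiff_norm_le.
rewrite -natrX ler_nat ffact_prod.
elim: (k) => [|j IH]; first by rewrite big_ord0.
by rewrite big_ord_recr /= expnSr leq_mul// leq_subr.
Qed.

Lemma half_le_expR : 1 / 2 <= expR (- (1 / 2)) :> R.
Proof. by apply: le_trans (expR_ge1Dx _); lra. Qed.

Lemma expR_half_le2 : expR (1 / 2) <= 2 :> R.
Proof.
have := half_le_expR; rewrite expRN.
have e0 := @expR_gt0 R (1 / 2).
by rewrite div1r lef_pV2 ?posrE.
Qed.

Lemma two_le_expR1 : 2 <= expR 1 :> R.
Proof. by apply: le_trans (expR_ge1Dx _); lra. Qed.

(** A polynomial step function: the probability that a binomial variable with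
parameters n and x is at most m, which drops from 1 to 0 around x = m / n. *)
Definition cutoff (n m : nat) : {poly R} := bern n (fun j => (j <= m)%N%:R).

Lemma cutoff_compl n m : 1 - cutoff n m = bern n (fun j => (m < j)%N%:R).
Proof.
have -> : (fun j => (m < j)%N%:R) = (fun j => 1 - (j <= m)%N%:R) :> (nat -> R).
  by apply/funext => j; rewrite ltnNge; case: leqP; rewrite /= ?subrr ?subr0.
rewrite (bernB n (fun=> 1)); congr (_ - _).
elim: n => [//|n IH] /=; rewrite -IH.
by rewrite !mulr1 subrK.
Qed.

(** The derivatives of all orders grow geometrically at a rate proportional to n: for n
of the order of 1 / eps they cost no more than the derivatives of the layers. *)
Lemma cutoff_derivn_le n m k x : 0 <= x <= 1 ->
  `|((cutoff n m)^`(k)).[x]| <= (4 * n%:R) ^+ k.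
Proof.
move=> x01.
apply: (le_trans (@derivn_bern_norm_le n _ 1 1 k x x01 _ _ _)) => //.
  by move=> j; rewrite mul1r expr1n; case: (_ <= _)%N; rewrite /= ?normr1 ?normr0.
case: ifP => _; last by rewrite exprn_ge0 ?mulr_ge0.
rewrite mulr1 subrK expr1n mul1r mulr1 exprMn mulrC ler_wpM2r ?exprn_ge0//.
by apply: ler_exprn => //; lra.
Qed.

(** Chernoff's bound: dominate the indicator of j <= m by 2^(m - j). *)
Lemma cutoff_right n m k x : 0 <= x <= 1 -> 4 * m%:R <= n%:R * x ->
  `|((cutoff n m)^`(k)).[x]| <= (4 * n%:R) ^+ k * expR (- m%:R).
Proof.
move=> x01 mx; have /andP[x0 x1] := x01.
apply: (le_trans (@derivn_bern_norm_le n _ (2 ^+ m) (1 / 2) k x x01 _ _ _)).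
- lra.
- by rewrite exprn_ge0.
- move=> j; have [jm|_] := leqP j m; last first.
    by rewrite normr0 mulr_ge0 ?exprn_ge0//; lra.
  rewrite normr1 -(subnK jm) exprD -mulrA -exprMn mulrC.
  by rewrite mul1r divff// expr1n mul1r exprn_ege1//; lra.
case: leqP => [kn|_]; last by rewrite mulr_ge0 ?expR_ge0 ?exprn_ge0 ?mulr_ge0.
rewrite [(4 * _) ^+ k]exprMn [4 ^+ k * _]mulrC -!mulrA ler_wpM2l ?exprn_ge0//.
have h1 : 2 ^+ m <= expR m%:R :> R.
  rewrite -[m%:R]mulr1 mulrC expRM_natr; apply: ler_exprn => //.
  exact: two_le_expR1.
have h2 : (1 - x + x * (1 / 2)) ^+ (n - k) <= expR (- (x / 2) * (n - k)%:R).
  rewrite expRM_natr; apply: ler_exprn; first lra.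
  by apply: le_trans (expR_ge1Dx _); lra.
have h3 : (1 + 1 / 2) ^+ k * expR (x / 2 * k%:R) <= 4 ^+ k :> R.
  rewrite expRM_natr -exprMn; apply: ler_exprn; first by rewrite mulr_ge0 ?expR_ge0//; lra.
  have : expR (x / 2) <= 2 by apply: le_trans expR_half_le2; rewrite ler_expR; lra.
  by have := expR_ge0 (x / 2); nra.
apply: le_trans (ler_pM _ _ h1 (ler_wpM2l _ h2)) _.
- by rewrite exprn_ge0.
- by rewrite mulr_ge0 ?exprn_ge0//; lra.
- by rewrite exprn_ge0//; lra.
rewrite natrB//.
have -> : - (x / 2) * (n%:R - k%:R) = x / 2 * k%:R - n%:R * x / 2 by field.
have h4 : expR m%:R * expR (- (n%:R * x / 2)) <= expR (- m%:R).
  by rewrite -expRD ler_expR; lra.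
rewrite expRD; set E := expR (x / 2 * k%:R) in h3 *.
have -> : expR m%:R * ((1 + 1 / 2) ^+ k * (E * expR (- (n%:R * x / 2)))) =
  ((1 + 1 / 2) ^+ k * E) * (expR m%:R * expR (- (n%:R * x / 2))) by ring.
apply: ler_pM => //; rewrite ?mulr_ge0 ?exprn_ge0 ?expR_ge0//; lra.
Qed.

(** Chernoff's bound for the other tail: dominate the indicator of j > m by 2^(j - m). *)
Lemma cutoff_left n m k x : 0 <= x <= 1 -> 4 * (n%:R * x) <= m%:R ->
  `|((1 - cutoff n m)^`(k)).[x]| <= (4 * n%:R) ^+ k * expR (- (m%:R / 4)).
Proof.
move=> x01 mx; have /andP[x0 x1] := x01.
rewrite cutoff_compl.
have c0 : 0 <= (1 / 2 : R) ^+ m by rewrite exprn_ge0//; lra.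
apply: (le_trans (@derivn_bern_norm_le n _ ((1 / 2) ^+ m) 2 k x x01 _ c0 _)) => //.
  move=> j; have [mj|_] := ltnP m j; last first.
    by rewrite normr0 mulr_ge0 ?exprn_ge0//; lra.
  rewrite normr1 -(subnK (ltnW mj)) exprD mulrCA -exprMn.
  by rewrite mul1r mulVf// expr1n mulr1 exprn_ege1//; lra.
case: leqP => [kn|_]; last by rewrite mulr_ge0 ?expR_ge0 ?exprn_ge0 ?mulr_ge0.
rewrite [(4 * _) ^+ k]exprMn [4 ^+ k * _]mulrC -!mulrA ler_wpM2l ?exprn_ge0//.
have h1 : (1 / 2) ^+ m <= expR (- (1 / 2) * m%:R) :> R.
  rewrite expRM_natr; apply: ler_exprn; first lra.
  exact: half_le_expR.
have h2 : (1 - x + x * 2) ^+ (n - k) <= expR (x * n%:R).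
  apply: (@le_trans _ _ ((1 - x + x * 2) ^+ n)).
    by rewrite ler_weXn2l ?leq_subr//; lra.
  rewrite expRM_natr; apply: ler_exprn; first lra.
  by apply: le_trans (expR_ge1Dx _); lra.
have h3 : (1 + 2) ^+ k <= 4 ^+ k :> R by apply: ler_exprn => //; lra.
rewrite mulrCA; apply: ler_pM => //; rewrite ?mulr_ge0 ?exprn_ge0//; try lra.
apply: le_trans (ler_pM _ _ h1 h2) _; rewrite ?exprn_ge0//; try lra.
by rewrite -expRD ler_expR; lra.
Qed.

End BernsteinCutoff.

(** * The reduced system A w = h *)

Section CourseOfValues.

(** Recursion on all earlier values of the sequence, for steps that depend on nothing
else. *)
Lemma course_of_values (T : Type) (t0 : T) (step : nat -> (nat -> T) -> T) :
  (forall n f g, (forall k, (k < n)%N -> f k = g k) -> step n f = step n g) ->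
  exists v, forall n, v n = step n v.
Proof.
move=> ext.
pose F := fix F n : nat -> T := if n is n'.+1 then
  (fun k => if (k < n')%N then F n' k else step n' (F n')) else fun=> t0.
have FS n k : F n.+1 k = if (k < n)%N then F n k else step n (F n) by [].
have stab k n : (k < n)%N -> F n k = F k.+1 k.
  elim: n => [//|n IH]; rewrite ltnS leq_eqVlt => /predU1P[->//|kn].
  by rewrite FS kn IH.
exists (fun k => F k.+1 k) => n; rewrite FS ltnn; apply: ext => k kn.
exact: stab.
Qed.

End CourseOfValues.

Section LinearSystem.
Context {R : realType}.
Implicit Types (w h : 'I_2 -> nat -> R -> R).

(** The n-th derivative of the component l of A w. *)
Definition sysop (a : 'I_2 -> 'I_2 -> nat -> R -> R) w (l : 'I_2) n (x : R) : R :=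
  leib ((a l ord0)^~ x) ((w ord0)^~ x) n + leib ((a l ord_max)^~ x) ((w ord_max)^~ x) n.

Definition quadform (a : 'I_2 -> 'I_2 -> nat -> R -> R) (x p q : R) : R :=
  p * (a ord0 ord0 0%N x * p + a ord0 ord_max 0%N x * q) +
  q * (a ord_max ord0 0%N x * p + a ord_max ord_max 0%N x * q).

Definition coercive (alpha : R) (a : 'I_2 -> 'I_2 -> nat -> R -> R) : Prop :=
  forall x, 0 <= x <= 1 -> forall p q,
    alpha ^+ 2 * (p ^+ 2 + q ^+ 2) <= quadform a x p q.

Lemma ord2E (P : 'I_2 -> Prop) : P ord0 -> P ord_max -> forall l, P l.
Proof.
move=> P0 P1 [[|[|//]] i].
  by rewrite (_ : Ordinal i = ord0) //; exact: val_inj.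
by rewrite (_ : Ordinal i = ord_max) //; exact: val_inj.
Qed.

(** Test the system with its solution, and compare with the larger of the two
unknowns. *)
Lemma coercive_solution_le alpha (a00 a01 a10 a11 p q B : R) : 0 < alpha ->
  alpha ^+ 2 * (p ^+ 2 + q ^+ 2) <= p * (a00 * p + a01 * q) + q * (a10 * p + a11 * q) ->
  `|a00 * p + a01 * q| <= B -> `|a10 * p + a11 * q| <= B ->
  `|p| <= 2 / alpha ^+ 2 * B /\ `|q| <= 2 / alpha ^+ 2 * B.
Proof.
move=> al0; set r := a00 * p + _; set s := a10 * p + _ => E rB sB.
have al2 : 0 < alpha ^+ 2 by rewrite exprn_gt0.
have H m : 0 <= m -> `|p| <= m -> `|q| <= m -> m ^+ 2 <= p ^+ 2 + q ^+ 2 ->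
    m <= 2 / alpha ^+ 2 * B.
  move=> m0 pm qm mm; rewrite mulrAC ler_pdivlMr//.
  have h1 : alpha ^+ 2 * m ^+ 2 <= 2 * B * m.
    apply: le_trans (ler_wpM2l (ltW al2) mm) _; apply: le_trans E _.
    have h : forall u v : R, `|u| <= m -> `|v| <= B -> u * v <= m * B.
      move=> u v um vB; apply: le_trans (ler_norm _) _; rewrite normrM.
      by apply: ler_pM.
    by have := h p r pm rB; have := h q s qm sB; lra.
  have [->|mn0] := eqVneq m 0.
    by rewrite mul0r mulr_ge0// (le_trans (normr_ge0 r)).
  have mp : 0 < m by rewrite lt_neqAle eq_sym mn0.
  by rewrite -(ler_pM2r mp); lra.
have n0 := normr_ge0 p; have n1 := normr_ge0 q.
have [pq|qp] := leP `|p| `|q|.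
  have := H `|q| n1 pq (lexx _); rewrite real_normK ?num_real// => /(_ _) h.
  have {}h : `|q| <= 2 / alpha ^+ 2 * B by apply: h; rewrite lerDr sqr_ge0.
  by split=> //; apply: le_trans h.
have := H `|p| n0 (lexx _) (ltW qp); rewrite real_normK ?num_real// => /(_ _) h.
have {}h : `|p| <= 2 / alpha ^+ 2 * B by apply: h; rewrite lerDl sqr_ge0.
by split=> //; apply: le_trans h; exact: ltW.
Qed.

Lemma eq_leib_tail (a v v' : nat -> R) n : (forall k, (k < n)%N -> v k = v' k) ->
  leib_tail a v n = leib_tail a v' n.
Proof.
move=> vv; apply: eq_bigr => k _; rewrite vv//.
by rewrite ltn_subrL (leq_ltn_trans _ (ltn_ord k)).
Qed.

Lemma is_derive_leib_tail (a v : nat -> R -> R) n (x : R) :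
  (forall k, is_derive x 1 (a k) (a k.+1 x)) ->
  (forall k, (k < n)%N -> is_derive x 1 (v k) (v k.+1 x)) ->
  is_derive x 1 (fun y => leib_tail (a^~ y) (v^~ y) n)
    (leib (a^~ x) (v^~ x) n.+1 - a 1%N x * v n x - a 0%N x * v n.+1 x).
Proof.
move=> da dv.
have -> : leib (a^~ x) (v^~ x) n.+1 - a 1%N x * v n x - a 0%N x * v n.+1 x =
  \sum_(k < n) 'C(n, k.+1)%:R *
    (a k.+2 x * v (n - k.+1)%N x + a k.+1 x * v (n - k.+1).+1 x).
  rewrite leibS !leib_head /leib_tail.
  under [RHS]eq_bigr => k _ do rewrite mulrDr.
  by rewrite big_split /=; ring.
apply: isD_sum => k; apply: isD_Z; apply: isD_M.
by apply: dv; rewrite ltn_subrL (leq_ltn_trans _ (ltn_ord k)).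
Qed.

Lemma ctsI_leib_tail (a v : nat -> R -> R) n : (forall k, ctsI (a k)) ->
  (forall k, (k < n)%N -> ctsI (v k)) ->
  ctsI (fun y => leib_tail (a^~ y) (v^~ y) n).
Proof.
move=> ca cv; apply: ctsI_sum => k _; apply: ctsIM; first exact: ctsI_cst.
apply: ctsIM; first exact: ca.
by apply: cv; rewrite ltn_subrL (leq_ltn_trans _ (ltn_ord k)).
Qed.

End LinearSystem.

Section SolveLinearSystem.
Context {R : realType}.
Variables (alpha : R) (a : 'I_2 -> 'I_2 -> nat -> R -> R).
Hypothesis alpha0 : 0 < alpha.
Hypothesis ta : forall i j, tower (a i j).
Hypothesis coa : coercive alpha a.
Implicit Types (w h : 'I_2 -> nat -> R -> R).

Let a00 := a ord0 ord0 0%N.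
Let a01 := a ord0 ord_max 0%N.
Let a10 := a ord_max ord0 0%N.
Let a11 := a ord_max ord_max 0%N.
Let det x := a00 x * a11 x - a01 x * a10 x.

Let det_gt0 x : 0 <= x <= 1 -> 0 < det x.
Proof.
move=> x01; have al2 : 0 < alpha ^+ 2 by rewrite exprn_gt0.
have h0 : 0 < a00 x by have := coa x01 1 0; rewrite /quadform -/a00; lra.
(* Test coercivity with a vector orthogonal to the first row. *)
have h1 := coa x01 (- a01 x) (a00 x).
have h2 : quadform a x (- a01 x) (a00 x) = a00 x * det x.
  by rewrite /quadform /det -/a00 -/a01 -/a10 -/a11; ring.
rewrite h2 in h1; have : 0 < a00 x * det x.
  apply: lt_le_trans h1; apply: mulr_gt0 => //.
  by have := sqr_ge0 (- a01 x); have := exprn_gt0 2 h0; lra.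
by rewrite pmulr_rgt0.
Qed.

Lemma sys_uniq x p q p' q' : 0 <= x <= 1 ->
  a00 x * p + a01 x * q = a00 x * p' + a01 x * q' ->
  a10 x * p + a11 x * q = a10 x * p' + a11 x * q' -> p = p' /\ q = q'.
Proof.
move=> x01 e0 e1; have dn0 : det x != 0 by rewrite gt_eqF// det_gt0.
split; apply: (mulfI dn0); rewrite /det.
  have -> : (a00 x * a11 x - a01 x * a10 x) * p =
    a11 x * (a00 x * p + a01 x * q) - a01 x * (a10 x * p + a11 x * q) by ring.
  by rewrite e0 e1; ring.
have -> : (a00 x * a11 x - a01 x * a10 x) * q =
  a00 x * (a10 x * p + a11 x * q) - a10 x * (a00 x * p + a01 x * q) by ring.
by rewrite e0 e1; ring.
Qed.

Let tailh h w l n x := h l n x -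
  (leib_tail ((a l ord0)^~ x) ((w ord0)^~ x) n +
   leib_tail ((a l ord_max)^~ x) ((w ord_max)^~ x) n).

(** Cramer's rule, one order of differentiation after the other: the n-th derivatives of
the unknowns solve the same 2 x 2 system, with a right-hand side that involves lower
derivatives only. That the functions obtained in this way are derivatives of one another
follows from the uniqueness of the solution of the system. *)
Lemma solve_system h : (forall l, tower (h l)) -> exists w,
  (forall l, tower (w l)) /\
  forall l n x, 0 <= x <= 1 -> sysop a w l n x = h l n x.
Proof.
move=> th.
pose sw (f : nat -> 'I_2 -> R -> R) : 'I_2 -> nat -> R -> R := fun l n => f n l.
pose step n f (l : 'I_2) (x : R) : R := (if l == ord0 then
    a11 x * tailh h (sw f) ord0 n x - a01 x * tailh h (sw f) ord_max n x
  else a00 x * tailh h (sw f) ord_max n x - a10 x * tailh h (sw f) ord0 n x) * ((det x)^-1)%R.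
have [n f g fg|v vE] := @course_of_values ('I_2 -> R -> R) (fun=> fun=> 0) step.
  have E l x : tailh h (sw f) l n x = tailh h (sw g) l n x.
    by rewrite /tailh; congr (_ - (_ + _)); apply: eq_leib_tail => k /fg; rewrite /sw => ->.
  by apply/funext => l; apply/funext => x; rewrite /step !E.
pose w := sw v; exists w.
have wE0 n x : w ord0 n x =
    (a11 x * tailh h w ord0 n x - a01 x * tailh h w ord_max n x) * ((det x)^-1)%R.
  by rewrite /w {1}/sw vE /step eqxx.
have wE1 n x : w ord_max n x =
    (a00 x * tailh h w ord_max n x - a10 x * tailh h w ord0 n x) * ((det x)^-1)%R.
  by rewrite /w {1}/sw vE /step.
have eq0 n x : 0 <= x <= 1 ->
    a00 x * w ord0 n x + a01 x * w ord_max n x = tailh h w ord0 n x.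
  by move=> x01; rewrite wE0 wE1 /det; field; rewrite gt_eqF// det_gt0.
have eq1 n x : 0 <= x <= 1 ->
    a10 x * w ord0 n x + a11 x * w ord_max n x = tailh h w ord_max n x.
  by move=> x01; rewrite wE0 wE1 /det; field; rewrite gt_eqF// det_gt0.
have sys l n x : 0 <= x <= 1 -> sysop a w l n x = h l n x.
  move=> x01; rewrite /sysop !leib_head.
  move: l; apply: ord2E.
    by have := eq0 n x x01; rewrite /tailh -/a00 -/a01; lra.
  by have := eq1 n x x01; rewrite /tailh -/a10 -/a11; lra.
have cdet : ctsI (fun x => ((det x)^-1)%R).
  apply: ctsIV; last by move=> x x01; rewrite gt_eqF// det_gt0.
  by apply: ctsIB; apply: ctsIM; exact: (ta _ _).1.
have cw n l : ctsI (w l n).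
  elim/ltn_ind: n l => n IH.
  have ct l : ctsI (tailh h w l n).
    apply: ctsIB; first exact: (th l).1.
    by apply: ctsID; apply: ctsI_leib_tail;
      [exact: (ta _ _).1|move=> k kn; exact: IH|
       exact: (ta _ _).1|move=> k kn; exact: IH].
  apply: ord2E.
    apply: eq_ctsI (fun x _ => esym (wE0 n x)) _.
    by apply: ctsIM => //; apply: ctsIB; apply: ctsIM => //; exact: (ta _ _).1.
  apply: eq_ctsI (fun x _ => esym (wE1 n x)) _.
  by apply: ctsIM => //; apply: ctsIB; apply: ctsIM => //; exact: (ta _ _).1.
split=> // l; split=> [n|n x x01]; first exact: cw.
elim/ltn_ind: n l => n IH.
have x01' : 0 <= x <= 1 by move: x01 => /andP[/ltW -> /ltW ->].
have da i j k : is_derive x 1 (a i j k) (a i j k.+1 x) by exact: (ta i j).2.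
pose dt l := h l n.+1 x -
  ((leib ((a l ord0)^~ x) ((w ord0)^~ x) n.+1 - a l ord0 1%N x * w ord0 n x -
      a l ord0 0%N x * w ord0 n.+1 x) +
   (leib ((a l ord_max)^~ x) ((w ord_max)^~ x) n.+1 - a l ord_max 1%N x * w ord_max n x -
      a l ord_max 0%N x * w ord_max n.+1 x)).
have dtP l : is_derive x 1 (tailh h w l n) (dt l).
  apply: isD_B; first exact: (th l).2.
  by apply: isD_D; apply: is_derive_leib_tail => // k kn; exact: IH.
have dtE l : dt l = a l ord0 1%N x * w ord0 n x + a l ord0 0%N x * w ord0 n.+1 x +
   (a l ord_max 1%N x * w ord_max n x + a l ord_max 0%N x * w ord_max n.+1 x).
  by rewrite /dt -(sys l n.+1 x x01') /sysop; ring.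
have ddet : derivable (fun y => ((det y)^-1)%R) x 1.
  apply: derivableV; first by rewrite gt_eqF// det_gt0.
  exact: is_derive_derivable (isD_B (isD_M (da ord0 ord0 0%N) (da ord_max ord_max 0%N))
    (isD_M (da ord0 ord_max 0%N) (da ord_max ord0 0%N))).
have [y0 dw0] : exists y0, is_derive x 1 (w ord0 n) y0.
  exists ('D_1 (w ord0 n) x); apply: derivableP.
  rewrite (_ : w ord0 n = fun y => (a11 y * tailh h w ord0 n y -
    a01 y * tailh h w ord_max n y) * ((det y)^-1)%R); last exact/funext.
  exact: is_derive_derivable (isD_M (isD_B (isD_M (da ord_max ord_max 0%N) (dtP ord0))
    (isD_M (da ord0 ord_max 0%N) (dtP ord_max))) (derivableP ddet)).
have [y1 dw1] : exists y1, is_derive x 1 (w ord_max n) y1.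
  exists ('D_1 (w ord_max n) x); apply: derivableP.
  rewrite (_ : w ord_max n = fun y => (a00 y * tailh h w ord_max n y -
    a10 y * tailh h w ord0 n y) * ((det y)^-1)%R); last exact/funext.
  exact: is_derive_derivable (isD_M (isD_B (isD_M (da ord0 ord0 0%N) (dtP ord_max))
    (isD_M (da ord_max ord0 0%N) (dtP ord0))) (derivableP ddet)).
have E0 : a ord0 ord0 1%N x * w ord0 n x + a00 x * y0 +
    (a ord0 ord_max 1%N x * w ord_max n x + a01 x * y1) = dt ord0.
  apply: is_derive_uniq (dtP ord0).
  apply: (eq_isD (f := fun y => a00 y * w ord0 n y + a01 y * w ord_max n y) x01).
    by move=> y /andP[/ltW y0' /ltW y1']; rewrite eq0// y0' y1'.
  exact: isD_D (isD_M (da _ _ _) dw0) (isD_M (da _ _ _) dw1).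
have E1 : a ord_max ord0 1%N x * w ord0 n x + a10 x * y0 +
    (a ord_max ord_max 1%N x * w ord_max n x + a11 x * y1) = dt ord_max.
  apply: is_derive_uniq (dtP ord_max).
  apply: (eq_isD (f := fun y => a10 y * w ord0 n y + a11 y * w ord_max n y) x01).
    by move=> y /andP[/ltW y0' /ltW y1']; rewrite eq1// y0' y1'.
  exact: isD_D (isD_M (da _ _ _) dw0) (isD_M (da _ _ _) dw1).
(* The differentiated system of order n and the system of order n + 1 coincide. *)
have [Ey0 Ey1] : y0 = w ord0 n.+1 x /\ y1 = w ord_max n.+1 x.
  apply: (sys_uniq x01').
    by move: E0; rewrite dtE -/a00 -/a01; lra.
  by move: E1; rewrite dtE -/a10 -/a11; lra.
by apply: ord2E; rewrite -?Ey0 -?Ey1.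
Qed.

End SolveLinearSystem.

(** * The outer expansion *)

Section SolutionBounds.
Context {R : realType}.

Lemma fact_binom_le n k s : (k <= n)%N ->
  ('C(n, k) * k`! * (n - k + s)`! <= (n + s)`!)%N.
Proof.
move=> kn; have kns : (k <= n + s)%N by rewrite (leq_trans kn)// leq_addr.
rewrite -(bin_fact kns) -mulnA addnC addnBA// addnC.
by rewrite leq_mul2r leq_bin2l ?leq_addr ?orbT.
Qed.

Lemma sum_geom_le n (t : R) : 0 <= t -> t <= 1 / 2 ->
  \sum_(k < n) t ^+ k.+1 <= 2 * t.
Proof.
move=> t0 t2; elim: n => [|n IH]; first by rewrite big_ord0 mulr_ge0.
rewrite big_ord_recl /= expr1.
have -> : \sum_(i < n) t ^+ (bump 0 i).+1 = t * \sum_(i < n) t ^+ i.+1.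
  by rewrite mulr_sumr; apply: eq_bigr => i _; rewrite -exprS.
have := ler_wpM2l t0 IH; nra.
Qed.

(** If the second factor grows faster than the analytic first one, by a factor 1 / t,
then its lower derivatives contribute the small multiple 2 t of the bound expected for
the top one. *)
Lemma leib_tail_le (a v : nat -> R) n s (Ca ga X rho t : R) :
  0 <= Ca -> 0 <= ga -> 0 <= X -> 0 <= rho -> 0 <= t -> t <= 1 / 2 -> ga = t * rho ->
  (forall k, `|a k| <= Ca * ga ^+ k * k`!%:R) ->
  (forall k, (k < n)%N -> `|v k| <= X * rho ^+ k * (k + s)`!%:R) ->
  `|leib_tail a v n| <= Ca * X * rho ^+ n * (n + s)`!%:R * (2 * t).
Proof.
move=> Ca0 ga0 X0 rho0 t0 t2 gaE ha hv.
apply: le_trans (ler_norm_sum _ _ _) _.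
apply: le_trans (_ : \sum_(k < n) Ca * X * rho ^+ n * (n + s)`!%:R * t ^+ k.+1 <= _).
  apply: ler_sum => k _; rewrite !normrM normr_nat.
  have kn : (n - k.+1 < n)%N by rewrite ltn_subrL (leq_ltn_trans _ (ltn_ord k)).
  have h := ler_wpM2l (ler0n R 'C(n, k.+1)) (ler_pM (normr_ge0 _) (normr_ge0 _) (ha k.+1) (hv _ kn)).
  apply: le_trans h _.
  have -> : rho ^+ n = rho ^+ k.+1 * rho ^+ (n - k.+1).
    by rewrite -exprD subnKC// ltn_ord.
  rewrite gaE exprMn.
  have -> : 'C(n, k.+1)%:R * (Ca * (t ^+ k.+1 * rho ^+ k.+1) * (k.+1)`!%:R *
     (X * rho ^+ (n - k.+1) * (n - k.+1 + s)`!%:R)) =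
     Ca * X * (rho ^+ k.+1 * rho ^+ (n - k.+1)) * t ^+ k.+1 *
     ('C(n, k.+1) * (k.+1)`! * (n - k.+1 + s)`!)%N%:R.
    by rewrite !natrM; ring.
  rewrite [leRHS]mulrAC ler_wpM2l//; first by rewrite !mulr_ge0 ?exprn_ge0.
  by rewrite ler_nat fact_binom_le// ltn_ord.
rewrite -mulr_sumr ler_wpM2l ?mulr_ge0 ?exprn_ge0//.
exact: sum_geom_le.
Qed.

Variables (alpha Ca ga : R) (a : 'I_2 -> 'I_2 -> nat -> R -> R).
Hypothesis alpha0 : 0 < alpha.
Hypothesis Ca0 : 0 < Ca.
Hypothesis ga0 : 0 < ga.
Hypothesis ta : forall i j, tower (a i j).
Hypothesis coa : coercive alpha a.
Hypothesis ba : forall i j n x, 0 <= x <= 1 ->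
  `|a i j n x| <= Ca * ga ^+ n * n`!%:R.
Implicit Types (w h : 'I_2 -> nat -> R -> R).

(** Solving a system with analytic coefficients preserves bounds rho^n (n + s)! on the
derivatives, once rho is so large that the contribution of the lower derivatives can be
absorbed. The shift s makes room for the derivatives taken by an iteration. *)
Lemma solution_bound h w s (H rho : R) : 0 <= H ->
  2 * ga <= rho -> 16 * Ca * ga / alpha ^+ 2 <= rho ->
  (forall l n x, 0 <= x <= 1 -> sysop a w l n x = h l n x) ->
  (forall l n x, 0 <= x <= 1 -> `|h l n x| <= H * rho ^+ n * (n + s)`!%:R) ->
  forall l n x, 0 <= x <= 1 ->
    `|w l n x| <= 4 / alpha ^+ 2 * H * rho ^+ n * (n + s)`!%:R.
Proof.
move=> H0 rho1 rho2 sys hh l n x x01.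
have [ga1 Ca1] := (ga0, Ca0).
have al2 : 0 < alpha ^+ 2 by rewrite exprn_gt0.
have rho0 : 0 < rho by lra.
pose t := ga / rho.
have t0 : 0 <= t by rewrite divr_ge0 ?ltW.
have t2 : t <= 1 / 2 by rewrite ler_pdivrMr//; lra.
have gaE : ga = t * rho by rewrite divfK// gt_eqF.
have tC : 8 * Ca * t <= alpha ^+ 2 / 2.
  rewrite /t mulrA ler_pdivrMr//.
  by move: rho2; rewrite ler_pdivrMr//; lra.
elim/ltn_ind: n l => n IH.
set X := 4 / alpha ^+ 2 * H in IH *.
have X0 : 0 <= X by rewrite mulr_ge0// divr_ge0// ltW.
set N : R := rho ^+ n * (n + s)`!%:R.
have N0 : 0 <= N by rewrite mulr_ge0// exprn_ge0// ltW.
have tl l j : `|leib_tail ((a l j)^~ x) ((w j)^~ x) n| <= Ca * X * N * (2 * t).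
  have -> : Ca * X * N * (2 * t) = Ca * X * rho ^+ n * (n + s)`!%:R * (2 * t).
    by rewrite /N; ring.
  apply: (leib_tail_le (ltW Ca0) (ltW ga0) X0 (ltW rho0) t0 t2 gaE).
    by move=> k; exact: ba.
  by move=> k kn; exact: IH.
pose q l := h l n x - (leib_tail ((a l ord0)^~ x) ((w ord0)^~ x) n +
  leib_tail ((a l ord_max)^~ x) ((w ord_max)^~ x) n).
have qE l : a l ord0 0%N x * w ord0 n x + a l ord_max 0%N x * w ord_max n x = q l.
  by rewrite /q -(sys l n x x01) /sysop !leib_head; ring.
have qB l : `|q l| <= N * (H + 4 * Ca * X * t).
  apply: le_trans (ler_normB _ _) _.
  have hN : `|h l n x| <= H * N by rewrite /N mulrA; exact: hh.
  have := ler_normD (leib_tail ((a l ord0)^~ x) ((w ord0)^~ x) n)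
    (leib_tail ((a l ord_max)^~ x) ((w ord_max)^~ x) n).
  by have := tl l ord0; have := tl l ord_max; lra.
have [||h0 h1] := @coercive_solution_le R alpha (a ord0 ord0 0%N x) (a ord0 ord_max 0%N x)
   (a ord_max ord0 0%N x) (a ord_max ord_max 0%N x) (w ord0 n x) (w ord_max n x)
   (N * (H + 4 * Ca * X * t)) alpha0 (coa x01 _ _).
- by rewrite qE.
- by rewrite qE.
suff E : 2 / alpha ^+ 2 * (N * (H + 4 * Ca * X * t)) <= X * N.
  by apply: ord2E; rewrite -mulrA -/N; apply: le_trans E.
have -> : X * N = 2 / alpha ^+ 2 * (N * (alpha ^+ 2 / 2 * X)).
  by field; rewrite gt_eqF.
apply: ler_wpM2l; first by rewrite divr_ge0// ltW.
apply: ler_wpM2l => //.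
have := ler_wpM2r X0 tC.
have -> : H = alpha ^+ 2 / 4 * X by rewrite /X; field; rewrite gt_eqF.
lra.
Qed.

(** A solution operator defined for all right-hand sides, over which one can iterate. *)
Lemma solve_all : exists sol : ('I_2 -> nat -> R -> R) -> 'I_2 -> nat -> R -> R,
  forall h, (forall l, tower (h l)) -> (forall l, tower (sol h l)) /\
    forall l n x, 0 <= x <= 1 -> sysop a (sol h) l n x = h l n x.
Proof.
have H h : exists w : 'I_2 -> nat -> R -> R, (forall l, tower (h l)) ->
    (forall l, tower (w l)) /\ forall l n x, 0 <= x <= 1 -> sysop a w l n x = h l n x.
  have [th|nth] := pselect (forall l, tower (h l)); last by exists h.
  by have [w wP] := solve_system alpha0 ta coa th; exists w.
by have [sol solP] := choice H; exists sol => h th; apply: solP.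
Qed.

Variables (f : 'I_2 -> nat -> R -> R) (Cf gf : R).
Hypothesis tf : forall l, tower (f l).
Hypothesis Cf0 : 0 < Cf.
Hypothesis gf0 : 0 < gf.
Hypothesis bf : forall l n x, 0 <= x <= 1 -> `|f l n x| <= Cf * gf ^+ n * n`!%:R.

Let rho := 2 * ga + 16 * Ca * ga / alpha ^+ 2 + gf.
Let K := 4 / alpha ^+ 2 * rho ^+ 2.

(** One step of the expansion differentiates twice and solves once: this turns
rho^n (n + 2 i)! into (4 / alpha^2) rho^(n + 2) (n + 2 i + 2)!, whence the factor K per
step. *)
Lemma outer_expansion (E : 'I_2 -> R) : (forall l, 0 <= E l <= 1) ->
  exists h w : nat -> 'I_2 -> nat -> R -> R,
  [/\ forall i l, tower (h i l) /\ tower (w i l),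
      h 0%N = f /\ (forall i l n x, h i.+1 l n x = E l * w i l n.+2 x),
      forall i l n x, 0 <= x <= 1 -> sysop a (w i) l n x = h i l n x,
      forall i l n x, 0 <= x <= 1 ->
        `|h i l n x| <= Cf * K ^+ i * rho ^+ n * (n + 2 * i)`!%:R &
      forall i l n x, 0 <= x <= 1 ->
        `|w i l n x| <= 4 / alpha ^+ 2 * (Cf * K ^+ i) * rho ^+ n * (n + 2 * i)`!%:R].
Proof.
move=> E01; have [sol solP] := solve_all.
have [ga1 gf1] := (ga0, gf0).
pose h := fix h i : 'I_2 -> nat -> R -> R :=
  if i is i'.+1 then (fun l n x => E l * sol (h i') l n.+2 x) else f.
pose w i := sol (h i).
have al2 : 0 < alpha ^+ 2 by rewrite exprn_gt0.
have c0 : 0 < 16 * Ca * ga / alpha ^+ 2 by rewrite divr_gt0// !mulr_gt0.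
have rho0 : 0 < rho by rewrite /rho; lra.
have K0 : 0 < K by rewrite mulr_gt0 ?divr_gt0 ?exprn_gt0.
have th i l : tower (h i l).
  elim: i l => [//|i IH] l; apply: towerZ.
  have := tower_shift 2 ((solP _ IH).1 l).
  by under eq_fun do rewrite addn2.
have sys i l n x : 0 <= x <= 1 -> sysop a (w i) l n x = h i l n x.
  exact: (solP _ (th i)).2.
have wb i : (forall l n x, 0 <= x <= 1 ->
      `|h i l n x| <= Cf * K ^+ i * rho ^+ n * (n + 2 * i)`!%:R) ->
    forall l n x, 0 <= x <= 1 ->
      `|w i l n x| <= 4 / alpha ^+ 2 * (Cf * K ^+ i) * rho ^+ n * (n + 2 * i)`!%:R.
  move=> hb; apply: (@solution_bound (h i) _ _ _ _ _ _ _ (sys i) hb).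
  - by rewrite mulr_ge0 ?exprn_ge0 ?ltW.
  - by rewrite /rho; lra.
  - by rewrite /rho; lra.
have hb i l n x : 0 <= x <= 1 ->
    `|h i l n x| <= Cf * K ^+ i * rho ^+ n * (n + 2 * i)`!%:R.
  elim: i l n x => [|i IH] l n x x01.
    rewrite expr0 mulr1 muln0 addn0; apply: le_trans (bf l n x01) _.
    apply: ler_wpM2r => //; apply: ler_wpM2l; first exact: ltW.
    by apply: ler_exprn; [exact: ltW|rewrite /rho; lra].
  rewrite /= normrM; have /andP[El0 El1] := E01 l; rewrite (ger0_norm El0).
  apply: le_trans (_ : `|w i l n.+2 x| <= _); first by rewrite ler_piMl.
  apply: le_trans (wb _ IH l n.+2 x x01) _.
  have -> : (n.+2 + 2 * i = n + 2 * i.+1)%N by rewrite mulnS addnA addn2.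
  have -> : Cf * K ^+ i.+1 * rho ^+ n = 4 / alpha ^+ 2 * (Cf * K ^+ i) * rho ^+ n.+2.
    by rewrite exprS; set Ki := K ^+ i; rewrite 2!(exprS rho) /K; ring.
  exact: lexx.
exists h, w; split=> //.
  by move=> i l; split; [exact: th|exact: (solP _ (th i)).1].
by move=> i; apply: wb; exact: hb.
Qed.

End SolutionBounds.

Section SmoothPart.
Context {R : realType}.

Lemma fact_le_expn n m : (n <= m)%N -> (n`! <= m ^ n)%N.
Proof.
elim: n => [//|n IH] nm; rewrite factS expnS leq_mul// IH//.
exact: ltnW.
Qed.

(** Separates the factorial growth due to differentiation from the growth along the
expansion, which powers of mu^2 compensate as long as m mu is small. *)
Lemma fact_add_le n i m : (i <= m)%N ->
  ((n + 2 * i)`! <= 2 ^ n * n`! * (16 * m ^ 2) ^ i)%N.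
Proof.
move=> im; have nN : (n <= n + 2 * i)%N by exact: leq_addr.
rewrite -(bin_fact nN) addKn.
have h1 : ('C(n + 2 * i, n) <= 2 ^ (n + 2 * i))%N.
  rewrite (expnDn 1 1).
  under eq_bigr => k _ do rewrite !exp1n !muln1.
  rewrite (bigD1 (Ordinal (nN : (n < (n + 2 * i).+1)%N))) //=.
  exact: leq_addr.
have h2 : ((2 * i)`! <= (2 * m) ^ (2 * i))%N.
  by apply: fact_le_expn; rewrite leq_mul2l im.
apply: leq_trans (leq_mul h1 (leq_mul (leqnn _) h2)) _.
rewrite expnD -!mulnA leq_mul2l; apply/orP; right.
rewrite mulnCA leq_mul2l; apply/orP; right.
by rewrite -expnMn expnM mulnA expnMn.
Qed.

Definition dcoef (eps mu : R) (l : 'I_2) : R :=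
  if l == ord0 then eps ^+ 2 else mu ^+ 2.

(** Truncation of the outer expansion after about k0 / mu terms, with k0 so small that
16 K k0^2 <= 1 / 2: then the i-th term is at most 2^(- i) times a fixed bound. Hence the
sum is bounded uniformly in eps and mu, and its residual, which by telescoping is the first
neglected right-hand side, is exponentially small in 1 / mu. *)
Lemma smooth_part (alpha Ca ga Cf gf : R) (a : 'I_2 -> 'I_2 -> nat -> R -> R)
    (f : 'I_2 -> nat -> R -> R) : 0 < alpha -> 0 < Ca -> 0 < ga -> 0 < Cf -> 0 < gf ->
  (forall i j, tower (a i j)) -> coercive alpha a ->
  (forall i j n x, 0 <= x <= 1 -> `|a i j n x| <= Ca * ga ^+ n * n`!%:R) ->
  (forall l, tower (f l)) ->
  (forall l n x, 0 <= x <= 1 -> `|f l n x| <= Cf * gf ^+ n * n`!%:R) ->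
  exists C gam kap : R, [/\ 0 < C, 0 < gam & 0 < kap] /\
  forall eps mu : R, 0 < eps -> eps <= mu ->
  exists W G : 'I_2 -> nat -> R -> R,
  [/\ forall l, tower (W l) /\ tower (G l),
      forall l n x, 0 <= x <= 1 -> `|W l n x| <= C * gam ^+ n * n`!%:R,
      forall l n x, 0 <= x <= 1 ->
        `|G l n x| <= C * gam ^+ n * n`!%:R * expR (- (kap / mu)) &
      forall l n x, 0 <= x <= 1 ->
        G l n x = f l n x - sysop a W l n x + dcoef eps mu l * W l n.+2 x].
Proof.
move=> al0 Ca0 ga0 Cf0 gf0 ta coa ba tf bf.
have al2 : 0 < alpha ^+ 2 by rewrite exprn_gt0.
pose rho := 2 * ga + 16 * Ca * ga / alpha ^+ 2 + gf.
pose K := 4 / alpha ^+ 2 * rho ^+ 2.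
have rho0 : 0 < rho.
  have : 0 < 16 * Ca * ga / alpha ^+ 2 by rewrite divr_gt0// !mulr_gt0.
  by rewrite /rho; lra.
have K0 : 0 < K by rewrite mulr_gt0 ?divr_gt0 ?exprn_gt0.
pose k0 := 1 / (32 * K + 1).
have k00 : 0 < k0 by rewrite divr_gt0//; lra.
have k01 : k0 <= 1 by rewrite ler_pdivrMr; lra.
have kK : 16 * K * k0 ^+ 2 <= 1 / 2.
  have : k0 * (32 * K + 1) = 1 by rewrite divfK// gt_eqF//; lra.
  by rewrite expr2; nra.
pose X := 4 / alpha ^+ 2 * Cf.
have X0 : 0 < X by rewrite mulr_gt0 ?divr_gt0.
exists (2 * X + 2 * Cf), (2 * rho), (k0 / 2); split; first by split; lra.
move=> eps mu eps0 em.
have mu0 : 0 < mu by exact: lt_le_trans em.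
have mu20 : 0 < mu ^+ 2 by rewrite exprn_gt0.
have em2 : eps ^+ 2 <= mu ^+ 2 by apply: ler_exprn => //; exact: ltW.
pose E l := dcoef eps mu l / mu ^+ 2.
have E01 l : 0 <= E l <= 1.
  rewrite /E /dcoef; case: ifP => _; last by rewrite divff ?gt_eqF// ler01 lexx.
  by rewrite divr_ge0 ?sqr_ge0//= ler_pdivrMr// mul1r.
have [h [w [thw [h0 hS] sys hb wb]]] :=
  outer_expansion al0 Ca0 ga0 ta coa ba tf Cf0 gf0 bf E01.
rewrite -/rho -/K in hb wb.
clearbody K rho.
pose m := Num.trunc (k0 / mu).
have km0 : 0 <= k0 / mu by rewrite divr_ge0 ?ltW.
have [mle' mlt] : m%:R <= k0 / mu /\ k0 / mu < m.+1%:R.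
  by have /andP[] := truncn_itv km0.
have mle : m%:R * mu <= k0 by rewrite -ler_pdivlMr.
have qb i : (i <= m)%N -> (mu ^+ 2) ^+ i * (K ^+ i * (16 * m%:R ^+ 2) ^+ i) <= (1 / 2) ^+ i.
  move=> im; rewrite -!exprMn; apply: ler_exprn.
    by rewrite !mulr_ge0 ?exprn_ge0//; exact: ltW.
  have -> : mu ^+ 2 * (K * (16 * m%:R ^+ 2)) = 16 * K * (m%:R * mu) ^+ 2 by ring.
  apply: le_trans kK; apply: ler_wpM2l; first by rewrite mulr_ge0//; exact: ltW.
  by apply: ler_exprn => //; rewrite mulr_ge0//; exact: ltW.
have fb n i (c y : R) : (i <= m)%N -> 0 <= c ->
    y <= c * K ^+ i * rho ^+ n * (n + 2 * i)`!%:R ->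
    (mu ^+ 2) ^+ i * y <= c * (2 * rho) ^+ n * n`!%:R * (1 / 2) ^+ i.
  move=> im c0 yb.
  have h1 : ((n + 2 * i)`!%:R : R) <= 2 ^+ n * n`!%:R * (16 * m%:R ^+ 2) ^+ i.
    have := fact_add_le n im; rewrite -(ler_nat R) !natrM !natrX natrM natrX => /le_trans; apply.
    exact: lexx.
  have c1 : 0 <= c * K ^+ i * rho ^+ n by rewrite !mulr_ge0 ?exprn_ge0//; exact: ltW.
  have := le_trans yb (ler_wpM2l c1 h1) => {}yb.
  have := ler_wpM2l (exprn_ge0 i (ltW mu20)) yb => /le_trans; apply.
  have -> : (mu ^+ 2) ^+ i * (c * K ^+ i * rho ^+ n * (2 ^+ n * n`!%:R * (16 * m%:R ^+ 2) ^+ i))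
    = c * (2 ^+ n * rho ^+ n) * n`!%:R * ((mu ^+ 2) ^+ i * (K ^+ i * (16 * m%:R ^+ 2) ^+ i)).
    by ring.
  rewrite -exprMn; apply: ler_wpM2l; last exact: qb.
  by rewrite !mulr_ge0 ?exprn_ge0 ?mulr_ge0//; exact: ltW.
pose W l n x := \sum_(i < m) (mu ^+ 2) ^+ i * w i l n x.
pose G l n x := (mu ^+ 2) ^+ m * h m l n x.
have hn j : 0 <= (mu ^+ 2) ^+ j by rewrite exprn_ge0// ltW.
have base n : 0 <= (2 * rho) ^+ n * n`!%:R by rewrite mulr_ge0 ?exprn_ge0 ?mulr_ge0//; exact: ltW.
exists W, G; split.
- move=> l; split; last by apply: towerZ; exact: (thw m l).1.
  apply: (@tower_sumZ R m (fun i n x => w i l n x) (fun i => (mu ^+ 2) ^+ i)) => i.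
  exact: (thw i l).2.
- move=> l n x x01; apply: le_trans (ler_norm_sum _ _ _) _.
  apply: le_trans (_ : \sum_(i < m) X * (2 * rho) ^+ n * n`!%:R * (1 / 2) ^+ i <= _).
    apply: ler_sum => i _; rewrite normrM (ger0_norm (hn _)).
    apply: fb; [exact: ltnW|exact: ltW|].
    by have := wb i l n x x01; rewrite /X; congr (_ <= _); ring.
  rewrite -mulr_sumr.
  have s2 : \sum_(i < m) (1 / 2 : R) ^+ i <= 2.
    have h2 : 0 <= 1 / 2 :> R by lra.
    have := @sum_geom_le R m (1 / 2) h2 (lexx _).
    under eq_bigr do rewrite exprS.
    by rewrite -mulr_sumr; lra.
  have Xb : 0 <= X * ((2 * rho) ^+ n * n`!%:R) by rewrite mulr_ge0//; exact: ltW.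
  have := ler_wpM2l Xb s2; have := mulr_ge0 (ltW Cf0) (base n); lra.
- move=> l n x x01; rewrite /G normrM (ger0_norm (hn _)).
  have := fb n m Cf `|h m l n x| (leqnn _) (ltW Cf0) (hb m l n x x01) => /le_trans; apply.
  have e1 : (1 / 2 : R) ^+ m <= 2 * expR (- (k0 / 2 / mu)).
    apply: le_trans (_ : expR (- (1 / 2) * m%:R) <= _).
      rewrite expRM_natr; apply: ler_exprn; first lra.
      exact: half_le_expR.
    have := @expR_half_le2 R => /(ler_wpM2r (expR_ge0 (- (k0 / 2 / mu)))).
    apply: le_trans; rewrite -expRD ler_expR.
    by move: mlt; rewrite -addn1 natrD; lra.
  have Cb : 0 <= Cf * ((2 * rho) ^+ n * n`!%:R) by rewrite mulr_ge0//; exact: ltW.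
  have := ler_wpM2l Cb e1.
  have := mulr_ge0 (mulr_ge0 (ltW X0) (base n)) (expR_ge0 (- (k0 / 2 / mu))); lra.
- move=> l n x x01; rewrite /G.
  have sysW : sysop a W l n x = \sum_(i < m) (mu ^+ 2) ^+ i * sysop a (w i) l n x.
    rewrite /sysop /W.
    rewrite (@leib_sumr R m _ (fun i k => w i ord0 k x) (fun i => (mu ^+ 2) ^+ i)).
    rewrite (@leib_sumr R m _ (fun i k => w i ord_max k x) (fun i => (mu ^+ 2) ^+ i)).
    by rewrite -big_split /=; apply: eq_bigr => i _; rewrite mulrDr.
  have dE : dcoef eps mu l = mu ^+ 2 * E l by rewrite /E mulrC divfK// gt_eqF.
  rewrite sysW dE /W mulr_sumr; under eq_bigr => i _ do rewrite sys//.
  elim: (m) => [|j IH]; first by rewrite !big_ord0 expr0 mul1r h0 subr0 addr0.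
  rewrite !big_ord_recr /= hS exprS.
  move: IH => /eqP; rewrite -subr_eq0 => /eqP IH.
  apply/eqP; rewrite -subr_eq0; apply/eqP; rewrite -[RHS]IH; ring.
Qed.

End SmoothPart.

(** * Exponential decay of the layers *)

Section LayerEstimates.
Context {R : realType}.

(** The size of a pair of boundary layers of width mu / kap at both end points. *)
Definition layer (kap mu x : R) : R :=
  expR (- (kap * x / mu)) + expR (- (kap * (1 - x) / mu)).

Definition dlayer (kap mu x : R) : R :=
  kap / mu * (expR (- (kap * (1 - x) / mu)) - expR (- (kap * x / mu))).

Lemma layer_gt0 kap mu x : 0 < layer kap mu x.
Proof. by rewrite addr_gt0// expR_gt0. Qed.

Lemma layer_rev kap mu x : layer kap mu (1 - x) = layer kap mu x.
Proof. by rewrite /layer addrC subKr. Qed.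

Lemma layer_0_ge1 kap mu : 1 <= layer kap mu 0.
Proof. by rewrite /layer mulr0 mul0r oppr0 expR0 lerDl expR_ge0. Qed.

Lemma layer_1_ge1 kap mu : 1 <= layer kap mu 1.
Proof. by rewrite -layer_rev subrr layer_0_ge1. Qed.

Lemma expR_le_layer kap mu x : 0 < kap -> 0 < mu -> 0 <= x <= 1 ->
  expR (- (kap / mu)) <= layer kap mu x.
Proof.
move=> k0 mu0 /andP[x0 x1]; apply: le_trans (_ : expR (- (kap * x / mu)) <= _).
  rewrite ler_expR lerN2; apply: ler_wpM2r; first by rewrite invr_ge0 ltW.
  by rewrite ler_piMr// ltW.
by rewrite lerDl expR_ge0.
Qed.

Lemma layer_le2 kap mu x : 0 < kap -> 0 < mu -> 0 <= x <= 1 -> layer kap mu x <= 2.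
Proof.
move=> k0 mu0 /andP[x0 x1].
have h : forall y : R, 0 <= y -> expR (- (kap * y / mu)) <= 1.
  move=> y y0; rewrite -expR0 ler_expR oppr_le0 divr_ge0 ?mulr_ge0//; exact: ltW.
by have := h x x0; have := h (1 - x) (_ : 0 <= 1 - x); rewrite /layer subr_ge0 => /(_ x1); lra.
Qed.

Lemma layer_sq kap mu x : layer (2 * kap) mu x <= layer kap mu x ^+ 2.
Proof.
rewrite /layer.
have E : forall y : R, expR (- (2 * kap * y / mu)) = expR (- (kap * y / mu)) ^+ 2.
  by move=> y; rewrite -expRM_natl; congr expR; ring.
rewrite !E.
have := expR_ge0 (- (kap * x / mu)); have := expR_ge0 (- (kap * (1 - x) / mu)); nra.
Qed.

(** A layer is almost constant along distances of the order of its width. *)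
Lemma layer_lipschitz kap mu h x y : 0 < kap -> 0 < mu -> h <= mu -> `|y - x| <= h ->
  layer kap mu y <= expR kap * layer kap mu x.
Proof.
move=> k0 mu0 hmu yx; rewrite /layer [expR kap * _]mulrDr -!expRD.
have H : forall u v : R, `|u - v| <= h -> expR (- (kap * u / mu)) <= expR (kap - kap * v / mu).
  move=> u v uv; rewrite ler_expR.
  have : kap * (v - u) / mu <= kap.
    rewrite ler_pdivrMr// ler_pM2l//; apply: le_trans hmu; apply: le_trans uv.
    by rewrite distrC ler_norm.
  by lra.
have h1 := H _ _ yx; have h2 := H (1 - y) (1 - x) _.
apply: lerD; first by rewrite h1.
apply: h2; rewrite (_ : 1 - y - (1 - x) = - (y - x)) ?normrN//; ring.
Qed.

Lemma is_derive_layer kap mu (x : R) :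
  is_derive x 1 (layer kap mu) (dlayer kap mu x).
Proof.
have h1 : is_derive x 1 (fun y => - (kap * y / mu)) (- (kap * 1 / mu)).
  apply: isD_N; apply: (is_derive_eq (isD_M (isD_Z kap (isD_id x)) (isD_cst (mu^-1)%R x))).
  by rewrite mulr0 addr0.
have h2 : is_derive x 1 (fun y => - (kap * (1 - y) / mu)) (- (kap * (0 - 1) / mu)).
  apply: isD_N; apply: (is_derive_eq (isD_M (isD_Z kap (isD_B (isD_cst 1 x) (isD_id x)))
    (isD_cst (mu^-1)%R x))).
  by rewrite mulr0 addr0.
apply: (is_derive_eq (isD_D (isD_comp h1 (is_derive_expR _)) (isD_comp h2 (is_derive_expR _)))).
by rewrite /dlayer; ring.
Qed.

Lemma is_derive_dlayer kap mu (x : R) :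
  is_derive x 1 (dlayer kap mu) ((kap / mu) ^+ 2 * layer kap mu x).
Proof.
have h1 : is_derive x 1 (fun y => - (kap * y / mu)) (- (kap * 1 / mu)).
  apply: isD_N; apply: (is_derive_eq (isD_M (isD_Z kap (isD_id x)) (isD_cst (mu^-1)%R x))).
  by rewrite mulr0 addr0.
have h2 : is_derive x 1 (fun y => - (kap * (1 - y) / mu)) (- (kap * (0 - 1) / mu)).
  apply: isD_N; apply: (is_derive_eq (isD_M (isD_Z kap (isD_B (isD_cst 1 x) (isD_id x)))
    (isD_cst (mu^-1)%R x))).
  by rewrite mulr0 addr0.
apply: (is_derive_eq (isD_Z (kap / mu)
  (isD_B (isD_comp h2 (is_derive_expR _)) (isD_comp h1 (is_derive_expR _))))).
by rewrite /layer; ring.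
Qed.

Lemma ctsI_layer kap mu : ctsI (layer kap mu).
Proof.
apply: ctsI_continuous => x; apply/differentiable_continuous/derivable1_diffP.
exact: is_derive_derivable (is_derive_layer kap mu x).
Qed.

Lemma is_derive_sqr (v v1 : R -> R) (x : R) : is_derive x 1 v (v1 x) ->
  is_derive x 1 (fun y => v y ^+ 2) (2 * (v x * v1 x)).
Proof.
move=> h; apply: (is_derive_eq (isD_M h h)); ring.
Qed.

Lemma is_derive_dsqr (v v1 : R -> R) (v2 x : R) : is_derive x 1 v (v1 x) ->
  is_derive x 1 v1 v2 ->
  is_derive x 1 (fun y => 2 * (v y * v1 y)) (2 * (v1 x ^+ 2 + v x * v2)).
Proof. by move=> h h1; apply: (is_derive_eq (isD_Z 2 (isD_M h h1))). Qed.

Lemma young (al u v : R) : 0 < al -> 2 * (u * v) <= al ^+ 2 * u ^+ 2 + v ^+ 2 / al ^+ 2.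
Proof.
move=> al0; have := sqr_ge0 (al * u - v / al).
have -> : (al * u - v / al) ^+ 2 = al ^+ 2 * u ^+ 2 + v ^+ 2 / al ^+ 2 - 2 * (u * v).
  by field; rewrite gt_eqF.
lra.
Qed.

(** Systems with a merely coercive matrix satisfy no maximum principle, but their
coercivity passes to scalar differential inequalities for the squares of the solutions.
These are compared with the layer psi of twice the rate, for which
mu^2 psi'' = 4 kap^2 psi <= (alpha^2 / 2) psi. *)
Lemma layer_decay (alpha Ca g M kap eps mu : R) (a : 'I_2 -> 'I_2 -> nat -> R -> R)
    (v G : 'I_2 -> nat -> R -> R) :
  0 < alpha -> 0 < kap -> 8 * kap ^+ 2 <= alpha ^+ 2 ->
  0 < eps -> eps <= mu -> coercive alpha a ->
  (forall i j x, 0 <= x <= 1 -> `|a i j 0%N x| <= Ca) ->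
  (forall l, tower (v l)) ->
  (forall l x, 0 <= x <= 1 ->
     dcoef eps mu l * v l 2%N x = sysop a v l 0 x - G l 0%N x) ->
  (forall l, `|v l 0%N 0| <= M /\ `|v l 0%N 1| <= M) ->
  (forall l x, 0 <= x <= 1 -> `|G l 0%N x| <= g * expR (- (kap / mu))) ->
  let K1 := 2 * M ^+ 2 + 4 * g ^+ 2 / alpha ^+ 4 in
  let K2 := K1 + M ^+ 2 + 4 * (Ca ^+ 2 * K1 + g ^+ 2) / alpha ^+ 4 in
  forall l x, 0 <= x <= 1 -> v l 0%N x ^+ 2 <= K2 * layer (2 * kap) mu x.
Proof.
move=> al0 k0 kal eps0 em coa ba tv eqv bM bG K1 K2.
have mu0 : 0 < mu by exact: lt_le_trans em.
have al2 : 0 < alpha ^+ 2 by rewrite exprn_gt0.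
have al4 : 0 < alpha ^+ 4 by rewrite exprn_gt0.
have e2 : 0 < eps ^+ 2 by rewrite exprn_gt0.
have m2 : 0 < mu ^+ 2 by rewrite exprn_gt0.
have em2 : eps ^+ 2 <= mu ^+ 2 by apply: ler_exprn => //; exact: ltW.
have g4 : 0 <= 4 * g ^+ 2 / alpha ^+ 4.
  by apply: divr_ge0; [rewrite mulr_ge0 ?sqr_ge0|exact: ltW].
have M2 := sqr_ge0 M.
have K10 : 0 <= K1 by rewrite /K1; lra.
have C4 : 0 <= 4 * (Ca ^+ 2 * K1 + g ^+ 2) / alpha ^+ 4.
  apply: divr_ge0; last exact: ltW.
  by have := mulr_ge0 (sqr_ge0 Ca) K10; have := sqr_ge0 g; lra.
have K20 : 0 <= K2 by rewrite /K2; lra.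
set psi := layer (2 * kap) mu.
have psi0 x : 0 < psi x by exact: layer_gt0.
have dpsi (x : R) : is_derive x 1 psi (dlayer (2 * kap) mu x).
  exact: is_derive_layer.
have d2psi (x : R) : is_derive x 1 (dlayer (2 * kap) mu) ((2 * kap / mu) ^+ 2 * psi x).
  exact: is_derive_dlayer.
have psimu x : mu ^+ 2 * ((2 * kap / mu) ^+ 2 * psi x) = 4 * kap ^+ 2 * psi x.
  by field; rewrite gt_eqF.
have Gpsi l x : 0 <= x <= 1 -> G l 0%N x ^+ 2 <= g ^+ 2 * psi x.
  move=> x01; rewrite -[G _ _ _ ^+ 2]real_normK ?num_real//.
  apply: le_trans (ler_exprn 2 (normr_ge0 _) (bG l x x01)) _.
  rewrite exprMn ler_wpM2l ?sqr_ge0// -expRM_natl.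
  have := @expR_le_layer (2 * kap) mu x _ mu0 x01.
  have -> : 2%:R * - (kap / mu) = - (2 * kap / mu) by ring.
  by apply; lra.
have dv l n (x : R) : 0 < x < 1 -> is_derive x 1 (v l n) (v l n.+1 x) by exact: (tv l).2.
have bd l : v l 0%N 0 ^+ 2 <= M ^+ 2 /\ v l 0%N 1 ^+ 2 <= M ^+ 2.
  have [h0 h1] := bM l; split; rewrite -[X in X <= _]real_normK ?num_real//; exact: ler_exprn.
have p0 := layer_0_ge1 (2 * kap) mu; have p1 := layer_1_ge1 (2 * kap) mu.
rewrite -/psi in p0 p1.
(* The weighted square of V itself satisfies a scalar differential inequality,
   because A is coercive. *)
have step1 x : 0 <= x <= 1 -> v ord_max 0%N x ^+ 2 <= K1 * psi x.
  move=> x01.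
  pose z (y : R) := eps ^+ 2 * v ord0 0%N y ^+ 2 + mu ^+ 2 * v ord_max 0%N y ^+ 2
    - K1 * mu ^+ 2 * psi y.
  have : z x <= 0.
    apply: (@comparison_principle R z
      (fun y => eps ^+ 2 * (2 * (v ord0 0%N y * v ord0 1%N y)) +
         mu ^+ 2 * (2 * (v ord_max 0%N y * v ord_max 1%N y)) -
         K1 * mu ^+ 2 * dlayer (2 * kap) mu y)
      (fun y => eps ^+ 2 * (2 * (v ord0 1%N y ^+ 2 + v ord0 0%N y * v ord0 2%N y)) +
         mu ^+ 2 * (2 * (v ord_max 1%N y ^+ 2 + v ord_max 0%N y * v ord_max 2%N y)) -
         K1 * mu ^+ 2 * ((2 * kap / mu) ^+ 2 * psi y)) (alpha ^+ 2 / mu ^+ 2)) x01.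
    - by rewrite divr_gt0.
    - apply: ctsIB; last by apply: ctsIM; [exact: ctsI_cst|exact: ctsI_layer].
      by apply: ctsID; apply: ctsIM; try exact: ctsI_cst; apply: ctsIM; exact: (tv _).1.
    - move=> y y01; exact: isD_B (isD_D (isD_Z _ (is_derive_sqr (dv ord0 0%N y y01)))
        (isD_Z _ (is_derive_sqr (dv ord_max 0%N y y01)))) (isD_Z _ (dpsi y)).
    - move=> y y01; exact: isD_B (isD_D (isD_Z _ (is_derive_dsqr (dv ord0 0%N y y01) (dv ord0 1%N y y01)))
        (isD_Z _ (is_derive_dsqr (dv ord_max 0%N y y01) (dv ord_max 1%N y y01)))) (isD_Z _ (d2psi y)).
    - move=> y y01; have y01' : 0 <= y <= 1 by move: y01 => /andP[/ltW -> /ltW ->].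
      have e0 := eqv ord0 y y01'; have e1 := eqv ord_max y y01'.
      rewrite /dcoef /sysop !leib0 /= in e0 e1.
      have Q := coa y y01' (v ord0 0%N y) (v ord_max 0%N y); rewrite /quadform in Q.
      have Y0 := young (v ord0 0%N y) (G ord0 0%N y) al0.
      have Y1 := young (v ord_max 0%N y) (G ord_max 0%N y) al0.
      have G0 := Gpsi ord0 y y01'; have G1 := Gpsi ord_max y y01'.
      have GG : (G ord0 0%N y ^+ 2 + G ord_max 0%N y ^+ 2) / alpha ^+ 2
          <= 2 * g ^+ 2 / alpha ^+ 2 * psi y.
        by rewrite mulrAC ler_pM2r ?invr_gt0//; clear - G0 G1; lra.
      have Kg : 2 * g ^+ 2 / alpha ^+ 2 <= alpha ^+ 2 * K1 / 2.
        have -> : 2 * g ^+ 2 / alpha ^+ 2 = alpha ^+ 2 / 2 * (4 * g ^+ 2 / alpha ^+ 4).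
          by field; rewrite gt_eqF.
        have -> : alpha ^+ 2 * K1 / 2 = alpha ^+ 2 / 2 * K1 by ring.
        by apply: ler_wpM2l; [clear - al2; lra|rewrite /K1; clear - M2; lra].
      have Kk : 4 * kap ^+ 2 * K1 <= alpha ^+ 2 * K1 / 2.
        by have := ler_wpM2r K10 kal; clear; lra.
      have KK := ler_wpM2r (ltW (psi0 y)) (lerD Kg Kk).
      have zE : alpha ^+ 2 / mu ^+ 2 * z y <=
          alpha ^+ 2 * (v ord0 0%N y ^+ 2 + v ord_max 0%N y ^+ 2) - alpha ^+ 2 * K1 * psi y.
        have -> : alpha ^+ 2 / mu ^+ 2 * z y =
           alpha ^+ 2 * (eps ^+ 2 / mu ^+ 2 * v ord0 0%N y ^+ 2 + v ord_max 0%N y ^+ 2)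
           - alpha ^+ 2 * K1 * psi y.
          by rewrite /z; field; rewrite gt_eqF.
        have r1 : eps ^+ 2 / mu ^+ 2 <= 1 by rewrite ler_pdivrMr// mul1r.
        have := ler_wpM2r (sqr_ge0 (v ord0 0%N y)) r1 => r2.
        by have := ler_wpM2l (ltW al2) r2; clear; lra.
      have S0 := mulr_ge0 (ltW e2) (sqr_ge0 (v ord0 1%N y)).
      have S1 := mulr_ge0 (ltW m2) (sqr_ge0 (v ord_max 1%N y)).
      have -> : K1 * mu ^+ 2 * ((2 * kap / mu) ^+ 2 * psi y) = 4 * kap ^+ 2 * K1 * psi y.
        by rewrite -mulrA psimu; ring.
      have T0 : eps ^+ 2 * (v ord0 0%N y * v ord0 2%N y) =
        v ord0 0%N y * (eps ^+ 2 * v ord0 2%N y) by ring.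
      have T1 : mu ^+ 2 * (v ord_max 0%N y * v ord_max 2%N y) =
        v ord_max 0%N y * (mu ^+ 2 * v ord_max 2%N y) by ring.
      rewrite e0 in T0; rewrite e1 in T1.
      apply: le_trans zE _.
      move: T0 T1 Q Y0 Y1 GG KK S0 S1.
      set w0 := v ord0 0%N y; set w1 := v ord_max 0%N y.
      clear; lra.
    - have [h0 _] := bd ord0; have [h1 _] := bd ord_max.
      have q0 := ler_pM (ltW e2) (sqr_ge0 _) em2 h0.
      have q1 := ler_wpM2l (ltW m2) h1.
      have K1M : 2 * M ^+ 2 <= K1 by rewrite /K1; clear - g4; lra.
      have q2 := ler_wpM2r (ltW m2) K1M.
      have q3 := ler_wpM2l (mulr_ge0 K10 (ltW m2)) p0.
      by rewrite /z; clear - q0 q1 q2 q3; lra.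
    - have [_ h0] := bd ord0; have [_ h1] := bd ord_max.
      have q0 := ler_pM (ltW e2) (sqr_ge0 _) em2 h0.
      have q1 := ler_wpM2l (ltW m2) h1.
      have K1M : 2 * M ^+ 2 <= K1 by rewrite /K1; clear - g4; lra.
      have q2 := ler_wpM2r (ltW m2) K1M.
      have q3 := ler_wpM2l (mulr_ge0 K10 (ltW m2)) p1.
      by rewrite /z; clear - q0 q1 q2 q3; lra.
  have h := mulr_ge0 (ltW e2) (sqr_ge0 (v ord0 0%N x)).
  by rewrite /z => zx; rewrite -(ler_pM2l m2); clear - h zx; lra.
(* The first component, for which the previous step loses the factor mu / eps, is
   recovered from its own scalar equation. *)
have step2 x : 0 <= x <= 1 -> v ord0 0%N x ^+ 2 <= K2 * psi x.
  move=> x01.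
  pose z (y : R) := v ord0 0%N y ^+ 2 - K2 * psi y.
  suff : z x <= 0 by rewrite /z subr_le0.
  apply: (@comparison_principle R z
      (fun y => 2 * (v ord0 0%N y * v ord0 1%N y) - K2 * dlayer (2 * kap) mu y)
      (fun y => 2 * (v ord0 1%N y ^+ 2 + v ord0 0%N y * v ord0 2%N y) -
         K2 * ((2 * kap / mu) ^+ 2 * psi y)) (alpha ^+ 2 / eps ^+ 2)) x01.
  - by rewrite divr_gt0.
  - apply: ctsIB; last by apply: ctsIM; [exact: ctsI_cst|exact: ctsI_layer].
    by apply: ctsIM; exact: (tv _).1.
  - move=> y y01; exact: isD_B (is_derive_sqr (dv ord0 0%N y y01)) (isD_Z _ (dpsi y)).
  - move=> y y01; exact: isD_B (is_derive_dsqr (dv ord0 0%N y y01) (dv ord0 1%N y y01)) (isD_Z _ (d2psi y)).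
  - move=> y y01; have y01' : 0 <= y <= 1 by move: y01 => /andP[/ltW -> /ltW ->].
    have e0 := eqv ord0 y y01'; rewrite /dcoef /sysop !leib0 /= in e0.
    have Q := coa y y01' 1 0; rewrite /quadform in Q.
    have a00 : alpha ^+ 2 <= a ord0 ord0 0%N y by clear - Q; lra.
    have A0 := ler_wpM2r (sqr_ge0 (v ord0 0%N y)) a00.
    set w0 := v ord0 0%N y in e0 A0 *; set w1 := v ord_max 0%N y in e0 *.
    set b := a ord0 ord_max 0%N y in e0; set G0 := G ord0 0%N y in e0.
    have Y := young w0 (G0 - b * w1) al0.
    have w1b : w1 ^+ 2 <= K1 * psi y by exact: step1.
    have b2 : b ^+ 2 <= Ca ^+ 2.
      by rewrite -real_normK ?num_real//; apply: ler_exprn => //; exact: ba.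
    have bw : (b * w1) ^+ 2 <= Ca ^+ 2 * (K1 * psi y).
      by rewrite exprMn; apply: ler_pM => //; exact: sqr_ge0.
    have Gb : G0 ^+ 2 <= g ^+ 2 * psi y by exact: Gpsi.
    have S : (G0 - b * w1) ^+ 2 <= 2 * (Ca ^+ 2 * K1 + g ^+ 2) * psi y.
      by have := sqr_ge0 (G0 + b * w1); clear - bw Gb; nra.
    have S' : (G0 - b * w1) ^+ 2 / alpha ^+ 2 <= alpha ^+ 2 * K2 / 2 * psi y.
      rewrite ler_pdivrMr//; apply: le_trans S _; rewrite [leRHS]mulrAC.
      apply: ler_wpM2r; first exact: ltW.
      have -> : 2 * (Ca ^+ 2 * K1 + g ^+ 2) =
         alpha ^+ 4 / 2 * (4 * (Ca ^+ 2 * K1 + g ^+ 2) / alpha ^+ 4).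
        by field; rewrite gt_eqF.
      have -> : alpha ^+ 2 * K2 / 2 * alpha ^+ 2 = alpha ^+ 4 / 2 * K2 by ring.
      by apply: ler_wpM2l; [clear - al4; lra|rewrite /K2; clear - K10 M2; lra].
    have Kk : 4 * kap ^+ 2 * K2 * psi y <= alpha ^+ 2 * K2 / 2 * psi y.
      apply: ler_wpM2r; first exact: ltW.
      by have := ler_wpM2r K20 kal; clear; lra.
    have r1 : eps ^+ 2 * (K2 * ((2 * kap / mu) ^+ 2 * psi y)) <= 4 * kap ^+ 2 * K2 * psi y.
      have -> : 4 * kap ^+ 2 * K2 * psi y = mu ^+ 2 * (K2 * ((2 * kap / mu) ^+ 2 * psi y)).
        by rewrite [RHS]mulrCA psimu; ring.
      by apply: ler_wpM2r => //; exact: mulr_ge0 K20 (mulr_ge0 (sqr_ge0 _) (ltW (psi0 y))).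
    have S0 := mulr_ge0 (ltW e2) (sqr_ge0 (v ord0 1%N y)).
    have T0 : eps ^+ 2 * (w0 * v ord0 2%N y) = w0 * (eps ^+ 2 * v ord0 2%N y) by ring.
    rewrite e0 in T0.
    rewrite -(ler_pM2l e2).
    have -> : eps ^+ 2 * (alpha ^+ 2 / eps ^+ 2 * z y) = alpha ^+ 2 * w0 ^+ 2 - alpha ^+ 2 * K2 * psi y.
      by rewrite /z -/w0; field; rewrite gt_eqF.
    rewrite mulrBr.
    move: T0 A0 Y S' Kk r1 S0; clearbody b w0 w1 G0; clear; lra.
  - have [h0 _] := bd ord0; have K2M : M ^+ 2 <= K2 by rewrite /K2; clear - K10 C4; lra.
    by have := ler_wpM2l K20 p0; rewrite /z; clear - h0 K2M; lra.
  - have [_ h0] := bd ord0; have K2M : M ^+ 2 <= K2 by rewrite /K2; clear - K10 C4; lra.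
    by have := ler_wpM2l K20 p1; rewrite /z; clear - h0 K2M; lra.
apply: ord2E => x x01; first exact: step2.
apply: le_trans (step1 x x01) _; apply: ler_wpM2r; first exact: ltW.
by rewrite /K2; clear - M2 C4; lra.
Qed.

End LayerEstimates.

(** * Derivatives of the layers *)

Section LayerDerivatives.
Context {R : realType}.

Lemma binom_fact_le n k N : (k <= n)%N -> (n <= N)%N -> ('C(n, k) * k`! <= N ^ k)%N.
Proof.
move=> kn nN; rewrite bin_ffact ffact_prod.
elim: {kn} k => [|k IH]; first by rewrite big_ord0.
by rewrite big_ord_recr /= expnSr leq_mul// (leq_trans (leq_subr _ _)).
Qed.

(** Up to order N the factorials of the analytic factor are dominated by powers of N. *)
Lemma leib_le_powers (a v : nat -> R) n N (Ca ga X gam om : R) :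
  0 <= Ca -> 0 <= ga -> 0 <= X -> 0 < gam -> 0 <= om -> 2 * ga <= gam -> (n <= N)%N ->
  (forall k, `|a k| <= Ca * ga ^+ k * k`!%:R) ->
  (forall k, (k <= n)%N -> `|v k| <= X * (gam * N%:R) ^+ k * om) ->
  `|leib a v n| <= 2 * Ca * X * (gam * N%:R) ^+ n * om.
Proof.
move=> Ca0 ga0 X0 gam0 om0 gg nN ha hv.
pose t := ga / gam.
have t0 : 0 <= t by apply: divr_ge0 => //; exact: ltW.
have t2 : t <= 1 / 2 by rewrite ler_pdivrMr//; lra.
have gaE : ga = gam * t by rewrite mulrC divfK// gt_eqF.
have c0 : 0 <= Ca * X * (gam * N%:R) ^+ n * om.
  by rewrite !mulr_ge0// exprn_ge0// mulr_ge0//; exact: ltW.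
apply: le_trans (ler_norm_sum _ _ _) _.
apply: le_trans (_ : \sum_(k < n.+1) Ca * X * (gam * N%:R) ^+ n * om * t ^+ k <= _).
  apply: ler_sum => k _; rewrite !normrM normr_nat.
  have kn : (k <= n)%N by rewrite -ltnS ltn_ord.
  have h := ler_wpM2l (ler0n R 'C(n, k))
    (ler_pM (normr_ge0 _) (normr_ge0 _) (ha k) (hv (n - k)%N (leq_subr _ _))).
  apply: le_trans h _.
  have e : (gam * N%:R) ^+ n = (gam * N%:R) ^+ k * (gam * N%:R) ^+ (n - k).
    by rewrite -exprD subnKC.
  have -> : 'C(n, k)%:R * (Ca * ga ^+ k * k`!%:R * (X * (gam * N%:R) ^+ (n - k) * om)) =
      Ca * X * (gam * N%:R) ^+ (n - k) * om * ga ^+ k * ('C(n, k) * k`!)%N%:R.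
    by rewrite natrM; ring.
  apply: le_trans (_ : Ca * X * (gam * N%:R) ^+ (n - k) * om * ga ^+ k * N%:R ^+ k <= _).
    apply: ler_wpM2l; last by rewrite -natrX ler_nat binom_fact_le.
    apply: mulr_ge0; last exact: exprn_ge0.
    by rewrite !mulr_ge0// exprn_ge0// mulr_ge0//; exact: ltW.
  rewrite e gaE !exprMn le_eqVlt; apply/orP; left; apply/eqP; ring.
rewrite -mulr_sumr.
have s2 : \sum_(k < n.+1) t ^+ k <= 2.
  rewrite big_ord_recl expr0; have := sum_geom_le n t0 t2.
  rewrite (eq_bigr (fun i : 'I_n => t ^+ i.+1)) => [|i _]; last by [].
  by lra.
by have := ler_wpM2l c0 s2; lra.
Qed.

(** Landau's inequality: a bounded second derivative controls the first one, since by
the mean value theorem the latter is a difference quotient somewhere nearby. *)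
Lemma landau_derivative (u u1 u2 : R -> R) (h B B2 x : R) : ctsI u -> ctsI u1 ->
  (forall y : R, 0 < y < 1 -> is_derive y 1 u (u1 y)) ->
  (forall y : R, 0 < y < 1 -> is_derive y 1 u1 (u2 y)) ->
  0 < h -> h <= 1 / 2 -> 0 <= x <= 1 ->
  (forall y, 0 <= y <= 1 -> `|y - x| <= h -> `|u y| <= B) ->
  (forall y, 0 <= y <= 1 -> `|y - x| <= h -> `|u2 y| <= B2) ->
  `|u1 x| <= 2 * B / h + h * B2.
Proof.
move=> cu cu1 du du1 h0 h2 /andP[x0 x1] uB u2B.
have [b [bx xb bb0 bb1]] : exists b, [/\ b <= x, x <= b + h, 0 <= b & b + h <= 1].
  by have [xh|xh] := leP x (1 / 2); [exists x|exists (x - h)]; split; lra.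
have near y : b <= y -> y <= b + h -> 0 <= y <= 1 /\ `|y - x| <= h.
  by move=> by1 by2; rewrite ler_norml; split; apply/andP; split; lra.
have bbh : b < b + h by rewrite ltrDl.
have [c [bc cb]] := MVT_I bb0 bbh bb1 cu du.
rewrite addrAC subrr add0r => cE.
have uc : `|u1 c| <= 2 * B / h.
  rewrite ler_pdivlMr// -[X in _ * X <= _](gtr0_norm h0) -normrM -cE.
  apply: le_trans (ler_normB _ _) _; rewrite mulr_natl mulr2n; apply: lerD.
    by have [? ?] := near (b + h) (ltW bbh) (lexx _); exact: uB.
  by have [? ?] := near b (lexx _) (ltW bbh); exact: uB.
have L p q : b <= p -> p < q -> q <= b + h -> `|u1 q - u1 p| <= h * B2.
  move=> bp pq qb; have p0 := le_trans bb0 bp; have q1 := le_trans qb bb1.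
  have [d [pd dq ->]] := MVT_I p0 pq q1 cu1 du1.
  rewrite normrM (@ger0_norm _ (q - p)) ?subr_ge0 ?(ltW pq)// mulrC.
  have [d01 dx] := near d (le_trans bp (ltW pd)) (le_trans (ltW dq) qb).
  by apply: ler_pM; [rewrite subr_ge0 ltW|exact: normr_ge0|lra|exact: u2B].
have -> : u1 x = u1 c + (u1 x - u1 c) by rewrite addrC subrK.
apply: le_trans (ler_normD _ _) _; apply: lerD => //.
have [xc|cx|->] := ltgtP x c.
- by rewrite distrC; apply: L => //; exact: ltW.
- by apply: L => //; exact: ltW.
- have [b01 bx'] := near b (lexx _) (ltW bbh).
  by rewrite subrr normr0 mulr_ge0 ?(ltW h0)// (le_trans _ (u2B b b01 bx')).
Qed.

(** Up to order N >= 1 / eps each derivative costs a factor N: the equation expresses the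
second derivatives of V, and then all others two orders at a time, while the first
derivatives are interpolated. *)
Lemma layer_bounds (alpha Ca ga M g gg kap : R) : 0 < alpha -> 0 < Ca -> 0 < ga ->
  0 < M -> 0 < g -> 0 < gg -> 0 < kap -> 8 * kap ^+ 2 <= alpha ^+ 2 ->
  exists X gam : R, [/\ 0 < X, 0 < gam & forall (eps mu : R) (N : nat)
    (a : 'I_2 -> 'I_2 -> nat -> R -> R) (v G : 'I_2 -> nat -> R -> R),
  0 < eps -> eps <= mu -> 1 / eps <= N%:R -> coercive alpha a ->
  (forall i j n x, 0 <= x <= 1 -> `|a i j n x| <= Ca * ga ^+ n * n`!%:R) ->
  (forall l, tower (v l)) ->
  (forall l n x, 0 <= x <= 1 ->
     dcoef eps mu l * v l n.+2 x = sysop a v l n x - G l n x) ->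
  (forall l, `|v l 0%N 0| <= M /\ `|v l 0%N 1| <= M) ->
  (forall l n x, 0 <= x <= 1 -> `|G l n x| <= g * gg ^+ n * n`!%:R * expR (- (kap / mu))) ->
  forall l n x, (n <= N)%N -> 0 <= x <= 1 ->
    `|v l n x| <= X * (gam * N%:R) ^+ n * layer kap mu x].
Proof.
move=> al0 Ca0 ga0 M0 g0 gg0 k0 kal.
pose K1 := 2 * M ^+ 2 + 4 * g ^+ 2 / alpha ^+ 4.
pose K2 := K1 + M ^+ 2 + 4 * (Ca ^+ 2 * K1 + g ^+ 2) / alpha ^+ 4.
have al4 : 0 < alpha ^+ 4 by rewrite exprn_gt0.
have K10 : 0 <= K1.
  have : 0 <= 4 * g ^+ 2 / alpha ^+ 4.
    by apply: divr_ge0; [rewrite mulr_ge0 ?sqr_ge0|exact: ltW].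
  by have := sqr_ge0 M; rewrite /K1; lra.
have K20 : 0 <= K2.
  have : 0 <= 4 * (Ca ^+ 2 * K1 + g ^+ 2) / alpha ^+ 4.
    apply: divr_ge0; last exact: ltW.
    by have := mulr_ge0 (sqr_ge0 Ca) K10; have := sqr_ge0 g; lra.
  by have := sqr_ge0 M; rewrite /K2; lra.
have decay := fun eps mu a v G => @layer_decay R alpha Ca g M kap eps mu a v G al0 k0 kal.
cbv zeta in decay; rewrite -/K1 -/K2 in decay.
clearbody K2; clear K1 K10 al4 al0 kal.
have [Kb [Kb0 KbK]] : exists Kb, 0 <= Kb /\ K2 <= Kb ^+ 2.
  by exists (K2 + 1); split; [lra|nra].
have [Y YE] : exists Y, Y = expR kap * (4 * Kb + 2 * Ca * Kb + g) by eexists.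
have CK : 0 <= Ca * Kb by rewrite mulr_ge0// ltW.
have Y0 : 0 < Y by rewrite YE; apply: mulr_gt0; [exact: expR_gt0|lra].
have [X [KbX gX XY]] : exists X, [/\ Kb <= X, g <= X & Y <= X].
  by exists (Kb + g + Y); split; clear - Kb0 g0 Y0; lra.
have X0 : 0 < X by lra.
have [gam [gam1 gamga gamgg gam2]] :
    exists gam : R, [/\ 1 <= gam, 2 * ga <= gam, gg <= gam & 4 * Ca + 1 <= gam ^+ 2].
  by exists (1 + 4 * Ca + 2 * ga + gg); clear - Ca0 ga0 gg0; split; [lra|lra|lra|nra].
exists X, gam; split=> //; first lra.
move=> eps mu N a v G eps0 em eN coa ba tv eqv bM bG.
have mu0 : 0 < mu by exact: lt_le_trans em.
have N0 : 0 < N%:R :> R by apply: lt_le_trans eN; rewrite divr_gt0.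
have N1 : 1 <= N%:R :> R by rewrite ler1n -(ltr0n R).
have epsN : 1 <= eps * N%:R by rewrite -ler_pdivrMl// mulrC.
pose om := layer kap mu.
have om0 x : 0 < om x by exact: layer_gt0.
have expom x : 0 <= x <= 1 -> expR (- (kap / mu)) <= om x by exact: expR_le_layer.
(* Since 1 / mu <= 1 / eps <= N, solving the equation for V'' costs at most N^2. *)
have dN l y B : 0 <= B -> `|dcoef eps mu l * y| <= B -> `|y| <= N%:R ^+ 2 * B.
  move=> B0; rewrite normrM => h.
  have d1 : 1 <= N%:R ^+ 2 * `|dcoef eps mu l|.
    rewrite ger0_norm; last by rewrite /dcoef; case: ifP; rewrite sqr_ge0.
    rewrite /dcoef; case: ifP => _; rewrite -exprMn exprn_ege1// mulrC//.
    exact: le_trans epsN (ler_wpM2r (ltW N0) em).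
  apply: le_trans (ler_wpM2l (exprn_ge0 2 (ltW N0)) h).
  by rewrite mulrA ler_peMl.
have Gb l n x : 0 <= x <= 1 -> (n <= N)%N -> `|G l n x| <= g * (gam * N%:R) ^+ n * om x.
  move=> x01 nN; apply: le_trans (bG l n x x01) _.
  apply: ler_pM; [|exact: expR_ge0| |exact: expom].
    by rewrite !mulr_ge0 ?exprn_ge0//; exact: ltW.
  rewrite -mulrA exprMn; apply: ler_wpM2l; first exact: ltW.
  apply: ler_pM => //; first by rewrite exprn_ge0//; exact: ltW.
    by apply: ler_exprn; [exact: ltW|].
  by rewrite -natrX ler_nat fact_le_expn.
have b0 l x : 0 <= x <= 1 -> `|v l 0%N x| <= Kb * om x.
  move=> x01.
  have h : v l 0%N x ^+ 2 <= K2 * layer (2 * kap) mu x.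
    apply: (decay eps mu a v G eps0 em coa _ tv (fun l => eqv l 0%N) bM _ l x x01).
      by move=> i j y y01; have := ba i j 0%N y y01; rewrite expr0 fact0 !mulr1.
    by move=> i y y01; have := bG i 0%N y y01; rewrite expr0 fact0 !mulr1.
  have oo := mulr_ge0 Kb0 (ltW (om0 x)).
  rewrite -(@ler_pXn2r _ 2)// ?nnegrE// real_normK ?num_real//.
  apply: le_trans h _; apply: le_trans (ler_wpM2l K20 (layer_sq kap mu x)) _.
  rewrite exprMn -/om; apply: ler_wpM2r; first exact: sqr_ge0.
  exact: KbK.
have b2 l x : 0 <= x <= 1 -> `|v l 2%N x| <= N%:R ^+ 2 * ((2 * Ca * Kb + g) * om x).
  move=> x01; apply: (dN l).
    by apply: mulr_ge0 (ltW (om0 x)); clear - CK g0; lra.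
  rewrite eqv// /sysop !leib0.
  have A j : `|a l j 0%N x * v j 0%N x| <= Ca * (Kb * om x).
    rewrite normrM; apply: ler_pM => //; last exact: b0.
    by have := ba l j 0%N x x01; rewrite expr0 fact0 !mulr1.
  apply: le_trans (ler_normB _ _) _.
  have := ler_normD (a l ord0 0%N x * v ord0 0%N x) (a l ord_max 0%N x * v ord_max 0%N x).
  have := A ord0; have := A ord_max; have := Gb l 0%N x x01 (leq0n _).
  by rewrite expr0 mulr1; clear; lra.
have b1 l x : 0 <= x <= 1 -> `|v l 1%N x| <= Y * N%:R * om x.
  move=> x01.
  (* A step of length at most eps / 2 <= mu, along which the layer is almost constant. *)
  pose h : R := 1 / (2 * N%:R).
  have hN : 2 * h * N%:R = 1 by rewrite /h; field; rewrite gt_eqF.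
  have h0 : 0 < h by rewrite divr_gt0// mulr_gt0.
  have h2 : h <= 1 / 2 by rewrite ler_pdivrMr ?mulr_gt0//; clear - N1; lra.
  have hmu : h <= mu.
    by apply: le_trans em; rewrite ler_pdivrMr ?mulr_gt0//; clear - epsN; lra.
  have omb y : `|y - x| <= h -> om y <= expR kap * om x by exact: layer_lipschitz.
  apply: le_trans (landau_derivative (B := Kb * (expR kap * om x))
    (B2 := N%:R ^+ 2 * ((2 * Ca * Kb + g) * (expR kap * om x))) ((tv l).1 0%N) ((tv l).1 1%N)
    ((tv l).2 0%N) ((tv l).2 1%N) h0 h2 x01 _ _) _.
  - by move=> y y01 /omb yx; apply: le_trans (b0 l y y01) _; exact: ler_wpM2l.
  - move=> y y01 /omb yx; apply: le_trans (b2 l y y01) _.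
    apply: ler_wpM2l; first exact: sqr_ge0.
    by apply: ler_wpM2l => //; clear - CK g0; lra.
  have -> : 2 * (Kb * (expR kap * om x)) / h +
      h * (N%:R ^+ 2 * ((2 * Ca * Kb + g) * (expR kap * om x))) =
    expR kap * (4 * Kb + (2 * Ca * Kb + g) / 2) * N%:R * om x.
    by rewrite /h; field; rewrite gt_eqF.
  apply: ler_wpM2r; first exact: ltW.
  apply: ler_wpM2r; first exact: ltW.
  by rewrite YE; apply: ler_wpM2l; [exact: expR_ge0|clear - CK g0; lra].
move=> l n x nN x01.
elim/ltn_ind: n l nN => -[|[|n]] IH l nN.
- rewrite expr0 mulr1; apply: le_trans (b0 l x x01) _; apply: ler_wpM2r; first exact: ltW.
  exact: KbX.
- rewrite expr1; apply: le_trans (b1 l x x01) _; apply: ler_wpM2r; first exact: ltW.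
  rewrite mulrA; apply: ler_wpM2r; first exact: ltW.
  by apply: le_trans XY _; rewrite ler_peMr// ltW.
- have nN' : (n <= N)%N by apply: leq_trans nN; rewrite -addn2 leq_addr.
  have S j : `|leib ((a l j)^~ x) ((v j)^~ x) n| <= 2 * Ca * X * (gam * N%:R) ^+ n * om x.
    apply: (leib_le_powers (ltW Ca0) (ltW ga0) (ltW X0) (lt_le_trans ltr01 gam1) (ltW (om0 x))
      gamga nN').
      by move=> k; exact: ba.
    by move=> k kn; apply: IH; [exact: leqW|exact: leq_trans kn nN'].
  have P : 0 <= (gam * N%:R) ^+ n * om x.
    apply: mulr_ge0; last exact: ltW.
    by rewrite exprn_ge0// mulr_ge0// (le_trans ler01).
  have := dN l (v l n.+2 x) ((4 * Ca * X + g) * ((gam * N%:R) ^+ n * om x)).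
  have CX : 0 <= 4 * Ca * X + g by have := mulr_ge0 (ltW Ca0) (ltW X0); clear - g0; lra.
  have CX2 := mulr_ge0 CX P => /(_ CX2) h.
  have {}h : `|v l n.+2 x| <= N%:R ^+ 2 * ((4 * Ca * X + g) * ((gam * N%:R) ^+ n * om x)).
    apply: h; rewrite eqv// /sysop; apply: le_trans (ler_normB _ _) _.
    have := ler_normD (leib ((a l ord0)^~ x) ((v ord0)^~ x) n) (leib ((a l ord_max)^~ x) ((v ord_max)^~ x) n).
    by have := S ord0; have := S ord_max; have := Gb l n x x01 nN'; clear; lra.
  apply: le_trans h _.
  have -> : X * (gam * N%:R) ^+ n.+2 * layer kap mu x =
    N%:R ^+ 2 * (X * gam ^+ 2 * ((gam * N%:R) ^+ n * om x)).
    by rewrite 2!(exprS (gam * N%:R)) /om; ring.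
  apply: ler_wpM2l; first exact: sqr_ge0.
  apply: ler_wpM2r => //.
  by have := ler_wpM2l (ltW X0) gam2; clear - gX; lra.
Qed.

End LayerDerivatives.

(** * Taylor polynomials *)

Section TaylorPolynomials.
Context {R : realType}.
Implicit Types (c : nat -> R) (x : R).

Lemma exp_partial_sum_le n x : 0 <= x -> \sum_(j < n) x ^+ j / j`!%:R <= expR x.
Proof.
move=> x0.
have -> : \sum_(j < n) x ^+ j / j`!%:R = series (exp_coeff x) n.
  by rewrite /series /= big_mkord.
apply: nondecreasing_cvgn_le; last exact: is_cvg_series_exp_coeff.
by apply: nondecreasing_series => i _ _; exact: exp_coeff_ge0.
Qed.

Lemma powf_le_expR n x : 0 <= x -> x ^+ n / n`!%:R <= expR x.
Proof.
move=> x0; apply: le_trans (exp_partial_sum_le n.+1 x0).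
rewrite big_ord_recr /= lerDr; apply: sumr_ge0 => j _.
by rewrite divr_ge0 ?exprn_ge0.
Qed.

Definition taylor c n : {poly R} := \poly_(j < n) (c j / j`!%:R).

Lemma derivn_taylor k c n :
  (taylor c n)^`(k) = taylor (fun j => c (j + k)%N) (n - k).
Proof.
elim: k => [|k IH].
  by rewrite derivn0 subn0; congr taylor; apply/funext => j; rewrite addn0.
rewrite derivnS IH; apply/polyP => i.
rewrite coef_deriv !coef_poly subnS.
have -> : (i.+1 < n - k)%N = (i < (n - k).-1)%N by case: (n - k)%N.
case: ifP => _; last by rewrite mul0rn.
rewrite addSnnS factS natrM -mulr_natr; field.
by rewrite -[1]/(1%:R) -natrD !pnatr_eq0 /= -lt0n fact_gt0.
Qed.

Lemma taylor_norm_le c n (A B x : R) : 0 <= x <= 1 -> 0 <= A -> 0 <= B ->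
  (forall j, (j < n)%N -> `|c j| <= A * B ^+ j) -> `|(taylor c n).[x]| <= A * expR B.
Proof.
move=> /andP[x0 x1] A0 B0 cAB; rewrite horner_poly.
apply: le_trans (ler_norm_sum _ _ _) _.
apply: le_trans (ler_wpM2l A0 (exp_partial_sum_le n B0)).
rewrite mulr_sumr; apply: ler_sum => j _; rewrite !normrM.
rewrite (ger0_norm (exprn_ge0 _ x0)) (@ger0_norm _ (_^-1)%R) ?invr_ge0//.
apply: le_trans (_ : `|c j| * (j`!%:R^-1)%R <= _).
  by rewrite ler_piMr ?exprn_ile1// mulr_ge0 ?invr_ge0.
by rewrite mulrA ler_wpM2r ?invr_ge0// cAB.
Qed.

Lemma taylor_at0 c n : (0 < n)%N -> (taylor c n).[0] = c 0%N.
Proof. by move=> n0; rewrite horner_coef0 coef_poly n0 fact0 divr1. Qed.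

(** Integrate the bound on the N-th derivative j times. *)
Lemma taylor_remainder_le (D : nat -> R -> R) N (B : R) : tower D ->
  (forall k, (k < N)%N -> D k 0 = 0) ->
  (forall x, 0 <= x <= 1 -> `|D N x| <= B) ->
  forall j, (j <= N)%N -> forall x, 0 <= x <= 1 ->
    `|D (N - j)%N x| <= B * (x ^+ j / j`!%:R).
Proof.
move=> [cD dD] D0 DB; elim=> [_ x x01|j IH jN x /andP[x0 x1]].
  by rewrite subn0 expr0 fact0 divr1 mulr1; exact: DB.
move: x0; rewrite le_eqVlt => /predU1P[<-|x0].
  rewrite D0 ?normr0 ?expr0n/= ?mul0r ?mulr0//.
  by rewrite ltn_subrL (leq_trans _ jN).
have S : (N - j = (N - j.+1).+1)%N by rewrite subnSK.
have h (s : R) : `|s| = 1 -> s * D (N - j.+1)%N x <= B * (x ^+ j.+1 / (j.+1)`!%:R).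
  move=> s1.
  pose g (y : R) := B * (y ^+ j.+1 / (j.+1)`!%:R) - s * D (N - j.+1)%N y.
  have dg (y : R) : 0 < y < 1 -> is_derive y 1 g (B * (y ^+ j / j`!%:R) - s * D (N - j)%N y).
    move=> y01; apply: isD_B; last by apply: isD_Z; rewrite S; exact: dD.
    apply: isD_Z.
    have hX : is_derive y 1 (fun z : R => z ^+ j.+1) (j.+1%:R * y ^+ j).
      have h := derivableP (@exprn_derivable R j.+1 y 1).
      by apply: (is_derive_eq h); rewrite exp_derive /GRing.scale /= mulr1.
    apply: (is_derive_eq (isD_M hX (isD_cst ((j.+1)`!%:R^-1)%R y))).
    rewrite mulr0 addr0 factS natrM; field.
    by rewrite -[1]/(1%:R) -natrD !pnatr_eq0 /= -lt0n fact_gt0.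
  have cg : ctsI g.
    apply: ctsIB; last by apply: ctsIM; [exact: ctsI_cst|exact: cD].
    apply: ctsIM; first exact: ctsI_cst.
    apply: ctsIM; last exact: ctsI_cst.
    by apply: ctsI_continuous; exact: exprn_continuous.
  have [y [y0 yx gE]] := MVT_I (lexx 0) x0 x1 cg dg.
  have y01 : 0 <= y <= 1 by rewrite (ltW y0) (le_trans (ltW yx)).
  have : 0 <= g x - g 0.
    rewrite gE; apply: mulr_ge0; last by rewrite subr0 ltW.
    rewrite subr_ge0; apply: le_trans (IH (ltnW jN) y y01).
    by apply: le_trans (ler_norm _) _; rewrite normrM s1 mul1r.
  rewrite /g D0; last by rewrite ltn_subrL (leq_trans _ jN).
  by rewrite expr0n /= mul0r !mulr0 subrr subr0 subr_ge0.
by rewrite ler_norml lerNl -mulN1r -{2}[D _ _]mul1r !h ?normr1 ?normrN1.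
Qed.

End TaylorPolynomials.

(** * Polynomial approximation of the layers *)

Section LocalApproximation.
Context {R : realType}.
Implicit Types (p q : {poly R}) (u : nat -> R -> R) (x : R).

Definition ptower p : nat -> R -> R := fun k x => (p^`(k)).[x].

Lemma ptower_mul p q n x : 0 <= x <= 1 ->
  ptower (p * q) n x = leib ((ptower p)^~ x) ((ptower q)^~ x) n.
Proof.
apply: (@tower_eq R (ptower (p * q)) (fun n x => leib ((ptower p)^~ x) ((ptower q)^~ x) n)).
- exact: tower_horner.
- by apply: tower_leib; exact: tower_horner.
- by move=> y _; rewrite leib0 /ptower !derivn0 hornerM.
Qed.

Lemma ptower_rev p n x : 0 <= x <= 1 ->
  ptower (p \Po (1 - 'X)) n x = (-1) ^+ n * ptower p n (1 - x).
Proof.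
apply: (@tower_eq R (ptower (p \Po (1 - 'X))) (fun n x => (-1) ^+ n * ptower p n (1 - x))).
- exact: tower_horner.
- exact: tower_rev (tower_horner p).
- by move=> y _; rewrite /ptower !derivn0 horner_comp !hornerE.
Qed.

Lemma ptowerB p q n x : ptower (p - q) n x = ptower p n x - ptower q n x.
Proof. by rewrite /ptower linearB hornerD hornerN. Qed.

Lemma ptowerD p q n x : ptower (p + q) n x = ptower p n x + ptower q n x.
Proof. by rewrite /ptower linearD hornerD. Qed.

Lemma leib_rev (a v : nat -> R) n :
  leib (fun k => (-1) ^+ k * a k) (fun k => (-1) ^+ k * v k) n = (-1) ^+ n * leib a v n.
Proof.
rewrite /leib mulr_sumr; apply: eq_bigr => k _.
have kn : (k <= n)%N by rewrite -ltnS ltn_ord.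
have -> : (-1) ^+ n = (-1) ^+ k * (-1) ^+ (n - k) :> R by rewrite -exprD subnKC.
ring.
Qed.

Lemma leibBl (a b v : nat -> R) n : leib (fun k => a k - b k) v n = leib a v n - leib b v n.
Proof.
by rewrite /leib -sumrB; apply: eq_bigr => k _; rewrite mulrBl mulrBr.
Qed.

Lemma leib_ptower1 (v : nat -> R) n x : leib ((ptower 1)^~ x) v n = v n.
Proof.
rewrite leib_head /leib_tail {1}/ptower derivn0 hornerC mul1r big1 ?addr0// => k _.
by rewrite /ptower -polyC1 derivSn derivC linear0 horner0 mul0r mulr0.
Qed.

(** Near the end point 0, the Taylor polynomial of degree less than N approximates u with an
error exponentially small in N; away from it, the cutoff is smaller still than the
Taylor polynomial is large. *)
Lemma taylor_cutoff_approx (X gam : R) (q L : nat) u N : 0 < X -> 1 <= gam ->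
  expR 2 * gam <= q%:R -> gam + 1 <= L%:R -> tower u ->
  (forall n x, (n <= N)%N -> 0 <= x <= 1 -> `|u n x| <= X * (gam * N%:R) ^+ n) ->
  let m := (L * N)%N in let n := (4 * m * q)%N in
  let Gam := 16 * L%:R * q%:R + expR 2 * gam in
  let T := taylor (fun j => u j 0) N in
  (forall k x, (k <= N)%N -> 0 <= x <= 1 ->
    `|leib ((ptower (cutoff n m))^~ x) (u^~ x) k - ptower (cutoff n m * T) k x|
       <= 2 * X * (Gam * N%:R) ^+ k * expR (- N%:R)) /\
  (forall k x, 0 <= x <= 1 ->
    `|ptower (cutoff n m * T) k x| <= X * expR (gam * N%:R) * (Gam * N%:R) ^+ k).
Proof.
move=> X0 gam1 qg Lg tu bu m n Gam T.
have gam0 : 0 < gam by lra.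
have e2 : 1 <= expR 2 :> R by rewrite -expR0 ler_expR.
have N0 : 0 <= N%:R :> R by [].
have gN0 : 0 <= gam * N%:R by rewrite mulr_ge0// ltW.
have q0 : 0 < q%:R :> R by apply: lt_le_trans qg; rewrite mulr_gt0// expR_gt0.
have nE : 4 * n%:R = 16 * L%:R * q%:R * N%:R :> R.
  by rewrite /n /m !natrM; ring.
have n0 : 0 <= 4 * n%:R :> R by rewrite mulr_ge0.
have Tb k x : 0 <= x <= 1 ->
    `|ptower T k x| <= X * expR (gam * N%:R) * (gam * N%:R) ^+ k.
  move=> x01; rewrite /ptower derivn_taylor mulrAC; apply: taylor_norm_le => //.
    by rewrite mulr_ge0 ?exprn_ge0// ltW.
  move=> j; rewrite ltn_subRL => /ltnW jk.
  by rewrite -mulrA -exprD addnC; apply: bu => //; rewrite lexx ler01.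
have gamGam : 4 * n%:R + gam * N%:R <= Gam * N%:R.
  by rewrite nE /Gam -mulrDl; apply: ler_wpM2r => //; rewrite lerD2l ler_peMl// ltW.
have XE0 : 0 <= X * expR (gam * N%:R) by rewrite mulr_ge0 ?expR_ge0// ltW.
split; last first.
  move=> k x x01; rewrite ptower_mul//.
  have := @leib_norm_le R ((ptower (cutoff n m))^~ x) ((ptower T)^~ x) k 1
    (X * expR (gam * N%:R)) (4 * n%:R) (gam * N%:R) ler01 XE0 n0 gN0.
  move=> h; apply: le_trans (h _ _) _.
  - by move=> j _; rewrite mul1r; exact: cutoff_derivn_le.
  - by move=> j _; exact: Tb.
  - rewrite mul1r; apply: ler_wpM2l => //; apply: ler_exprn => //.
    by rewrite addr_ge0.
move=> k x kN x01; have /andP[x0 x1] := x01.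
rewrite ptower_mul// -leibBr.
pose D j y := u j y - ptower T j y.
have tD : tower D by apply: towerB => //; exact: tower_horner.
have DN y : 0 <= y <= 1 -> D N y = u N y.
  by move=> y01; rewrite /D /ptower derivn_taylor subnn /taylor poly_def big_ord0 horner0 subr0.
have D0 j : (j < N)%N -> D j 0 = 0.
  by move=> jN; rewrite /D /ptower derivn_taylor taylor_at0 ?subn_gt0// add0n subrr.
have eN := expR_ge0 (- N%:R : R).
(* Up to 1 / q, Taylor's formula: the factor (gam x)^(N - j) <= e^(- 2 (N - j)) outweighs
   N^(N - j) / (N - j)! <= e^N. *)
have [xq|qx] := leP (q%:R * x) 1.
  have Dk j : (j <= k)%N -> `|D j x| <= (X * expR (- N%:R)) * (expR 2 * gam * N%:R) ^+ j.
    move=> jk; have jN := leq_trans jk kN.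
    have DNb y : 0 <= y <= 1 -> `|D N y| <= X * (gam * N%:R) ^+ N.
      by move=> y01; rewrite DN//; exact: bu.
    have := taylor_remainder_le tD D0 DNb (leq_subr j N) x01.
    rewrite subKn// => /le_trans; apply.
    set i := (N - j)%N; have NE : N = (i + j)%N by rewrite subnK.
    have h1 : (N%:R : R) ^+ i / i`!%:R <= expR N%:R by exact: powf_le_expR.
    have h2 : (gam * x) ^+ i <= expR (2 * j%:R - 2 * N%:R).
      have -> : 2 * j%:R - 2 * N%:R = - 2 * i%:R :> R by rewrite natrB//; ring.
      rewrite expRM_natr; apply: ler_exprn; first by rewrite mulr_ge0// ltW.
      rewrite expRN -[leRHS]mul1r ler_pdivlMr ?expR_gt0//.
      by apply: le_trans xq; rewrite mulrAC; apply: ler_wpM2r => //; rewrite mulrC.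
    have -> : X * (gam * N%:R) ^+ N * (x ^+ i / i`!%:R) =
       X * (gam * N%:R) ^+ j * ((gam * x) ^+ i * (N%:R ^+ i / i`!%:R)).
      by rewrite {2}NE exprD !exprMn; ring.
    have -> : X * expR (- N%:R) * (expR 2 * gam * N%:R) ^+ j =
       X * (gam * N%:R) ^+ j * (expR (2 * j%:R - 2 * N%:R) * expR N%:R).
      have -> : expR (2 * j%:R - 2 * N%:R) * expR N%:R = expR (- N%:R) * expR 2 ^+ j :> R.
        by rewrite -expRM_natr -!expRD; congr expR; ring.
      by rewrite !exprMn; ring.
    apply: ler_wpM2l; first by rewrite mulr_ge0 ?exprn_ge0// ltW.
    apply: ler_pM => //; first by rewrite exprn_ge0// mulr_ge0// ltW.
  have XeN : 0 <= X * expR (- N%:R) by rewrite mulr_ge0// ltW.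
  have e2N : 0 <= expR 2 * gam * N%:R by rewrite -mulrA mulr_ge0// expR_ge0.
  apply: le_trans (@leib_norm_le R ((ptower (cutoff n m))^~ x) (D^~ x) k 1
    (X * expR (- N%:R)) (4 * n%:R) (expR 2 * gam * N%:R) ler01 XeN n0 e2N _ Dk) _.
    by move=> j _; rewrite mul1r; exact: cutoff_derivn_le.
  have -> : 4 * n%:R + expR 2 * gam * N%:R = Gam * N%:R by rewrite nE /Gam; ring.
  have GN : 0 <= (Gam * N%:R) ^+ k.
    by rewrite exprn_ge0//; apply: le_trans gamGam; rewrite addr_ge0.
  by have := mulr_ge0 XeN GN; lra.
(* Beyond 1 / q, the cutoff is at most e^(- L N), and L > gam. *)
have Dk j : (j <= k)%N -> `|D j x| <= (2 * X * expR (gam * N%:R)) * (gam * N%:R) ^+ j.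
  move=> jk; have jN := leq_trans jk kN.
  apply: le_trans (ler_normB _ _) _; have := Tb j x x01; have := bu j x jN x01.
  have e1 : 1 <= expR (gam * N%:R) by apply: le_trans (expR_ge1Dx _); rewrite lerDl.
  have P : 0 <= X * (gam * N%:R) ^+ j by apply: mulr_ge0; [exact: ltW|exact: exprn_ge0].
  by have := ler_wpM2l P e1; lra.
have cR j : (j <= k)%N -> `|ptower (cutoff n m) j x| <= expR (- m%:R) * (4 * n%:R) ^+ j.
  move=> _; rewrite mulrC; apply: cutoff_right => //.
  rewrite /n !natrM -mulrA; apply: ler_peMr; first by rewrite mulr_ge0.
  exact: ltW.
have XE2 : 0 <= 2 * X * expR (gam * N%:R) by rewrite -mulrA mulr_ge0.
apply: le_trans (@leib_norm_le R ((ptower (cutoff n m))^~ x) (D^~ x) k (expR (- m%:R))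
    (2 * X * expR (gam * N%:R)) (4 * n%:R) (gam * N%:R) (expR_ge0 _) XE2 n0 gN0 cR Dk) _.
have em : expR (- m%:R) * expR (gam * N%:R) <= expR (- N%:R).
  rewrite -expRD ler_expR /m natrM; have := ler_wpM2r N0 Lg; lra.
have -> : expR (- m%:R) * (2 * X * expR (gam * N%:R)) * (4 * n%:R + gam * N%:R) ^+ k =
  2 * X * (4 * n%:R + gam * N%:R) ^+ k * (expR (- m%:R) * expR (gam * N%:R)) by ring.
have base : 0 <= 4 * n%:R + gam * N%:R by rewrite addr_ge0.
have X2 : 0 <= 2 * X by rewrite mulr_ge0// ltW.
apply: ler_pM em; first exact: mulr_ge0 X2 (exprn_ge0 _ base).
  by rewrite mulr_ge0 ?expR_ge0.
by apply: ler_wpM2l => //; exact: ler_exprn.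
Qed.

End LocalApproximation.

Section GlobalApproximation.
Context {R : realType}.

Lemma layer_antimono (b kap mu x : R) : b <= kap -> 0 < mu -> 0 <= x <= 1 ->
  layer kap mu x <= layer b mu x.
Proof.
move=> bk mu0 /andP[x0 x1]; rewrite /layer; apply: lerD; rewrite ler_expR lerN2.
  by apply: ler_wpM2r; [rewrite invr_ge0 ltW|apply: ler_wpM2r].
by apply: ler_wpM2r; [rewrite invr_ge0 ltW|apply: ler_wpM2r; rewrite ?subr_ge0].
Qed.

Lemma exists_nat_ge (y : R) : 0 <= y -> exists n : nat, y <= n%:R.
Proof.
by move=> y0; have /andP[_ h] := truncn_itv y0; eexists; exact: ltW h.
Qed.

(** What the cutoffs at the two end points miss: near an end point one of them is close
to 1 and the other one to 0, and in between the layer itself is exponentially small. *)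
Lemma cutoff_gap_le (X gam kap b mu : R) (q m N : nat) (u : nat -> R -> R) k x :
  let n := (4 * m * q)%N in
  let cL := cutoff n m in let cR := cL \Po (1 - 'X) in
  0 <= X -> 0 <= gam -> 0 < kap -> 0 < mu -> 2 <= q%:R :> R -> 0 <= x <= 1 ->
  b / mu <= m%:R / 4 -> b / mu <= kap / (16 * q%:R) / mu ->
  (forall j, (j <= k)%N -> `|u j x| <= X * (gam * N%:R) ^+ j * layer kap mu x) ->
  `|leib ((ptower (1 - cL - cR))^~ x) (u^~ x) k|
    <= 6 * X * (4 * n%:R + gam * N%:R) ^+ k * expR (- (b / mu)).
Proof.
move=> n cL cR X0 gam0 kap0 mu0 q2 x01 bm bk bu.
have /andP[x0 x1] := x01.
have m0 : 0 <= m%:R :> R by [].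
have q0 : 0 < q%:R :> R by lra.
have n0 : 0 <= 4 * n%:R :> R by rewrite mulr_ge0.
have gN0 : 0 <= gam * N%:R by rewrite mulr_ge0.
have rev01 : 0 <= 1 - x <= 1 by apply/andP; split; lra.
have cRE j : `|ptower cR j x| = `|ptower cL j (1 - x)|.
  by rewrite ptower_rev// normrM normrX normrN1 expr1n mul1r.
have emb : expR (- (m%:R / 4)) <= expR (- (b / mu)) by rewrite ler_expR lerN2.
have em4 : expR (- m%:R) <= expR (- (m%:R / 4)) :> R by rewrite ler_expR; lra.
have lay2 : layer kap mu x <= 2 by exact: layer_le2.
have bu2 j : (j <= k)%N -> `|u j x| <= 2 * X * (gam * N%:R) ^+ j.
  move=> jk; apply: le_trans (bu j jk) _.
  by have := ler_wpM2l (mulr_ge0 X0 (exprn_ge0 j gN0)) lay2; lra.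
have nE y : n%:R * y = 4 * (m%:R * (q%:R * y)) :> R by rewrite /n !natrM; ring.
have side (P Q : {poly R}) : 1 - cL - cR = P - Q ->
    (forall j, `|ptower P j x| <= (4 * n%:R) ^+ j * expR (- (m%:R / 4))) ->
    (forall j, `|ptower Q j x| <= (4 * n%:R) ^+ j * expR (- (m%:R / 4))) ->
    `|leib ((ptower (1 - cL - cR))^~ x) (u^~ x) k|
      <= 6 * X * (4 * n%:R + gam * N%:R) ^+ k * expR (- (b / mu)).
  move=> -> bP bQ.
  have e0 : 0 <= 2 * expR (- (m%:R / 4)) :> R by rewrite mulr_ge0 ?expR_ge0.
  have X20 : 0 <= 2 * X by rewrite mulr_ge0.
  apply: le_trans (@leib_norm_le R ((ptower (P - Q))^~ x) (u^~ x) k _ _ _ _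
     e0 X20 n0 gN0 _ bu2) _.
    move=> j _; rewrite ptowerB; apply: le_trans (ler_normB _ _) _.
    by have := bP j; have := bQ j; lra.
  have B0 : 0 <= X * (4 * n%:R + gam * N%:R) ^+ k.
    by rewrite mulr_ge0// exprn_ge0// addr_ge0.
  have := ler_wpM2l B0 emb; have := mulr_ge0 B0 (expR_ge0 (- (b / mu))); clear; lra.
(* The cutoffs drop at the distance 1 / (4 q) from their end points. *)
have [xl|xl] := leP (16 * (q%:R * x)) 1.
  apply: (side (1 - cL) cR) => // j.
    apply: cutoff_left => //; rewrite nE.
    by have := ler_wpM2l m0 xl; clear; lra.
  rewrite cRE; apply: le_trans (_ : (4 * n%:R) ^+ j * expR (- m%:R) <= _).
    apply: cutoff_right => //; rewrite nE; apply: ler_wpM2l => //.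
    by apply: ler_peMr => //; clear - q2 xl x0 x1; nra.
  by apply: ler_wpM2l => //; exact: exprn_ge0.
have [xr|xr] := leP (16 * (q%:R * (1 - x))) 1.
  apply: (side (1 - cR) cL) => [|j|j].
  - by rewrite -!addrA [- cL + _]addrC.
  - have -> : 1 - cR = (1 - cL) \Po (1 - 'X) by rewrite comp_polyB comp_polyC.
    rewrite ptower_rev// normrM normrX normrN1 expr1n mul1r.
    apply: cutoff_left => //; rewrite nE.
    by have := ler_wpM2l m0 xr; clear; lra.
  - apply: le_trans (_ : (4 * n%:R) ^+ j * expR (- m%:R) <= _).
      apply: cutoff_right => //; rewrite nE; apply: ler_wpM2l => //.
      by apply: ler_peMr => //; clear - q2 xr x0 x1; nra.
    by apply: ler_wpM2l => //; exact: exprn_ge0.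
have lay : layer kap mu x <= 2 * expR (- (b / mu)).
  have h y : 1 < 16 * (q%:R * y) -> expR (- (kap * y / mu)) <= expR (- (b / mu)).
    move=> hy; rewrite ler_expR lerN2; apply: le_trans bk _.
    apply: ler_wpM2r; first by rewrite invr_ge0 ltW.
    rewrite ler_pdivrMr ?mulr_gt0//.
    by have := ler_wpM2l (ltW kap0) (ltW hy); clear; lra.
  by have := h _ xl; have := h _ xr; rewrite /layer; clear; lra.
have X20 : 0 <= 2 * X * expR (- (b / mu)) by rewrite !mulr_ge0 ?expR_ge0.
have three : 0 <= 3 :> R by [].
apply: le_trans (@leib_norm_le R ((ptower (1 - cL - cR))^~ x) (u^~ x) k 3
   (2 * X * expR (- (b / mu))) (4 * n%:R) (gam * N%:R) three X20 n0 gN0 _ _) _.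
- move=> j _; rewrite !ptowerB.
  have h1 : `|ptower (1 : {poly R}) j x| <= (4 * n%:R) ^+ j.
    rewrite /ptower; case: j => [|j]; first by rewrite derivn0 hornerC normr1 expr0.
    by rewrite -polyC1 derivSn derivC linear0 horner0 normr0 exprn_ge0.
  have h2 := cutoff_derivn_le n m j x01.
  have h3 := cutoff_derivn_le n m j rev01.
  have := cRE j; have := ler_normB (ptower 1 j x - ptower cL j x) (ptower cR j x).
  by have := ler_normB (ptower 1 j x) (ptower cL j x); rewrite /ptower in h1 *; clear - h1 h2 h3; lra.
- move=> j jk; apply: le_trans (bu j jk) _.
  by have := ler_wpM2l (mulr_ge0 X0 (exprn_ge0 j gN0)) lay; clear; lra.
by rewrite le_eqVlt; apply/orP; left; apply/eqP; ring.
Qed.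

(** The polynomial is the sum of the Taylor polynomials at both end points, each
multiplied by its cutoff. Up to order N its layer bounds come from those of u; for the
orders above N, where nothing is known about u, they hold because growth geometric in k
absorbs every factor exponential in N. *)
Lemma polynomial_approximation (X gam kap : R) : 0 < X -> 1 <= gam -> 0 < kap ->
  exists C Gam b : R, [/\ 0 < C, 0 < Gam, 0 < b & forall (mu : R) (N : nat)
     (u : nat -> R -> R),
   0 < mu -> 1 / mu <= N%:R -> tower u ->
   (forall n x, (n <= N)%N -> 0 <= x <= 1 ->
      `|u n x| <= X * (gam * N%:R) ^+ n * layer kap mu x) ->
   exists p : {poly R},
     (forall k x, (k <= N)%N -> 0 <= x <= 1 ->
        `|u k x - ptower p k x| <= C * (Gam * N%:R) ^+ k * expR (- (b / mu))) /\
     (forall k x, 0 <= x <= 1 ->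
        `|ptower p k x| <= C * (Gam * N%:R) ^+ k * layer b mu x)].
Proof.
move=> X0 gam1 kap0.
have gam0 : 0 < gam by lra.
have e3 : 3 <= expR 2 :> R by apply: le_trans (expR_ge1Dx _); lra.
have eg0 : 0 <= expR 2 * gam by rewrite mulr_ge0 ?expR_ge0// ltW.
have [q qg] := exists_nat_ge eg0.
have [L Lg] : exists L : nat, gam + 1 <= L%:R by apply: exists_nat_ge; lra.
have q2 : 2 <= q%:R :> R by apply: le_trans qg; nra.
have q0 : 0 < q%:R :> R by lra.
pose b := Num.min (kap / (16 * q%:R)) (1 / 2).
have b0 : 0 < b by rewrite lt_min !divr_gt0// mulr_gt0.
have bk : b <= kap / (16 * q%:R) by rewrite ge_min lexx.
have b2 : b <= 1 / 2 by rewrite ge_min lexx orbT.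
have bkap : b <= kap.
  by apply: le_trans bk _; rewrite ler_pdivrMr ?mulr_gt0// ler_peMr ?(ltW kap0)//; lra.
clearbody b.
pose Gam0 := 16 * L%:R * q%:R + expR 2 * gam.
have Gam00 : 0 < Gam0.
  by rewrite /Gam0 ltr_pwDr ?mulr_gt0 ?expR_gt0// mulr_ge0 ?mulr_ge0// ltW.
have Egb : 1 <= expR (gam + b) by apply: le_trans (expR_ge1Dx _); lra.
pose Gam := Gam0 * expR (gam + b).
have GG : Gam0 <= Gam by rewrite /Gam ler_peMr// ltW.
exists (15 * X), Gam, b; split; [lra|by rewrite /Gam mulr_gt0// expR_gt0|by []|].
move=> mu N u mu0 muN tu bu.
pose m := (L * N)%N; pose n := (4 * m * q)%N.
pose cL := cutoff n m : {poly R}; pose cR := cL \Po (1 - 'X).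
have nE : 4 * n%:R = 16 * L%:R * q%:R * N%:R :> R by rewrite /n /m !natrM; ring.
have Nn : 0 <= N%:R :> R by [].
have gN0 : 0 <= gam * N%:R by rewrite mulr_ge0// ltW.
have bu2 : forall v : nat -> R -> R, (forall j x, (j <= N)%N -> 0 <= x <= 1 ->
      `|v j x| <= X * (gam * N%:R) ^+ j * layer kap mu x) ->
    forall j x, (j <= N)%N -> 0 <= x <= 1 -> `|v j x| <= 2 * X * (gam * N%:R) ^+ j.
  move=> v bv j x jN x01; apply: le_trans (bv j x jN x01) _.
  have := ler_wpM2l (mulr_ge0 (ltW X0) (exprn_ge0 j gN0)) (layer_le2 kap0 mu0 x01); clear; lra.
pose u' (k : nat) (x : R) := (-1) ^+ k * u k (1 - x).
have bu' j x : (j <= N)%N -> 0 <= x <= 1 -> `|u' j x| <= X * (gam * N%:R) ^+ j * layer kap mu x.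
  move=> jN /andP[x0 x1]; rewrite /u' normrM normrX normrN1 expr1n mul1r -layer_rev.
  by apply: bu => //; apply/andP; split; clear - x0 x1; lra.
have X20 : 0 < 2 * X by rewrite mulr_gt0.
have [aL gL] := taylor_cutoff_approx X20 gam1 qg Lg tu (bu2 u bu).
have [aR gR] := taylor_cutoff_approx X20 gam1 qg Lg (tower_rev tu) (bu2 u' bu').
pose pL := (cutoff n m : {poly R}) * taylor (fun j => u j 0) N.
pose pR' := (cutoff n m : {poly R}) * taylor (fun j => u' j 0) N.
rewrite -/m -/n -/Gam0 -/pL in aL gL; rewrite -/m -/n -/Gam0 -/pR' in aR gR.
pose pR := pR' \Po (1 - 'X).
have pRE k x : 0 <= x <= 1 -> ptower pR k x = (-1) ^+ k * ptower pR' k (1 - x).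
  by move=> x01; exact: ptower_rev.
have rev01 (x : R) : 0 <= x <= 1 -> 0 <= 1 - x <= 1.
  by move=> /andP[x0 x1]; apply/andP; split; clear - x0 x1; lra.
have gR' k x : 0 <= x <= 1 -> `|ptower pR k x| <= 2 * X * expR (gam * N%:R) * (Gam0 * N%:R) ^+ k.
  move=> x01; rewrite pRE// normrM normrX normrN1 expr1n mul1r.
  by apply: gR; exact: rev01.
have aR' k x : (k <= N)%N -> 0 <= x <= 1 ->
    `|leib ((ptower cR)^~ x) (u^~ x) k - ptower pR k x|
      <= 2 * (2 * X) * (Gam0 * N%:R) ^+ k * expR (- N%:R).
  move=> kN x01; have := aR k (1 - x) kN (rev01 x x01).
  have -> : leib ((ptower cR)^~ x) (u^~ x) k =
      (-1) ^+ k * leib ((ptower (cutoff n m))^~ (1 - x)) (u'^~ (1 - x)) k.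
    rewrite -leib_rev; apply: eq_leib => j _; first exact: ptower_rev.
    by rewrite /u' /= mulrA -exprD addnn -mul2n exprM sqrrN !expr1n mul1r subKr.
  by rewrite pRE// -mulrBr normrM normrX normrN1 expr1n mul1r.
have GN0 : 0 <= Gam0 * N%:R by rewrite mulr_ge0// ltW.
have Nb : b / mu <= N%:R.
  apply: le_trans muN; apply: ler_wpM2r; last by clear - b2; lra.
  by rewrite invr_ge0 ltW.
have eNb : expR (- N%:R) <= expR (- (b / mu)) by rewrite ler_expR lerN2.
have approx k x : (k <= N)%N -> 0 <= x <= 1 ->
    `|u k x - ptower (pL + pR) k x| <= 14 * X * (Gam0 * N%:R) ^+ k * expR (- (b / mu)).
  move=> kN x01.
  have -> : u k x - ptower (pL + pR) k x =
      leib ((ptower (1 - cL - cR))^~ x) (u^~ x) k +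
      (leib ((ptower cL)^~ x) (u^~ x) k - ptower pL k x) +
      (leib ((ptower cR)^~ x) (u^~ x) k - ptower pR k x).
    rewrite ptowerD (@eq_leib _ ((ptower (1 - cL - cR))^~ x) (u^~ x)
      (fun j => ptower 1 j x - ptower cL j x - ptower cR j x) (u^~ x))//; last first.
      by move=> j _; rewrite !ptowerB.
    rewrite (leibBl (fun j => ptower 1 j x - ptower cL j x)) (leibBl ((ptower 1)^~ x)).
    by rewrite leib_ptower1; ring.
  have gap : `|leib ((ptower (1 - cL - cR))^~ x) (u^~ x) k|
       <= 6 * X * (Gam0 * N%:R) ^+ k * expR (- (b / mu)).
    apply: le_trans (@cutoff_gap_le X gam kap b mu q m N u k x (ltW X0) (ltW gam0)
      kap0 mu0 q2 x01 _ _ _) _.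
    - have L2 : 2 <= L%:R :> R by clear - Lg gam1; lra.
      have := ler_wpM2r Nn L2; rewrite /m natrM.
      have : b / mu <= N%:R / 2.
        have := ler_wpM2r (_ : 0 <= mu^-1)%R b2; rewrite invr_ge0 => /(_ (ltW mu0)).
        by move: muN; rewrite div1r; clear; lra.
      clear; lra.
    - by apply: ler_wpM2r => //; rewrite invr_ge0 ltW.
    - by move=> j jk; apply: bu => //; exact: leq_trans kN.
    apply: ler_wpM2r; first exact: expR_ge0.
    apply: ler_wpM2l; first by rewrite mulr_ge0// ltW.
    apply: ler_exprn; first by rewrite addr_ge0// mulr_ge0.
    have -> : Gam0 * N%:R = 4 * n%:R + expR 2 * gam * N%:R by rewrite nE /Gam0; ring.
    rewrite lerD2l; apply: ler_wpM2r => //.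
    by apply: ler_peMl; [exact: ltW|clear - e3; lra].
  have B0 : 0 <= X * (Gam0 * N%:R) ^+ k by rewrite mulr_ge0 ?exprn_ge0// ltW.
  have := ler_wpM2l B0 eNb.
  have hL := aL k x kN x01; have hR := aR' k x kN x01.
  move: gap hL hR; set E1 := leib _ _ _; set E2 := leib _ _ _ - _; set E3 := leib _ _ _ - _.
  have := ler_normD (E1 + E2) E3; have := ler_normD E1 E2.
  clearbody E1 E2 E3; clear - B0; lra.
have GkG k : (Gam0 * N%:R) ^+ k <= (Gam * N%:R) ^+ k.
  by apply: ler_exprn => //; apply: ler_wpM2r.
have eb := expR_ge0 (- (b / mu)).
have Xk k : 0 <= X * (Gam * N%:R) ^+ k.
  by apply: mulr_ge0; [exact: ltW|apply: le_trans (GkG k); exact: exprn_ge0].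
exists (pL + pR); split=> [k x kN x01|k x x01].
  apply: le_trans (approx k x kN x01) _; apply: ler_wpM2r => //.
  have := ler_wpM2l (ltW X0) (GkG k); have := Xk k; clear; lra.
have ebl : expR (- (b / mu)) <= layer b mu x by exact: expR_le_layer.
have [kN|Nk] := leqP k N.
  have -> : ptower (pL + pR) k x = u k x - (u k x - ptower (pL + pR) k x) by ring.
  apply: le_trans (ler_normB _ _) _.
  have h1 := approx k x kN x01; have h2 := bu k x kN x01.
  have lb := layer_antimono bkap mu0 x01.
  have G1 : 14 * X * (Gam0 * N%:R) ^+ k * expR (- (b / mu)) <=
     14 * (X * (Gam * N%:R) ^+ k) * layer b mu x.
    apply: ler_pM => //; first by rewrite !mulr_ge0 ?exprn_ge0// ltW.
    by have := ler_wpM2l (ltW X0) (GkG k); clear; lra.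
  have G2 : X * (gam * N%:R) ^+ k * layer kap mu x <= X * (Gam * N%:R) ^+ k * layer b mu x.
    apply: ler_pM => //; [by rewrite mulr_ge0 ?exprn_ge0// ltW|exact/ltW/layer_gt0|].
    apply: ler_wpM2l; first exact: ltW.
    apply: ler_exprn => //; apply: ler_wpM2r => //; apply: le_trans GG.
    rewrite /Gam0; have : 0 <= 16 * L%:R * q%:R :> R by rewrite !mulr_ge0.
    have : gam <= expR 2 * gam by rewrite ler_peMl ?(ltW gam0)//; clear - e3; lra.
    clear; lra.
  clear - h1 h2 G1 G2; lra.
rewrite ptowerD; apply: le_trans (ler_normD _ _) _.
have h1 := gL k x x01; have h2 := gR' k x x01.
(* For k > N all exponentials of N are absorbed by the geometric growth in k. *)
have E : expR (gam * N%:R) * (Gam0 * N%:R) ^+ k <= (Gam * N%:R) ^+ k * layer b mu x.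
  have -> : (Gam * N%:R) ^+ k = expR ((gam + b) * k%:R) * (Gam0 * N%:R) ^+ k.
    by rewrite expRM_natr -exprMn /Gam; congr (_ ^+ _); ring.
  rewrite mulrAC; apply: ler_wpM2r; first exact: exprn_ge0.
  apply: le_trans (ler_wpM2l (expR_ge0 _) ebl); rewrite -expRD ler_expR.
  have kN : N%:R <= k%:R :> R by rewrite ler_nat ltnW.
  have bN : b / mu <= b * N%:R.
    by apply: ler_wpM2l; [exact: ltW|rewrite -div1r].
  have h3 := ler_wpM2l (ltW gam0) kN; have h4 := ler_wpM2l (ltW b0) kN; clear - h3 h4 bN; lra.
have := ler_wpM2l (ltW X0) E.
have := mulr_ge0 (Xk k) (ltW (layer_gt0 b mu x)); clear - h1 h2; lra.
Qed.

End GlobalApproximation.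

(** * Norms and integrals on the unit interval *)

Section NormsOnI.
Context {R : realType}.
Local Notation mu := (@lebesgue_measure R).
Local Notation I01 := ([set` `]0%R, 1%R[] : set (measurableTypeR R)).
Local Notation J01 := ([set` `[0%R, 1%R]] : set (measurableTypeR R)).
Implicit Types f g : R -> R.

Lemma ctsI_measurable f : ctsI f -> measurable_fun I01 f.
Proof.
move=> cf; apply: (@measurable_funS _ _ _ _ J01) => //.
  by move=> x /=; rewrite !in_itv /= => /andP[/ltW -> /ltW ->].
exact: subspace_continuous_measurable_fun.
Qed.

Lemma eq_measurable_I f g : (forall x, 0 < x < 1 -> f x = g x) ->
  measurable_fun I01 f -> measurable_fun I01 g.
Proof.
move=> fg; apply: eq_measurable_fun => x; rewrite inE /= in_itv /=; exact: fg.
Qed.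

Lemma ctsI_integrable f : ctsI f -> mu.-integrable J01 (EFin \o f).
Proof. by move=> cf; apply: continuous_compact_integrable => //; exact: segment_compact. Qed.

Lemma ctsI_integrable_oo f : ctsI f -> mu.-integrable I01 (EFin \o f).
Proof.
move=> /ctsI_integrable; apply: integrableS => //.
by move=> x /=; rewrite !in_itv /= => /andP[/ltW -> /ltW ->].
Qed.

Lemma normI2_le f g (B : R) : 0 <= B -> measurable_fun I01 f ->
  measurable_fun I01 g ->
  (forall x, 0 < x < 1 -> f x ^+ 2 <= g x) ->
  (\int[mu]_(x in `]0%R, 1%R[) (g x)%:E <= (B ^+ 2)%:E)%E ->
  (normI 2%:E f <= B%:E)%E.
Proof.
move=> B0 mf mg fg gB.
have mI : measurable I01 by exact: measurable_itv.
rewrite /normI unlock.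
have -> : (\int[mu]_x `|(EFin \o (f \_ `]0%R, 1%R[)) x| `^ 2 =
    \int[mu]_(x in `]0%R, 1%R[) (f x ^+ 2)%:E)%E.
  rewrite [RHS]integral_mkcond; apply: eq_integral => x _ /=.
  rewrite !patchE; case: ifP => _.
    by rewrite powR_mulrn ?normr_ge0// real_normK ?num_real.
  by rewrite normr0 powR0.
rewrite poweR12_sqrt; last by apply: integral_ge0 => x _; rewrite lee_fin sqr_ge0.
have -> : B%:E = sqrte (B ^+ 2)%:E :> \bar R by rewrite /= sqrtr_sqr ger0_norm.
rewrite lee_sqrt ?lee_fin ?sqr_ge0//; apply: le_trans gB.
apply: ge0_le_integral => //.
- by move=> x _; rewrite lee_fin sqr_ge0.
- by apply/measurable_EFinP; exact: measurable_funX.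
- exact/measurable_EFinP.
Qed.

Lemma measure_I : mu I01 = 1%E.
Proof. by rewrite lebesgue_measure_itv /= lte_fin ltr01 -EFinD subr0. Qed.

Lemma normI2_le_sup f (M : R) : measurable_fun I01 f ->
  (forall x, 0 < x < 1 -> `|f x| <= M) -> (normI 2%:E f <= M%:E)%E.
Proof.
move=> mf fM.
have M0 : 0 <= M by apply: le_trans (fM (1 / 2) _); [exact: normr_ge0|lra].
apply: (@normI2_le f (fun=> M ^+ 2)) => //.
- move=> x x01; rewrite -real_normK ?num_real//.
  by rewrite lerXn2r ?nnegrE// fM.
- by rewrite integral_cst//= measure_I mule1.
Qed.

Lemma normI_oo_le_sup f (M : R) : (forall x, 0 < x < 1 -> `|f x| <= M) ->
  (normI +oo%E f <= M%:E)%E.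
Proof.
move=> fM.
have M0 : 0 <= M by apply: le_trans (fM (1 / 2) _); [exact: normr_ge0|lra].
rewrite /normI unlock; case: ifP => _; last by rewrite lee_fin.
apply/ess_supP; apply: nearW => x /=; rewrite lee_fin patchE.
case: ifP => [|_]; last by rewrite normr0.
by rewrite inE /= in_itv /=; exact: fM.
Qed.

(** The flag selects the end point at which the layer sits. *)
Lemma integral_expR_le (c : R) (t : bool) : 0 < c ->
  (\int[mu]_(x in `]0%R, 1%R[) (expR (- (c * (if t then x else 1 - x))))%:E <= (1 / c)%:E)%E.
Proof.
move=> c0.
pose sg : R := if t then -1 else 1.
have sg2 : sg * sg = 1 by rewrite /sg; case: (t); lra.
pose f (x : R) := expR (- (c * (if t then x else 1 - x))).
have dE (x : R) : is_derive x 1 (fun y => - (c * (if t then y else 1 - y))) (sg * c).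
  rewrite /sg; case: (t).
    by apply: (is_derive_eq (isD_N (isD_Z c (isD_id x)))); ring.
  by apply: (is_derive_eq (isD_N (isD_Z c (isD_B (isD_cst 1 x) (isD_id x))))); ring.
have df (x : R) : is_derive x 1 f (sg * c * f x).
  by apply: (is_derive_eq (isD_comp (dE x) (is_derive_expR _))); rewrite mulrC.
have cf : continuous f.
  by move=> x; apply/differentiable_continuous/derivable1_diffP; exact: is_derive_derivable (df x).
pose F (x : R) := sg / c * f x.
have dF (x : R) : is_derive x 1 F (f x).
  apply: (is_derive_eq (isD_Z (sg / c) (df x))).
  have -> : sg / c * (sg * c * f x) = (sg * sg) * f x * (c / c) by field; rewrite gt_eqF.
  by rewrite sg2 divff ?gt_eqF// mul1r mulr1.
have cF : continuous F.
  by move=> x; apply/differentiable_continuous/derivable1_diffP; exact: is_derive_derivable (dF x).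
apply: (@le_trans _ _ (\int[mu]_(x in `[0%R, 1%R]) (f x)%:E)%E).
  apply: ge0_subset_integral => //.
  - apply/measurable_EFinP; apply: measurable_funS (continuous_measurable_fun cf) => //.
  - by move=> x /=; rewrite !in_itv /= => /andP[/ltW -> /ltW ->].
rewrite (@continuous_FTC2 R f F 0 1 ltr01).
- rewrite -EFinB lee_fin /F /f /sg.
  have e0 : forall y, 0 <= 1 / c * expR y.
    by move=> y; rewrite mulr_ge0 ?expR_ge0// divr_ge0// ltW.
  case: (t); first by have := e0 (- (c * 1)); rewrite mulr0 oppr0 expR0; lra.
  by have := e0 (- (c * (1 - 0))); rewrite subrr mulr0 oppr0 expR0; lra.
- exact: continuous_subspaceT.
- split.
  + by move=> x _; exact: is_derive_derivable (dF x).
  + exact/cvg_at_right_filter/cF.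
  + exact/cvg_at_left_filter/cF.
- by move=> x _; exact: is_derive_derive1.
Qed.

(** From |f| <= 1 + f^2. *)
Lemma Lfun2_integrable_I f : f \_ `]0, 1[ \in Lfun mu 2%:E ->
  mu.-integrable I01 (EFin \o f).
Proof.
move=> hf; have mI : measurable I01 by exact: measurable_itv.
have iI := Lfun2_integrable_sqr hf.
pose q (x : R) : R := (f \_ I01) x ^+ 2.
have i1 : mu.-integrable I01 (EFin \o (fun x => 1 + q x)).
  have h1 := ctsI_integrable_oo (@ctsI_cst R 1).
  have h2 : mu.-integrable I01 (EFin \o q) by apply: integrableS iI.
  exact: (integrableD mI h1 h2).
apply: le_integrable i1 => //.
  apply/measurable_EFinP.
  have mf : measurable_fun [set: R]%classic (f \_ `]0, 1[).
    by move: hf; rewrite inE => /andP[/[!inE]].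
  by apply/(measurable_restrictT _ mI).
move=> x xI; rewrite /= !lee_fin /q patchE mem_set//.
have n0 := normr_ge0 (f x); rewrite (@ger0_norm _ (1 + _)) ?addr_ge0 ?sqr_ge0//.
rewrite -[f x ^+ 2]real_normK ?num_real//; nra.
Qed.

Lemma bounded_Lfun2 f (M : R) : measurable_fun [set: R]%classic f ->
  (forall x, 0 < x < 1 -> `|f x| <= M) -> f \_ `]0, 1[ \in Lfun mu 2%:E.
Proof.
move=> mf fM; rewrite inE; apply/andP; split; rewrite inE /=.
  have mI : measurable I01 by exact: measurable_itv.
  by apply/(measurable_restrictT _ mI); exact: measurable_funTS.
apply: le_lt_trans (ltry M); apply: normI2_le_sup => //.
exact: measurable_funTS.
Qed.

End NormsOnI.

(** * The Green function *)

Section GreenFunction.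
Context {R : realType}.
Local Notation mu := (@lebesgue_measure R).
Local Notation I01 := ([set` `]0%R, 1%R[] : set (measurableTypeR R)).
Local Notation J01 := ([set` `[0%R, 1%R]] : set (measurableTypeR R)).
Implicit Types f g h u : R -> R.

(** The Green function of - u'' with homogeneous Dirichlet conditions. *)
Definition green (x t : R) : R := Num.min x t - x * t.
Definition dgreen (x t : R) : R := (t < x)%R%:R - x.

Lemma itv0_sub_I01 (y : R) : y <= 1 ->
  ([set` `]0%R, y[] : set (measurableTypeR R)) `<=` I01.
Proof.
by move=> y1 t /=; rewrite !in_itv /= => /andP[-> /lt_le_trans]; exact.
Qed.

Lemma integrable_step h (x : R) (D : set (measurableTypeR R)) : measurable D ->
  mu.-integrable D (EFin \o h) ->
  mu.-integrable D (EFin \o (fun t => (t < x)%R%:R * h t)).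
Proof.
move=> mD ih; apply: le_integrable (ih) => //.
  apply/measurable_EFinP; apply: measurable_funM; last first.
    by have /measurable_EFinP := measurable_int mu ih.
  have -> : (fun t : R => (t < x)%R%:R : R) = \1_([set` `]-oo, x[]).
    by apply/funext => t; rewrite indicE mem_setE in_itv.
  exact: measurable_indic.
move=> t _; rewrite /= !lee_fin normrM ler_piMl//.
by case: (t < x); rewrite /= ?normr1 ?normr0.
Qed.

Lemma Rintegral_step h (x y : R) :
  \int[mu]_(t in `]0, y[) ((t < x)%R%:R * h t) = \int[mu]_(t in `]0, Num.min x y[) h t.
Proof.
have -> : ([set` `]0, Num.min x y[] : set (measurableTypeR R)) =
    ([set` `]0, y[] : set (measurableTypeR R)) `&` [set` `]-oo, x[].
  apply/seteqP; split => t /=; rewrite !in_itv /= lt_min.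
    by move=> /and3P[h1 h2 h3]; split; rewrite ?h1 ?h2 ?h3.
  by move=> [/andP[-> ->] ->].
rewrite Rintegral_mkcondr; apply: eq_Rintegral => t _.
rewrite patchE mem_setE in_itv /=.
by case: (t < x); rewrite /= ?mul1r ?mul0r.
Qed.

Lemma Rintegral_cst_itv0 (y c : R) : 0 <= y ->
  \int[mu]_(t in `]0, y[) c = c * y.
Proof.
move=> y0; rewrite Rintegral_cst//= lebesgue_measure_itv /= lte_fin.
case: ltP => [_|y0']; first by rewrite -EFinD /= subr0.
by congr (_ * _); apply/eqP; rewrite eq_le y0 y0'.
Qed.

Lemma integrable_cst_itv0 (y c : R) : mu.-integrable [set` `]0, y[] (EFin \o (fun=> c)).
Proof.
have : mu.-integrable ([set` `[0, y]] : set (measurableTypeR R)) (EFin \o (fun=> c)).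
  apply: continuous_compact_integrable; first exact: segment_compact.
  by apply: continuous_subspaceT => t; exact: cst_continuous.
apply: integrableS => //.
by move=> t /=; rewrite !in_itv /= => /andP[/ltW -> /ltW ->].
Qed.

Lemma green_H10 (x : R) : 0 < x < 1 -> H10 (green x) (dgreen x).
Proof.
move=> /andP[x0 x1]; split.
- apply: (@bounded_Lfun2 R _ 2).
    apply: measurable_funB => //.
    have -> : (fun t : R => (t < x)%R%:R : R) = \1_([set` `]-oo, x[]).
      by apply/funext => t; rewrite indicE mem_setE in_itv.
    exact: measurable_indic.
  move=> t _; rewrite /dgreen; apply: le_trans (ler_normB _ _) _.
  rewrite (gtr0_norm x0); have : `|(t < x)%R%:R| <= 1 :> R.
    by case: (t < x); rewrite /= ?normr1 ?normr0.
  lra.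
- move=> y /andP[y0 y1].
  have -> : green x 0 = 0 by rewrite /green mulr0 subr0; apply/min_idPr; exact: ltW.
  rewrite add0r /dgreen RintegralB//; last 2 first.
  + have -> : (fun t : R => (t < x)%R%:R) = (fun t => (t < x)%R%:R * (fun=> 1 : R) t).
      by apply/funext => t; rewrite mulr1.
    by apply: integrable_step => //; exact: integrable_cst_itv0.
  + exact: integrable_cst_itv0.
  rewrite Rintegral_cst_itv0//.
  have -> : \int[mu]_(t in `]0, y[) (t < x)%R%:R = \int[mu]_(t in `]0, y[) ((t < x)%R%:R * (fun=> 1) t).
    by apply: eq_Rintegral => t _; rewrite mulr1.
  by rewrite Rintegral_step Rintegral_cst_itv0 ?mul1r// le_min y0 ltW.
- by rewrite /green mulr0 subr0; apply/min_idPr; exact: ltW.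
- by rewrite /green mulr1; apply/eqP; rewrite subr_eq0; apply/eqP/min_idPl; exact: ltW.
Qed.

Lemma H10_ctsI u du : H10 u du -> ctsI u.
Proof.
move=> [L2 uE u0 _].
have iI := Lfun2_integrable_I L2.
pose d : R -> R := du \_ I01.
have iJ : mu.-integrable J01 (EFin \o d).
  rewrite /d -restrict_EFin; apply/(@integrable_restrict _ _ _ mu I01 _ J01) => //.
  have -> : J01 `&` I01 = I01; last exact: iI.
  apply/seteqP; split => t /=; first by case.
  by move=> tI; split=> //; move: tI; rewrite !in_itv /= => /andP[/ltW -> /ltW ->].
have c := @parameterized_integral_continuous R 0 1 d ler01 iJ.
apply: eq_ctsI c => y /andP[y0 y1].
rewrite uE ?y0// u0 add0r /parameterized_integral.
have iy : mu.-integrable [set` `[0, y]] (EFin \o d).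
  by apply: integrableS iJ => // t /=; rewrite !in_itv /= => /andP[-> /le_trans]; exact.
have iy2 : mu.-integrable [set` `]0, y]] (EFin \o d).
  by apply: integrableS iy => // t /=; rewrite !in_itv /= => /andP[/ltW -> ->].
have iy3 : mu.-integrable [set` `]0, y[] (EFin \o d).
  by apply: integrableS iy2 => // t /=; rewrite !in_itv /= => /andP[-> /ltW ->].
rewrite -(Rintegral_itv_obnd_cbnd iy2) -(Rintegral_itv_bndo_bndc iy3).
apply: eq_Rintegral => t; rewrite inE => ty.
by rewrite /d patchE mem_set//; exact: itv0_sub_I01 ty.
Qed.

(** Splitting the integral at the diagonal of the Green function expresses u through
primitives of g and of t g, which can be differentiated. *)
Lemma green_primitive g u (d : R) : d != 0 -> ctsI g -> ctsI u ->
  (forall x, 0 < x < 1 -> d * u x = \int[mu]_(t in `]0, 1[) (green x t * g t)) ->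
  exists u1, [/\ ctsI u1,
    forall x : R, 0 < x < 1 -> is_derive x 1 u (u1 x) &
    forall x : R, 0 < x < 1 -> is_derive x 1 u1 (- g x / d)].
Proof.
move=> d0 cg cu uE.
have ctg : ctsI (fun t => t * g t) by apply: ctsIM => //; exact: ctsI_id.
pose G f x := \int[mu]_(t in `[0, x]) f t.
have cG f : ctsI f -> ctsI (G f).
  by move=> cf; exact: (@parameterized_integral_continuous R 0 1 f ler01 (ctsI_integrable cf)).
have dG f (x : R) : ctsI f -> 0 < x < 1 -> is_derive x 1 (G f) (f x).
  move=> cf /[dup] x01 /andP[x0 x1].
  have [h1 h2] := continuous_FTC1_closed x1 (ctsI_integrable cf) x0 (ctsI_at cf x01).
  by apply: (is_derive_eq (derivableP h1)); rewrite -derive1E.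
pose u1 x := (G g 1 - G (fun t => t * g t) 1 - G g x) / d.
have E (x : R) : 0 < x < 1 -> u x =
    (G (fun t => t * g t) x + x * (G g 1 - G g x) - x * G (fun t => t * g t) 1) / d.
  move=> /[dup] x01 /andP[x0 x1].
  have cm : ctsI (fun t => Num.min x t * g t).
    apply: ctsIM => //; apply: ctsI_continuous => t.
    by apply: continuous_min; [exact: cst_continuous|exact: cvg_id].
  apply: (mulfI d0); rewrite uE// mulrC divfK//.
  have cgr : ctsI (fun t => green x t * g t).
    apply: ctsIM => //; apply: ctsIB; last by apply: ctsIM; [exact: ctsI_cst|exact: ctsI_id].
    apply: ctsI_continuous => t.
    by apply: continuous_min; [exact: cst_continuous|exact: cvg_id].
  have iJ := ctsI_integrable cgr.
  have iI2 : mu.-integrable [set` `]0, 1]] (EFin \o (fun t => green x t * g t)).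
    by apply: integrableS iJ => // t /=; rewrite !in_itv /= => /andP[/ltW -> ->].
  rewrite (Rintegral_itv_bndo_bndc (ctsI_integrable_oo cgr)) (Rintegral_itv_obnd_cbnd iI2).
  have -> : \int[mu]_(t in `[0, 1]) (green x t * g t) =
      \int[mu]_(t in `[0, 1]) (Num.min x t * g t - x * (t * g t)).
    by apply: eq_Rintegral => t _; rewrite /green; ring.
  have cxt : ctsI (fun t => x * (t * g t)) by apply: ctsIM => //; exact: ctsI_cst.
  rewrite RintegralB//; [|exact: ctsI_integrable|exact: ctsI_integrable].
  rewrite RintegralZl//; last exact: ctsI_integrable.
  have := Rintegral_itvB (ctsI_integrable cm) (x := x); rewrite !bnd_simp => /(_ (ltW x0) (ltW x1)).
  have := Rintegral_itvB (ctsI_integrable cg) (x := x); rewrite !bnd_simp => /(_ (ltW x0) (ltW x1)).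
  have -> : \int[mu]_(t in `]x, 1]) (Num.min x t * g t) = x * \int[mu]_(t in `]x, 1]) g t.
    rewrite -RintegralZl//; last first.
      apply: integrableS (ctsI_integrable cg) => // t /=; rewrite !in_itv /= => /andP[xt ->].
      by rewrite (ltW (lt_trans x0 xt)).
    apply: eq_Rintegral => t; rewrite inE /= in_itv /= => /andP[/ltW xt _].
    by congr (_ * _); apply/min_idPl.
  have -> : \int[mu]_(t in `[0, x]) (Num.min x t * g t) = G (fun t => t * g t) x.
    apply: eq_Rintegral => t; rewrite inE /= in_itv /= => /andP[_ tx].
    by congr (_ * _); apply/min_idPr.
  rewrite -/(G g 1) -/(G g x) -/(G (fun t => t * g t) 1) => <- h.
  by move/eqP: h; rewrite subr_eq => /eqP ->; ring.
exists u1; split.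
- apply: ctsIM; last exact: ctsI_cst.
  by apply: ctsIB; [exact: ctsI_cst|exact: cG].
- move=> x x01; apply: (eq_isD x01 (fun y y01 => esym (E y y01))).
  have h := isD_M (isD_B (isD_D (dG _ x ctg x01) (isD_M (isD_id x)
    (isD_B (isD_cst (G g 1) x) (dG _ x cg x01)))) (isD_M (isD_id x)
    (isD_cst (G (fun t => t * g t) 1) x))) (isD_cst (d^-1)%R x).
  by apply: (is_derive_eq h); rewrite /u1; ring.
- move=> x x01.
  have h := isD_M (isD_B (isD_cst (G g 1 - G (fun t => t * g t) 1) x) (dG _ x cg x01))
    (isD_cst (d^-1)%R x).
  by apply: (is_derive_eq h); ring.
Qed.

End GreenFunction.

(** * Regularity of weak solutions *)

Section WeakSolutions.
Context {R : realType}.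
Local Notation mu_ := (@lebesgue_measure R).
Local Notation I01 := ([set` `]0%R, 1%R[] : set (measurableTypeR R)).

Lemma sum_ord2 (G : 'I_2 -> R) : \sum_(j < 2) G j = G ord0 + G ord_max.
Proof.
rewrite big_ord_recl big_ord1; congr (_ + G _).
by apply: val_inj.
Qed.

Lemma ord_max_neq0 : (ord_max == ord0 :> 'I_2) = false.
Proof. by []. Qed.

Lemma test_integrand (eps mu : R) (M : 'M[R]_2) (v dv w dw : 'cV[R]_2) (l : 'I_2) (p dp : R) :
  v = \col_i (if i == l then p else 0) -> dv = \col_i (if i == l then dp else 0) ->
  (dv^T *m diagE eps mu *m dw + v^T *m M *m w) ord0 ord0 =
  dp * (dcoef eps mu l * dw l ord0) +
  p * (M l ord0 * w ord0 ord0 + M l ord_max * w ord_max ord0).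
Proof.
move=> -> ->; rewrite !mxE !sum_ord2 !mxE !sum_ord2 /diagE !mxE /dcoef.
move: l; apply: ord2E; rewrite /= ?eqxx ?ord_max_neq0 /=; ring.
Qed.

Lemma test_load (v w : 'cV[R]_2) (l : 'I_2) (p : R) :
  v = \col_i (if i == l then p else 0) -> (v^T *m w) ord0 ord0 = p * w l ord0.
Proof.
move=> ->; rewrite !mxE !sum_ord2 !mxE.
by move: l; apply: ord2E; rewrite /= ?eqxx ?ord_max_neq0 /=; ring.
Qed.

Lemma H10_zero : H10 (fun=> 0 : R) (fun=> 0).
Proof.
split=> //.
  by apply: (@bounded_Lfun2 R _ 1) => // t _; rewrite normr0.
by move=> x /andP[x0 _]; rewrite Rintegral_cst_itv0// mul0r addr0.
Qed.

(** Testing with a Green function turns the variational equation into an integral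
equation, from which the regularity of the solution can be read off. *)
Lemma solution_green (eps mu : R) (A : R -> 'M[R]_2) (F U : R -> 'cV[R]_2) :
  (forall i j, ctsI (fun x => A x i j)) -> (forall l, ctsI (cpt F l)) ->
  solution eps mu A F U ->
  (forall l, [/\ ctsI (cpt U l), cpt U l 0 = 0 & cpt U l 1 = 0]) /\
  forall l (x : R), 0 < x < 1 -> dcoef eps mu l * cpt U l x =
    \int[mu_]_(t in `]0, 1[) (green x t * (cpt F l t -
      (A t l ord0 * cpt U ord0 t + A t l ord_max * cpt U ord_max t))).
Proof.
move=> cA cF [dU [hU weak]].
have cU l : ctsI (cpt U l) by exact: H10_ctsI (hU l).
split=> [l|l x x01]; first by split=> //; have [] := hU l.
pose V t : 'cV[R]_2 := \col_i (if i == l then green x t else 0).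
pose dV t : 'cV[R]_2 := \col_i (if i == l then dgreen x t else 0).
have hV : H10v V dV.
  move=> i; rewrite /cpt.
  have -> : (fun t => V t i ord0) = (if i == l then green x else fun=> 0).
    by apply/funext => t; rewrite /V mxE; case: ifP.
  have -> : (fun t => dV t i ord0) = (if i == l then dgreen x else fun=> 0).
    by apply/funext => t; rewrite /dV mxE; case: ifP.
  by case: ifP => _; [exact: green_H10|exact: H10_zero].
have := weak V dV hV.
have -> : \int[mu_]_(t in `]0, 1[)
    ((dV t)^T *m diagE eps mu *m dU t + (V t)^T *m A t *m U t) ord0 ord0 =
  \int[mu_]_(t in `]0, 1[) (dgreen x t * (dcoef eps mu l * cpt dU l t) +
     green x t * (A t l ord0 * cpt U ord0 t + A t l ord_max * cpt U ord_max t)).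
  by apply: eq_Rintegral => t _; apply: test_integrand.
have -> : \int[mu_]_(t in `]0, 1[) ((V t)^T *m F t) ord0 ord0 =
  \int[mu_]_(t in `]0, 1[) (green x t * cpt F l t).
  by apply: eq_Rintegral => t _; apply: test_load.
have cg : ctsI (green x).
  apply: ctsIB; last by apply: ctsIM; [exact: ctsI_cst|exact: ctsI_id].
  apply: ctsI_continuous => t.
  by apply: continuous_min; [exact: cst_continuous|exact: cvg_id].
have cAU : ctsI (fun t => green x t * (A t l ord0 * cpt U ord0 t + A t l ord_max * cpt U ord_max t)).
  by apply: ctsIM => //; apply: ctsID; apply: ctsIM.
have cGF : ctsI (fun t => green x t * cpt F l t) by exact: ctsIM.
have [L2 uE u0 u1] := hU l.
have mI : measurable I01 by exact: measurable_itv.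
have idU := Lfun2_integrable_I L2.
have istep := integrable_step x mI idU.
have ixdU : mu_.-integrable I01 (EFin \o (fun t => x * cpt dU l t)).
  exact: (integrableZl mI x idU).
have idd : mu_.-integrable I01 (EFin \o (fun t => (t < x)%R%:R * cpt dU l t - x * cpt dU l t)).
  exact: (integrableB mI istep ixdU).
have iddd : mu_.-integrable I01 (EFin \o (fun t => dgreen x t * (dcoef eps mu l * cpt dU l t))).
  have := integrableZl mI (dcoef eps mu l) idd; apply: eq_integrable => // t _ /=.
  by rewrite -EFinM /dgreen; congr EFin; ring.
have E : \int[mu_]_(t in `]0, 1[) (dgreen x t * (dcoef eps mu l * cpt dU l t)) =
    dcoef eps mu l * cpt U l x.
  have -> : \int[mu_]_(t in `]0, 1[) (dgreen x t * (dcoef eps mu l * cpt dU l t)) =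
      \int[mu_]_(t in `]0, 1[) (dcoef eps mu l *
         ((t < x)%R%:R * cpt dU l t - x * cpt dU l t)).
    by apply: eq_Rintegral => t _; rewrite /dgreen; ring.
  rewrite RintegralZl// RintegralB// RintegralZl//; congr (_ * _).
  rewrite Rintegral_step.
  have /andP[x0 x1] := x01.
  have -> : Num.min x 1 = x by apply/min_idPl; exact: ltW.
  have h1 := uE 1 (introT andP (conj ler01 (lexx 1))).
  rewrite u0 u1 add0r in h1.
  rewrite -h1 mulr0 subr0 [RHS]uE ?(ltW x0) ?(ltW x1)//.
  by rewrite u0 add0r.
rewrite RintegralD//; last exact: ctsI_integrable_oo.
rewrite E => e.
have -> : \int[mu_]_(t in `]0, 1[) (green x t * (cpt F l t -
      (A t l ord0 * cpt U ord0 t + A t l ord_max * cpt U ord_max t))) =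
  \int[mu_]_(t in `]0, 1[) (green x t * cpt F l t -
      green x t * (A t l ord0 * cpt U ord0 t + A t l ord_max * cpt U ord_max t)).
  by apply: eq_Rintegral => t _; rewrite mulrBr.
rewrite RintegralB//; [|exact: ctsI_integrable_oo|exact: ctsI_integrable_oo].
by rewrite -e addrK.
Qed.

(** A classical solution of a system with smooth data is smooth up to the boundary: the
equation itself expresses all higher derivatives through the first two. *)
Lemma bootstrap (eps mu : R) (a : 'I_2 -> 'I_2 -> nat -> R -> R)
    (f : 'I_2 -> nat -> R -> R) (u u1 : 'I_2 -> R -> R) :
  (forall l, dcoef eps mu l != 0) ->
  (forall i j, tower (a i j)) -> (forall l, tower (f l)) ->
  (forall l, ctsI (u l) /\ ctsI (u1 l)) ->
  (forall l (x : R), 0 < x < 1 -> is_derive x 1 (u l) (u1 l x)) ->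
  (forall l (x : R), 0 < x < 1 -> is_derive x 1 (u1 l)
     (- (f l 0%N x - (a l ord0 0%N x * u ord0 x + a l ord_max 0%N x * u ord_max x))
        / dcoef eps mu l)) ->
  exists v : 'I_2 -> nat -> R -> R, [/\ forall l, tower (v l),
    forall l, v l 0%N = u l &
    forall l n x, dcoef eps mu l * v l n.+2 x = sysop a v l n x - f l n x].
Proof.
move=> d0 ta tf cu du du1.
pose sw (g : nat -> 'I_2 -> R -> R) : 'I_2 -> nat -> R -> R := fun l n => g n l.
pose step n (g : nat -> 'I_2 -> R -> R) : 'I_2 -> R -> R :=
  if n is m.+1 then if m is k.+1 then
    fun l x => (sysop a (sw g) l k x - f l k x) / dcoef eps mu l
  else u1 else u.
have [[|[|n]] g h gh //|w wE] := @course_of_values ('I_2 -> R -> R) u step.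
  apply/funext => l; apply/funext => x; rewrite /step /sysop.
  congr ((_ + _ - _) / _); apply: eq_leib => // k kn; rewrite /sw gh//.
    by rewrite ltnS leqW.
  by rewrite ltnS leqW.
pose v := sw w; exists v.
have v0 l : v l 0%N = u l by rewrite /v /sw wE.
have v1 l : v l 1%N = u1 l by rewrite /v /sw wE.
have v2 l n x : v l n.+2 x = (sysop a v l n x - f l n x) / dcoef eps mu l.
  by rewrite {1}/v {1}/sw wE.
split=> //; last by move=> l n x; rewrite v2 mulrC divfK.
have v2E l n : v l n.+2 = fun x => (sysop a v l n x - f l n x) / dcoef eps mu l.
  by apply/funext => x; exact: v2.
move=> l; split.
  move=> n; elim/ltn_ind: n l => -[|[|n]] IH l.
  - by rewrite v0; have [] := cu l.
  - by rewrite v1; have [] := cu l.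
  - rewrite v2E; apply: ctsIM; last exact: ctsI_cst.
    apply: ctsIB; last exact: (tf l).1.
    by apply: ctsID; apply: ctsI_leib => k kn; try exact: (ta _ _).1;
      apply: IH; rewrite ltnS leqW.
move=> n x x01; elim/ltn_ind: n l => -[|[|n]] IH l.
- by rewrite v0 v1; exact: du.
- rewrite v1 v2; apply: (is_derive_eq (du1 l x x01)).
  by rewrite /sysop !leib0 !v0; congr (_ / _); ring.
- rewrite v2E v2.
  have hl j : is_derive x 1 (fun y => leib ((a l j)^~ y) ((v j)^~ y) n)
      (leib ((a l j)^~ x) ((v j)^~ x) n.+1).
    apply: is_derive_leib => k kn; first exact: (ta _ _).2.
    by apply: IH; rewrite ltnS leqW.
  have h := isD_M (isD_B (isD_D (hl ord0) (hl ord_max)) ((tf l).2 n x x01))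
    (isD_cst ((dcoef eps mu l)^-1)%R x).
  by apply: (is_derive_eq h); rewrite mulr0 addr0.
Qed.

End WeakSolutions.

(** * Norms of the boundary layer part and of the remainder *)

Section FinalNorms.
Context {R : realType}.
Local Notation mu_ := (@lebesgue_measure R).
Local Notation I01 := ([set` `]0%R, 1%R[] : set (measurableTypeR R)).

Lemma horner_entire (p : {poly R}) : entire (horner p).
Proof.
exists (fun n => p`_n) => x; apply: cvg_near_cst.
exists (size p) => // n /= pn; rewrite /series /= big_mkord.
by rewrite -(horner_coef_wide x pn).
Qed.

Lemma ctsI_comp (h f : R -> R) : continuous h -> ctsI f -> ctsI (fun x => h (f x)).
Proof. by move=> ch cf; apply: within_continuous_comp => // y _; exact: ch. Qed.

Lemma normI2_fin (f : R -> R) (B : R) : (normI 2%:E f <= B%:E)%E ->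
  exists r, [/\ 0 <= r, r <= B & normI 2%:E f = r%:E].
Proof.
have := Lnorm_ge0 mu_ 2%:E (EFin \o (f \_ `]0%R, 1%R[)); rewrite -/(normI _ _).
by case: (normI 2%:E f) => // r; rewrite !lee_fin => r0 rB; exists r.
Qed.

(** The weight of the boundary layer class costs half of the decay; the other half
has squared integral of the order of the layer width. *)
Lemma weighted_layer_norm (b mu K : R) (f : R -> R) : 0 < b -> 0 < mu -> 0 <= K ->
  measurable_fun I01 f ->
  (forall x, 0 < x < 1 -> `|f x| <= K * layer b mu x) ->
  (normI 2%:E (fun x => (expR (dist_bd x / (2 / b * mu)) * f x)%R)
    <= (2 * K * Num.sqrt (2 / b * mu))%:E)%E.
Proof.
move=> b0 mu0 K0 mf fK.
have dm0 : 0 < 2 / b * mu by rewrite mulr_gt0 ?divr_gt0.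
have bm0 : 0 < b / mu by rewrite divr_gt0.
pose E (t : bool) (x : R) := expR (- (b / mu * (if t then x else 1 - x))).
have cE t : ctsI (E t).
  apply: (ctsI_comp (@continuous_expR R)); apply: ctsIN; apply: ctsIM; first exact: ctsI_cst.
  by case: t; [exact: ctsI_id|apply: ctsIB; [exact: ctsI_cst|exact: ctsI_id]].
apply: (@normI2_le R _ (fun x => 2 * K ^+ 2 * (E true x + E false x))).
- by rewrite !mulr_ge0 ?sqrtr_ge0.
- apply: measurable_funM => //; apply: ctsI_measurable.
  apply: (ctsI_comp (@continuous_expR R)); apply: ctsIM; last exact: ctsI_cst.
  apply: ctsI_continuous => t; rewrite /dist_bd.
  have h := @continuous_min R R (fun x : R => `|x - 0| : R^o) (fun x : R => `|x - 1| : R^o) t.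
  apply: h.
    by apply: cvg_norm; apply: cvgB; [exact: cvg_id|exact: cvg_cst].
  by apply: cvg_norm; apply: cvgB; [exact: cvg_id|exact: cvg_cst].
- by apply: ctsI_measurable; apply: ctsIM; [exact: ctsI_cst|exact: ctsID].
- move=> x /[dup] x01 /andP[x0 x1].
  set d := dist_bd x.
  have dx : d <= x by rewrite /d /dist_bd subr0 (gtr0_norm x0) ge_min lexx.
  have dx1 : d <= 1 - x.
    by rewrite /d /dist_bd (@ltr0_norm _ (x - 1)) ?subr_lt0// opprB ge_min lexx orbT.
  have h y : d <= y -> expR (d / (2 / b * mu)) * expR (- (b * y / mu)) <=
      expR (- (b / mu * y) / 2).
    move=> dy; rewrite -expRD ler_expR.
    have -> : d / (2 / b * mu) = b / mu * d / 2 by field; rewrite !gt_eqF.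
    by have := ler_wpM2l (ltW bm0) dy; lra.
  have sq y : expR (- (b / mu * y) / 2) ^+ 2 = expR (- (b / mu * y)).
    by rewrite -expRM_natl; congr expR; field; rewrite gt_eqF.
  have fx : `|expR (d / (2 / b * mu)) * f x| <=
      K * (expR (- (b / mu * x) / 2) + expR (- (b / mu * (1 - x)) / 2)).
    rewrite normrM (ger0_norm (expR_ge0 _)).
    apply: le_trans (ler_wpM2l (expR_ge0 _) (fK x x01)) _.
    rewrite mulrCA; apply: ler_wpM2l => //; rewrite /layer mulrDr.
    by apply: lerD; exact: h.
  rewrite -real_normK ?num_real//.
  apply: le_trans (ler_exprn 2 (normr_ge0 _) fx) _.
  have -> : E true x = expR (- (b / mu * x) / 2) ^+ 2 by rewrite sq.
  have -> : E false x = expR (- (b / mu * (1 - x)) / 2) ^+ 2 by rewrite sq.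
  set p := expR (- (b / mu * x) / 2); set q := expR (- (b / mu * (1 - x)) / 2).
  have := mulr_ge0 (sqr_ge0 K) (sqr_ge0 (p - q)); clearbody p q; clear; lra.
- have iE t := ctsI_integrable_oo (cE t).
  have mI : measurable I01 by exact: measurable_itv.
  have cS : ctsI (fun x => E true x + E false x) by exact: ctsID.
  have -> : (\int[mu_]_(x in `]0%R, 1%R[) (2 * K ^+ 2 * (E true x + E false x))%:E =
     (2 * K ^+ 2)%:E * (\int[mu_]_(x in `]0%R, 1%R[) (E true x)%:E +
        \int[mu_]_(x in `]0%R, 1%R[) (E false x)%:E))%E.
    rewrite -(integralD mI (iE true) (iE false)) -integralZl//.
    exact: (ctsI_integrable_oo cS).
  have K2 : 0 <= 2 * K ^+ 2 by rewrite mulr_ge0// sqr_ge0.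
  have := leeD (integral_expR_le true bm0) (integral_expR_le false bm0).
  move=> /(lee_wpmul2l (_ : 0 <= (2 * K ^+ 2)%:E)%E); rewrite lee_fin => /(_ K2)/le_trans; apply.
  rewrite -EFinD -EFinM lee_fin !exprMn (sqr_sqrtr (ltW dm0)).
  have -> : 2 * K ^+ 2 * (1 / (b / mu) + 1 / (b / mu)) = 4 * (K ^+ 2 * (mu / b)).
    by field; rewrite !gt_eqF.
  have -> : 2 ^+ 2 * K ^+ 2 * (2 / b * mu) = 8 * (K ^+ 2 * (mu / b)).
    by field; rewrite gt_eqF.
  have : 0 <= K ^+ 2 * (mu / b) by rewrite mulr_ge0 ?sqr_ge0// divr_ge0// ltW.
  lra.
Qed.

Lemma enorm_le (v : 'cV[R]_2) (B0 B1 : R) : 0 <= B0 -> 0 <= B1 ->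
  `|v ord0 ord0| <= B0 -> `|v ord_max ord0| <= B1 -> enorm v <= B0 + B1.
Proof.
move=> b0 b1 h0 h1; rewrite /enorm.
have -> : B0 + B1 = Num.sqrt ((B0 + B1) ^+ 2) by rewrite sqrtr_sqr ger0_norm// addr_ge0.
rewrite ler_sqrt ?sqr_ge0// big_ord_recl big_ord1.
have -> : lift ord0 ord0 = ord_max :> 'I_2 by apply: val_inj.
rewrite -[v ord0 ord0 ^+ 2]real_normK ?num_real// -[v ord_max ord0 ^+ 2]real_normK ?num_real//.
have := ler_exprn 2 (normr_ge0 _) h0; have := ler_exprn 2 (normr_ge0 _) h1; nra.
Qed.

(** All norms of the remainder follow from pointwise bounds on two derivatives; the
factor (mu / eps)^2 is the price of mu^2 times a second derivative. *)
Lemma remainder_norms (eps mu alpha Ca B H : R) (A : R -> 'M[R]_2) (Rm : R -> 'cV[R]_2)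
    (r : 'I_2 -> nat -> R -> R) :
  0 < eps -> eps <= mu -> 0 < alpha -> 0 <= Ca -> 0 <= B -> 1 <= H ->
  (forall i j, ctsI (fun x => A x i j)) ->
  (forall i j x, 0 <= x <= 1 -> `|A x i j| <= Ca) ->
  (forall l, tower (r l)) ->
  (forall l x, 0 <= x <= 1 -> cpt Rm l x = r l 0%N x) ->
  (forall l k x, (k <= 2)%N -> 0 <= x <= 1 -> `|r l k x| <= B * (H / eps) ^+ k) ->
  let C := 2 * (1 + H ^+ 2 + 2 * Ca) + 2 * (H + alpha) in
  [/\ (forall l, twice_differentiable (cpt Rm l)),
      ((bdnorm Rm)%:E + L2normv (opL eps mu A Rm) <= (C * (mu / eps) ^+ 2 * B)%:E)%E &
      (energy_norm eps mu alpha Rm <= (C * (mu / eps) ^+ 2 * B)%:E)%E].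
Proof.
move=> eps0 em al0 Ca0 B0 H1 cA bA tr rE rb C.
have mu0 : 0 < mu by exact: lt_le_trans em.
pose q := mu / eps.
have q1 : 1 <= q by rewrite ler_pdivlMr// mul1r.
have q2 : 1 <= q ^+ 2 by rewrite exprn_ege1.
have oc (x : R) : 0 < x < 1 -> 0 <= x <= 1 by move=> /andP[/ltW -> /ltW ->].
have rE' l (x : R) : 0 < x < 1 -> cpt Rm l x = r l 0%N x by move=> /oc; exact: rE.
have D l n x : 0 < x < 1 -> derive1n n (cpt Rm l) x = r l n x.
  by move=> x01; have [] := tower_derive1n (tr l) (rE' l) n x01.
have Ddiff l n x : 0 < x < 1 -> derivable (derive1n n (cpt Rm l)) x 1.
  by move=> x01; have [] := tower_derive1n (tr l) (rE' l) n x01.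
have rb0 l x : 0 <= x <= 1 -> `|r l 0%N x| <= B.
  by move=> x01; have := rb l 0%N x isT x01; rewrite expr0 mulr1.
split.
- move=> l; split.
    by apply: eq_ctsI (fun x x01 => esym (rE l x x01)) ((tr l).1 0%N).
  by move=> x x01; split; [exact: (Ddiff l 0%N)|exact: (Ddiff l 1%N)].
- have bd (x : R) : 0 <= x <= 1 -> enorm (Rm x) <= B + B.
    by move=> x01; apply: enorm_le => //; rewrite -/(cpt Rm _ x) rE// rb0.
  have bdn : bdnorm Rm <= 2 * B.
    have h0 : enorm (Rm 0) <= B + B by apply: bd; rewrite lexx ler01.
    have h1 : enorm (Rm 1) <= B + B by apply: bd; rewrite lexx ler01.
    by rewrite /bdnorm ge_max; apply/andP; split; lra.
  pose e l x := - (dcoef eps mu l * r l 2%N x) +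
    (A x l ord0 * r ord0 0%N x + A x l ord_max * r ord_max 0%N x).
  have eE l x : 0 < x < 1 -> opL eps mu A Rm x l ord0 = e l x.
    move=> x01; rewrite /opL !mxE !big_ord_recl !big_ord0 !mxE.
    have lm : lift ord0 ord0 = ord_max :> 'I_2 by apply: val_inj.
    rewrite lm -!/(cpt Rm _ x) !rE' ?x01// !D// /e /dcoef.
    by move: l; apply: ord2E; rewrite /= ?mulr1n ?mulr0n; ring.
  have ce l : ctsI (e l).
    apply: ctsID; first by apply: ctsIN; apply: ctsIM; [exact: ctsI_cst|exact: (tr l).1].
    by apply: ctsID; apply: ctsIM => //; exact: (tr _).1.
  have eb l x : 0 <= x <= 1 -> `|e l x| <= (H ^+ 2 + 2 * Ca) * q ^+ 2 * B.
    move=> x01; apply: le_trans (ler_normD _ _) _; rewrite normrN normrM.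
    have hd : `|dcoef eps mu l| <= mu ^+ 2.
      rewrite /dcoef; case: ifP => _; rewrite ger0_norm ?sqr_ge0//.
      by apply: ler_exprn => //; exact: ltW.
    have h1 := ler_pM (normr_ge0 _) (normr_ge0 _) hd (rb l 2%N x isT x01).
    have -> : (H ^+ 2 + 2 * Ca) * q ^+ 2 * B = mu ^+ 2 * (B * (H / eps) ^+ 2) + 2 * Ca * B * q ^+ 2.
      by rewrite /q; field; rewrite gt_eqF.
    apply: lerD => //; apply: le_trans (ler_normD _ _) _; rewrite !normrM.
    have h2 := ler_pM (normr_ge0 _) (normr_ge0 _) (bA l ord0 x x01) (rb0 ord0 x x01).
    have h3 := ler_pM (normr_ge0 _) (normr_ge0 _) (bA l ord_max x x01) (rb0 ord_max x x01).
    have h4 := ler_wpM2l (mulr_ge0 Ca0 B0) q2; lra.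
  have K0 : 0 <= (H ^+ 2 + 2 * Ca) * q ^+ 2 * B.
    by rewrite mulr_ge0// mulr_ge0 ?sqr_ge0// addr_ge0 ?sqr_ge0// mulr_ge0.
  have Lb : (L2normv (opL eps mu A Rm) <= (2 * ((H ^+ 2 + 2 * Ca) * q ^+ 2 * B))%:E)%E.
    apply: normI2_le_sup.
      apply: (@eq_measurable_I R (fun x => Num.sqrt (e ord0 x * e ord0 x + e ord_max x * e ord_max x))).
        move=> x x01; rewrite /enorm big_ord_recl big_ord1.
        have -> : lift ord0 ord0 = ord_max :> 'I_2 by apply: val_inj.
        by rewrite !eE// !expr2.
      apply: ctsI_measurable; apply: (ctsI_comp (@sqrt_continuous R)).
      by apply: ctsID; exact: ctsIM.
    move=> x x01; rewrite ger0_norm ?sqrtr_ge0//.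
    apply: le_trans (enorm_le K0 K0 _ _) _; last by lra.
      by rewrite eE// eb// oc.
    by rewrite eE// eb// oc.
  have [s [s0 sB sE]] := normI2_fin Lb; rewrite /L2normv sE.
  rewrite -EFinD lee_fin -/q.
  have h5 := ler_wpM2l B0 q2.
  have h6 : 0 <= 2 * (H + alpha) * q ^+ 2 * B.
    by rewrite mulr_ge0// mulr_ge0 ?sqr_ge0//; lra.
  rewrite /C; lra.
- have nb l k : (k <= 2)%N -> (normI 2%:E (derive1n k (cpt Rm l)) <= (B * (H / eps) ^+ k)%:E)%E.
    move=> k2; apply: normI2_le_sup.
      apply: (@eq_measurable_I R (r l k)) => [x x01|]; first by rewrite D.
      by apply: ctsI_measurable; exact: (tr l).1.
    by move=> x x01; rewrite D// rb// oc.
  rewrite /energy_norm.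
  have [u1 [u10 u1B E1]] := normI2_fin (nb ord0 1%N isT).
  have [v1 [v10 v1B E2]] := normI2_fin (nb ord_max 1%N isT).
  have [u0 [u00 u0B E3]] := normI2_fin (nb ord0 0%N isT).
  have [v0 [v00 v0B E4]] := normI2_fin (nb ord_max 0%N isT).
  rewrite derive1n1 in E1; rewrite derive1n1 in E2.
  rewrite derive1n0 in E3; rewrite derive1n0 in E4.
  rewrite E1 E2 E3 E4 -!EFin_expe.
  rewrite -[X in sqrte X]/((eps ^+ 2 * u1 ^+ 2 + mu ^+ 2 * v1 ^+ 2 +
    alpha ^+ 2 * (u0 ^+ 2 + v0 ^+ 2))%:E).
  have C0 : 0 <= C.
    by rewrite /C; have := sqr_ge0 H; lra.
  have CB0 : 0 <= C * q ^+ 2 * B by rewrite mulr_ge0// mulr_ge0// sqr_ge0.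
  have -> : (C * (mu / eps) ^+ 2 * B)%:E = sqrte ((C * q ^+ 2 * B) ^+ 2)%:E.
    by rewrite /= sqrtr_sqr ger0_norm.
  rewrite lee_sqrt ?lee_fin ?sqr_ge0//.
  rewrite expr0 mulr1 in u0B; rewrite expr0 mulr1 in v0B.
  rewrite expr1 in u1B; rewrite expr1 in v1B.
  have s1 := ler_wpM2l (sqr_ge0 eps) (ler_exprn 2 u10 u1B).
  have s2 := ler_wpM2l (sqr_ge0 mu) (ler_exprn 2 v10 v1B).
  have s3 := ler_wpM2l (sqr_ge0 alpha) (lerD (ler_exprn 2 u00 u0B) (ler_exprn 2 v00 v0B)).
  have e1 : eps ^+ 2 * (B * (H / eps)) ^+ 2 = (B * H) ^+ 2 by field; rewrite gt_eqF.
  have e2 : mu ^+ 2 * (B * (H / eps)) ^+ 2 = (B * H) ^+ 2 * q ^+ 2.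
    by rewrite /q; field; rewrite gt_eqF.
  rewrite e1 in s1; rewrite e2 in s2.
  have BH := sqr_ge0 (B * H); have BB := sqr_ge0 B.
  have q4 : q ^+ 2 <= q ^+ 4.
    by rewrite (_ : 4 = 2 + 2)%N// exprD ler_peMl ?sqr_ge0.
  have t1 := ler_wpM2l BH (le_trans q2 q4); have t2 := ler_wpM2l BH q4.
  have aB : 0 <= alpha ^+ 2 * (B ^+ 2 + B ^+ 2) by rewrite mulr_ge0 ?sqr_ge0// addr_ge0.
  have t3 := ler_wpM2l aB (le_trans q2 q4).
  have CC : 2 * H ^+ 2 + 2 * alpha ^+ 2 <= C ^+ 2.
    have : 2 * (H + alpha) <= C by rewrite /C; have := sqr_ge0 H; clear - Ca0; lra.
    have Ha : 0 <= 2 * (H + alpha) by clear - H1 al0; lra.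
    move=> /(ler_exprn 2 Ha) h; apply: le_trans h.
    have Hal : 0 <= H * alpha by rewrite mulr_ge0 ?ltW//; clear - H1; lra.
    by have := sqr_ge0 H; have := sqr_ge0 alpha; clear - Hal; lra.
  have -> : (C * q ^+ 2 * B) ^+ 2 = C ^+ 2 * (B ^+ 2 * q ^+ 4) by ring.
  have Bq : 0 <= B ^+ 2 * q ^+ 4 by rewrite mulr_ge0// (le_trans _ q4)// sqr_ge0.
  have := ler_wpM2r Bq CC.
  move: s1 s2 s3 t1 t2 t3; set Q4 := q ^+ 4; set Q2 := q ^+ 2.
  rewrite exprMn; clear; lra.
Qed.

End FinalNorms.

(** * The decomposition *)

Section Assembly.
Context {R : realType}.

Lemma data_towers (F : R -> 'cV[R]_2) (A : R -> 'M[R]_2) (Cf gf Cg gg Ca ga : R) :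
  0 < Cf -> 0 < gf -> 0 < Cg -> 0 < gg -> 0 < Ca -> 0 < ga ->
  analyticI Cf gf (cpt F ord0) -> analyticI Cg gg (cpt F ord_max) ->
  (forall i j : 'I_2, analyticI Ca ga (fun x => A x i j)) ->
  exists (a : 'I_2 -> 'I_2 -> nat -> R -> R) (f : 'I_2 -> nat -> R -> R),
  [/\ (forall i j, tower (a i j)) /\ (forall l, tower (f l)),
      forall i j x, 0 <= x <= 1 -> a i j 0%N x = A x i j,
      forall l x, 0 <= x <= 1 -> f l 0%N x = cpt F l x,
      forall i j n x, 0 <= x <= 1 -> `|a i j n x| <= Ca * ga ^+ n * n`!%:R &
      forall l n x, 0 <= x <= 1 -> `|f l n x| <= (Cf + Cg) * (gf + gg) ^+ n * n`!%:R].
Proof.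
move=> Cf0 gf0 Cg0 gg0 Ca0 ga0 hf hg ha.
have hF l : exists u, [/\ tower u, forall x, 0 <= x <= 1 -> u 0%N x = cpt F l x &
    forall n x, 0 <= x <= 1 -> `|u n x| <= (Cf + Cg) * (gf + gg) ^+ n * n`!%:R].
  have W C g n : 0 < C -> 0 < g -> C <= Cf + Cg -> g <= gf + gg ->
      C * g ^+ n * n`!%:R <= (Cf + Cg) * (gf + gg) ^+ n * n`!%:R.
    move=> C0 g0 CC gG; apply: ler_wpM2r => //; apply: ler_pM => //; first exact: ltW.
      by rewrite exprn_ge0// ltW.
    by apply: ler_exprn => //; exact: ltW.
  move: l; apply: ord2E.
    have [u [tu u0 ub]] := analyticI_tower Cf0 gf0 hf; exists u; split=> // n x x01.
    by apply: le_trans (ub n x x01) _; apply: W => //; rewrite lerDl ltW.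
  have [u [tu u0 ub]] := analyticI_tower Cg0 gg0 hg; exists u; split=> // n x x01.
  by apply: le_trans (ub n x x01) _; apply: W => //; rewrite lerDr ltW.
have [f fP] := choice hF.
have hA (ij : 'I_2 * 'I_2) := analyticI_tower Ca0 ga0 (ha ij.1 ij.2).
have [a aP] := choice hA.
exists (fun i j => a (i, j)), f; split.
- by split=> [i j|l]; [have [] := aP (i, j)|have [] := fP l].
- by move=> i j; have [] := aP (i, j).
- by move=> l; have [] := fP l.
- by move=> i j; have [] := aP (i, j).
- by move=> l; have [] := fP l.
Qed.

Lemma coercive_tower (alpha : R) (A : R -> 'M[R]_2) (a : 'I_2 -> 'I_2 -> nat -> R -> R) :
  (forall (xi : 'cV[R]_2) (x : R), 0 <= x <= 1 ->
     alpha ^+ 2 * (xi^T *m xi) ord0 ord0 <= (xi^T *m A x *m xi) ord0 ord0) ->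
  (forall i j x, 0 <= x <= 1 -> a i j 0%N x = A x i j) -> coercive alpha a.
Proof.
move=> hA aE x x01 p q; rewrite /quadform !aE//.
have := hA (\col_i (if i == ord0 then p else q)) x x01.
rewrite !mxE !sum_ord2 !mxE !sum_ord2 !mxE !eqxx /= => h.
by apply: le_trans (_ : _ <= _) (le_trans h _); rewrite le_eqVlt; apply/orP; left; apply/eqP; ring.
Qed.

(** Although U is only a weak solution, its difference to the smooth part solves the same
system, with the residual of the smooth part, in the classical sense and with all
derivatives up to the boundary. *)
Lemma layer_part (eps mu : R) (A : R -> 'M[R]_2) (F U : R -> 'cV[R]_2)
    (a : 'I_2 -> 'I_2 -> nat -> R -> R) (f W G : 'I_2 -> nat -> R -> R) :
  0 < eps -> 0 < mu ->
  (forall i j, tower (a i j)) -> (forall l, tower (f l)) ->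
  (forall i j x, 0 <= x <= 1 -> a i j 0%N x = A x i j) ->
  (forall l x, 0 <= x <= 1 -> f l 0%N x = cpt F l x) ->
  (forall l, tower (W l) /\ tower (G l)) ->
  (forall l n x, 0 <= x <= 1 ->
     G l n x = f l n x - sysop a W l n x + dcoef eps mu l * W l n.+2 x) ->
  solution eps mu A F U ->
  exists v : 'I_2 -> nat -> R -> R, [/\ forall l, tower (v l),
    forall l x, v l 0%N x = cpt U l x - W l 0%N x,
    forall l n x, dcoef eps mu l * v l n.+2 x = sysop a v l n x - G l n x &
    forall l, v l 0%N 0 = - W l 0%N 0 /\ v l 0%N 1 = - W l 0%N 1].
Proof.
move=> eps0 mu0 ta tf aE fE tWG GE sol.
have d0 l : dcoef eps mu l != 0 by rewrite /dcoef; case: ifP => _; rewrite gt_eqF// exprn_gt0.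
have cA i j : ctsI (fun x => A x i j) by exact: eq_ctsI (aE i j) ((ta i j).1 0%N).
have cF l : ctsI (cpt F l) by exact: eq_ctsI (fE l) ((tf l).1 0%N).
have [hU hG] := solution_green cA cF sol.
have cU l : ctsI (cpt U l) by have [] := hU l.
have hu1 l : exists u1, [/\ ctsI u1,
    forall x : R, 0 < x < 1 -> is_derive x 1 (cpt U l) (u1 x) &
    forall x : R, 0 < x < 1 -> is_derive x 1 u1
      (- (cpt F l x - (A x l ord0 * cpt U ord0 x + A x l ord_max * cpt U ord_max x))
        / dcoef eps mu l)].
  apply: (green_primitive (d0 l) _ (cU l) (hG l)).
  by apply: ctsIB => //; apply: ctsID; apply: ctsIM.
have [u1 u1P] := choice hu1.
have [||||v [tv v0 veq]] := @bootstrap R eps mu a G (fun l x => cpt U l x - W l 0%N x)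
  (fun l x => u1 l x - W l 1%N x) d0 ta.
- by move=> l; exact: (tWG l).2.
- move=> l; split; apply: ctsIB; [exact: cU|exact: (tWG l).1.1|by have [] := u1P l|
    exact: (tWG l).1.1].
- by move=> l x x01; apply: isD_B; [have [_ h _] := u1P l; exact: h|exact: (tWG l).1.2].
- move=> l x x01; have [_ _ h] := u1P l.
  have x01' : 0 <= x <= 1 by move: x01 => /andP[/ltW -> /ltW ->].
  apply: (is_derive_eq (isD_B (h x x01) ((tWG l).1.2 1%N x x01))).
  rewrite (GE l 0%N x x01') /sysop !leib0 !aE// fE//.
  by field; exact: d0.
exists v; split=> // [l x|l]; first by rewrite v0.
by rewrite !v0; have [_ -> ->] := hU l; rewrite !sub0r.
Qed.

End Assembly.

Theorem theorem6p1 (R : realType)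
  (F : R -> 'cV[R]_2) (A : R -> 'M[R]_2)
  (Cf gf Cg gg Ca ga alpha : R)
  (Cf0 : 0 < Cf) (gf0 : 0 < gf) (Cg0 : 0 < Cg) (gg0 : 0 < gg)
  (Ca0 : 0 < Ca) (ga0 : 0 < ga) (alpha0 : 0 < alpha)
  (hf : analyticI Cf gf (cpt F ord0))
  (hg : analyticI Cg gg (cpt F ord_max))
  (ha : forall i j : 'I_2, analyticI Ca ga (fun x => A x i j))
  (hA : forall (xi : 'cV[R]_2) (x : R), 0 <= x <= 1 ->
     alpha ^+ 2 * (xi^T *m xi) ord0 ord0 <= (xi^T *m A x *m xi) ord0 ord0) :
  exists CW CBL gW gBL delta C b : R,
    (0 < CW /\ 0 < CBL /\ 0 < gW /\ 0 < gBL /\ 0 < delta /\ 0 < C /\ 0 < b) /\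
    forall eps mu : R, 0 < eps -> eps <= mu -> mu <= 1 ->
    forall U : R -> 'cV[R]_2, solution eps mu A F U ->
    exists W UBL Rem : R -> 'cV[R]_2,
      (forall x : R, 0 <= x <= 1 -> U x = W x + UBL x + Rem x) /\
      (forall i : 'I_2, classA 1 CW gW (cpt W i)) /\
      (forall i : 'I_2,
         classBL2 (delta * mu) CBL (gBL * (mu / eps)) (cpt UBL i)) /\
      (forall i : 'I_2, twice_differentiable (cpt Rem i)) /\
      ((bdnorm Rem)%:E + L2normv (opL eps mu A Rem)
         <= (C * (mu / eps) ^+ 2 * expR (- b / mu))%:E)%E /\
      (energy_norm eps mu alpha Rem
         <= (C * (mu / eps) ^+ 2 * expR (- b / mu))%:E)%E.
Proof.
have [a [f [[ta tf] aE fE ba bf]]] := data_towers Cf0 gf0 Cg0 gg0 Ca0 ga0 hf hg ha.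
have coa := coercive_tower hA aE.
have CC0 : 0 < Cf + Cg by exact: addr_gt0.
have gg00 : 0 < gf + gg by exact: addr_gt0.
have [C0 [g0 [k0 [[C00 g00 k00] smooth]]]] :=
  smooth_part alpha0 Ca0 ga0 CC0 gg00 ta coa ba tf bf.
(* A rate attained by the residual and for which layers are supersolutions. *)
pose kap := Num.min k0 (alpha / 4).
have kap0 : 0 < kap by rewrite lt_min k00 divr_gt0.
have kapk : kap <= k0 by rewrite ge_min lexx.
have kapa : 8 * kap ^+ 2 <= alpha ^+ 2.
  have : kap <= alpha / 4 by rewrite ge_min lexx orbT.
  move=> /(ler_exprn 2 (ltW kap0)); have := sqr_ge0 alpha; clear; lra.
clearbody kap.
have [X [gV [X0 gV0 layers]]] := layer_bounds alpha0 Ca0 ga0 C00 C00 g00 kap0 kapa.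
have gV1 : 1 <= gV + 1 by rewrite lerDr ltW.
have [Cp [Gam [b [Cp0 Gam0 b0 approx]]]] := polynomial_approximation X0 gV1 kap0.
(* Growth is measured in powers of N up to here, and in powers of 1 / eps from now on:
   below, N <= 4 / eps. *)
pose H := 4 * Gam + 1.
have H1 : 1 <= H by rewrite /H lerDr mulr_ge0// ltW.
have H0 : 0 < H by exact: lt_le_trans H1.
pose Cr := 2 * (1 + H ^+ 2 + 2 * Ca) + 2 * (H + alpha).
have Cr0 : 0 < Cr by have := exprn_gt0 2 H0; rewrite /Cr; clear - H0 Ca0 alpha0; lra.
(* The weight of the boundary layer class takes half of the rate b: delta = 2 / b; then
   (H delta (mu / eps))^n / (delta mu)^n = (H / eps)^n. *)
exists C0, (2 * Cp), g0, (H * (2 / b)), (2 / b), (Cr * Cp), b.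
have d20 : 0 < 2 / b by rewrite divr_gt0.
have Hd : 0 < H * (2 / b) by rewrite mulr_gt0.
have CrC : 0 < Cr * Cp by rewrite mulr_gt0.
have Cp2 : 0 < 2 * Cp by rewrite mulr_gt0.
split; first by do ![split=> //].
move=> eps mu eps0 em mu1 U sol.
have mu0 : 0 < mu by exact: lt_le_trans eps0 em.
have eps1 : eps <= 1 by exact: le_trans em mu1.
have [W [G [tWG bW bG GE]]] := smooth eps mu eps0 em.
have [v [tv v0 veq vbd]] := layer_part eps0 mu0 ta tf aE fE tWG GE sol.
have [N [Nge Nle N3]] : exists N : nat, [/\ 1 / eps <= N%:R, N%:R <= 4 / eps & (2 < N)%N].
  have e1 : 1 <= 1 / eps by rewrite ler_pdivlMr// mul1r.
  have /andP[h1 h2] := truncn_itv (le_trans ler01 e1).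
  exists (Num.trunc (1 / eps) + 3)%N; split; last by rewrite addn3.
    by move: h2; rewrite -addn1 !natrD; clear; lra.
  have -> : 4 / eps = 4 * (1 / eps) by rewrite mul1r.
  by rewrite natrD; clear - h1 e1; lra.
have e0 : 0 <= expR (- (b / mu)) by exact: expR_ge0.
have bv l n x : (n <= N)%N -> 0 <= x <= 1 ->
    `|v l n x| <= X * ((gV + 1) * N%:R) ^+ n * layer kap mu x.
  move=> nN x01.
  apply: le_trans (layers eps mu N a v G eps0 em Nge coa ba tv
    (fun l n x _ => veq l n x) _ _ l n x nN x01) _.
  - move=> i; have [-> ->] := vbd i; rewrite !normrN.
    have B y : 0 <= y <= 1 -> `|W i 0%N y| <= C0.
      by move=> y01; have := bW i 0%N y y01; rewrite expr0 fact0 !mulr1.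
    by split; apply: B; rewrite lexx ler01.
  - move=> i k y y01; apply: le_trans (bG i k y y01) _; apply: ler_wpM2l.
      by rewrite !mulr_ge0 ?exprn_ge0//; exact: ltW.
    rewrite ler_expR lerN2; apply: ler_wpM2r => //.
    by rewrite invr_ge0 ltW.
  - apply: ler_wpM2r; first exact/ltW/layer_gt0.
    apply: ler_wpM2l; first exact: ltW.
    apply: ler_exprn; first by rewrite mulr_ge0// ltW.
    by apply: ler_wpM2r => //; rewrite lerDl.
have muN : 1 / mu <= N%:R.
  by apply: le_trans Nge; rewrite !div1r lef_pV2// posrE.
have hp l := approx mu N (v l) mu0 muN (tv l) (bv l).
have [p pP] := choice hp.
have GN k : (Gam * N%:R) ^+ k <= (H / eps) ^+ k.
  apply: ler_exprn; first by rewrite mulr_ge0// ltW.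
  apply: le_trans (ler_wpM2l (ltW Gam0) Nle) _.
  have : 0 < 1 / eps by rewrite divr_gt0.
  by rewrite /H; clear; lra.
exists (fun x => \col_l W l 0%N x), (fun x => \col_l (p l).[x]),
  (fun x => U x - \col_l W l 0%N x - \col_l (p l).[x]).
set W0 := fun x => \col_l W l 0%N x; set UB := fun x => \col_l (p l).[x].
set Rm := fun x => _.
have W0E l : cpt W0 l = W l 0%N by apply/funext => x; rewrite /cpt mxE.
have UBE l : cpt UB l = horner (p l) by apply/funext => x; rewrite /cpt mxE.
split; first by move=> x _; apply/matrixP => i j; rewrite !mxE; ring.
split.
  move=> l; rewrite W0E; have tW := (tWG l).1; split.
    split; first exact: tW.1.
    by move=> n x x01; have [] := tower_derive1n tW (fun x _ => erefl) n x01.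
  move=> n; apply: normI_oo_le_sup => x x01.
  have [-> _] := tower_derive1n tW (fun x _ => erefl) n x01.
  have x01' : 0 <= x <= 1 by move: x01 => /andP[/ltW -> /ltW ->].
  apply: le_trans (bW l n x x01') _; apply: ler_wpM2l.
    by rewrite mulr_ge0 ?exprn_ge0//; exact: ltW.
  apply: le_trans (_ : n%:R ^+ n <= _); first by rewrite -natrX ler_nat fact_le_expn.
  by apply: ler_exprn => //; rewrite le_max lexx.
have tp l := tower_horner (p l).
have pD l n x : 0 < x < 1 -> derive1n n (horner (p l)) x = ptower (p l) n x.
  move=> x01; have [] := @tower_derive1n R _ (horner (p l)) (tp l) _ n x x01 => //.
have oc (x : R) : 0 < x < 1 -> 0 <= x <= 1 by move=> /andP[/ltW -> /ltW ->].
split.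
  move=> l; rewrite UBE; split; first exact: horner_entire.
  move=> n.
  have Hn : 0 <= (H / eps) ^+ n by rewrite exprn_ge0// divr_ge0// ltW.
  have -> : 2 * Cp * Num.sqrt (2 / b * mu) * (H * (2 / b) * (mu / eps)) ^+ n * (2 / b * mu) ^- n =
     2 * (Cp * (H / eps) ^+ n) * Num.sqrt (2 / b * mu).
    have -> : H * (2 / b) * (mu / eps) = H / eps * (2 / b * mu) by ring.
    have q0 : (2 / b * mu) ^+ n != 0 by rewrite expf_neq0// gt_eqF// mulr_gt0// divr_gt0.
    by rewrite exprMn; field.
  apply: weighted_layer_norm => //.
  - by rewrite mulr_ge0// ltW.
  - apply: (@eq_measurable_I R (ptower (p l) n)) => [x x01|]; first by rewrite pD.
    by apply: ctsI_measurable; exact: (tp l).1.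
  - move=> x x01; rewrite pD//; have [_ h] := pP l.
    apply: le_trans (h n x (oc x x01)) _; apply: ler_wpM2r; first exact/ltW/layer_gt0.
    by apply: ler_wpM2l; [exact: ltW|exact: GN].
have cA i j : ctsI (fun x => A x i j) by exact: eq_ctsI (aE i j) ((ta i j).1 0%N).
have bA i j x : 0 <= x <= 1 -> `|A x i j| <= Ca.
  by move=> x01; rewrite -aE//; have := ba i j 0%N x x01; rewrite expr0 fact0 !mulr1.
pose r l k x := v l k x - ptower (p l) k x.
have tr l : tower (r l) by exact: towerB (tv l) (tp l).
have rE l x : 0 <= x <= 1 -> cpt Rm l x = r l 0%N x.
  by move=> _; rewrite /r v0 /ptower derivn0 /cpt /Rm !mxE.
have rb l k x : (k <= 2)%N -> 0 <= x <= 1 ->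
    `|r l k x| <= (Cp * expR (- (b / mu))) * (H / eps) ^+ k.
  move=> k2 x01; have [h _] := pP l.
  apply: le_trans (h k x _ x01) _; first by rewrite (leq_trans k2)// ltnW.
  by rewrite mulrAC; apply: ler_wpM2l; [rewrite mulr_ge0// ltW|exact: GN].
have B0 : 0 <= Cp * expR (- (b / mu)) by rewrite mulr_ge0// ltW.
have [h1 h2 h3] := remainder_norms eps0 em alpha0 (ltW Ca0) B0 H1 cA bA tr rE rb.
have E : Cr * (mu / eps) ^+ 2 * (Cp * expR (- (b / mu))) =
    Cr * Cp * (mu / eps) ^+ 2 * expR (- b / mu) by rewrite mulNr; ring.
by rewrite -/Cr E in h2 h3; split.
Qed.
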